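(* Let $D\in\mathbb{N}$, $M>m>0$, and let $\mathcal{Q}_N=(V_N,E_N,L_N,W_N,\beta_N,U_N)$, $N\in\mathbb{N}$, be a sequence of finite quantum graphs all satisfying the $(D,m,M)$-bounds. Then there is a subsequence $\mathcal{Q}_{N_k}$ which converges in the sense of Benjamini-Schramm; that is, there exists a probability measure $\mathbb{P}\in\mathcal{P}(\mathbf{Q}_*^{D,m,M})$ such that $\nu_{\mathcal{Q}_{N_k}}\to\mathbb{P}$ weakly, i.e. for every bounded continuous $F:\mathbf{Q}_*^{D,m,M}\to\mathbb{C}$, $\int F\,\mathrm{d}\nu_{\mathcal{Q}_{N_k}}\to\int F\,\mathrm{d}\mathbb{P}$.
   Context: **Quantum graphs.** $G=(V,E)$ is a connected combinatorial graph, $V$ countable, without loops or multiple edges; $d(v)$ is the degree; $\mathcal{B}$ is the set of oriented edges (bonds); for $b\in\mathcal{B}$, $\hat b$ is the reversed bond, $o(b),t(b)$ its origin and terminus, $e(b)\in E$ the underlying edge. $L:E\to(0,\infty)$ is a length function, $L_b=L(e(b))$. The metric graph is $\mathcal{G}=\{(b,x):b\in\mathcal{B},x\in(0,L_b)\}/\simeq$ with $(b,x)\simeq(\hat b,L_b-x)$ (vertices are not included). A quantum graph is $\mathcal{Q}=(V,E,L,W,\beta,U)$ where $W=(W_b)_{b\in\mathcal{B}}$, $W_b\in C^0([0,L_b];\mathbb{R})$ with $W_{\hat b}(L_b-x)=W_b(x)$; for each $v\in V$, $\beta^v:\{1,\dots,d(v)\}\to\{b:o(b)=v\}$ is a bijection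 and $U_v$ is a unitary $d(v)\times d(v)$ matrix. Let $P_v^{\mathrm R}$ be the orthogonal projection onto the sum of the eigenspaces of $U_v$ for eigenvalues other than $\pm1$, and $\Lambda_v=-\mathrm{i}(U_v+\mathrm{Id})^{-1}(U_v-\mathrm{Id})$ on the range of $P_v^{\mathrm R}$. Standing assumption: $\sup_v d(v)<\infty$, $\inf_e L(e)>0$, $\sup_e L(e)<\infty$, $\sup_b\|W_b\|_\infty<\infty$, $\sup_v\|\Lambda_v\|<\infty$. $\mathcal{Q}$ is finite if $|V|,|E|<\infty$; then $\mathcal{L}(\mathcal{Q})=\sum_{e\in E}L(e)$. **$(D,m,M)$-bounds.** $\mathcal{Q}$ satisfies the $(D,m,M)$-bounds if $d(v)\le D$ for all $v$, $m\le L(e)\le M$ for all $e$, $\|\Lambda_v\|\le M$ for all $v$, and every $W_b$ is Lipschitz with $\|W_b\|_\infty\le M$ and Lipschitz constant $\le M$. **Rooted quantum graphs.** A rooted quantum graph $(\mathcal{Q},\mathbf{x_0})$ is a quantum graph with a marked point $\mathbf{x_0}=(b_0,x_0)\in\mathcal{G}$ (recorded through a representative $(b_0,x_0)$). $\mathcal{Q}^{\mathbf{x_0}}=(V^{\mathbf{x_0}},E^{\mathbf{x_0}},L^{\mathbf{x_0}},W^{\mathbf{x_0}},\beta^{\mathbf{x_0}},U^{\mathbf{x_0}})$, with underlying graph $G^{\mathbf{x_0}}$, is obtained by adding a vertex $v_{\mathbf{x_0}}$ at $\mathbf{x_0}$: the edge $e(b_0)$ is replaced by $\{o(b_0),v_{\mathbf{x_0}}\}$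 of length $x_0$ and $\{t(b_0),v_{\mathbf{x_0}}\}$ of length $L_{b_0}-x_0$, with potentials obtained by restricting $W_{b_0}$ and $W_{\hat b_0}$ to the corresponding sub-intervals (translated to start at $0$); all other data are unchanged (a bond at $o(b_0)$ or $t(b_0)$ that was subdivided is replaced in the labelling by the sub-bond with the same origin); at $v_{\mathbf{x_0}}$ label $1$ is $(v_{\mathbf{x_0}},o(b_0))$, label $2$ is $(v_{\mathbf{x_0}},t(b_0))$ and $U_{v_{\mathbf{x_0}}}=\begin{pmatrix}0&1\\1&0\end{pmatrix}$ (Kirchhoff condition). Two rooted quantum graphs are equivalent if there is a graph isomorphism $\phi:G^{\mathbf{x_0}}\to G'^{\mathbf{x_0'}}$ with $\phi(v_{\mathbf{x_0}})=v_{\mathbf{x_0'}}$, preserving lengths, potentials and unitary matrices, with $\phi\circ\beta^{\mathbf{x_0}}=\beta'^{\mathbf{x_0'}}$. $\mathbf{Q}_*$ is the set of equivalence classes $[\mathcal{Q},\mathbf{x_0}]$, with the metric $d=\frac1{1+\alpha}$, where $\alpha$ is the supremum of those $r>0$ such that there is an isomorphism $\phi$ of the (induced, combinatorial) balls of radius $\lfloor r\rfloor$ around $v_{\mathbf{x_0}}$, $v_{\mathbf{x_0'}}$ in $G^{\mathbf{x_0}},G'^{\mathbf{x_0'}}$, mapping root to root and compatible with the labellings, such that over the edges $e$, bonds $b$ and vertices $v$ of the ball all of $|L^{\mathbf{x_0}}_e-L'^{\mathbf{x_0'}}_{\phi(e)}|$, $\sup_{t\in[0,1]}|W^{\mathbf{x_0}}_b(tL^{\mathbf{x_0}}_b)-W'^{\mathbf{x_0'}}_{\phi(b)}(tL'^{\mathbf{x_0'}}_{\phi(b)})|$,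 $\|U^{\mathbf{x_0}}_v-U'^{\mathbf{x_0'}}_{\phi(v)}\|$ (taken as $+\infty$ if the sizes differ) are $<1/r$. $\mathbf{Q}_*^{D,m,M}\subset\mathbf{Q}_*$ is the set of classes $[\mathcal{Q},\mathbf{x_0}]$ with $\mathcal{Q}$ satisfying the $(D,m,M)$-bounds. $\mathcal{P}(X)$ is the set of Borel probability measures on $X$. **Measure of a finite quantum graph.** $\nu_{\mathcal{Q}}=\frac{1}{2\mathcal{L}(\mathcal{Q})}\sum_{b_0\in\mathcal{B}}\int_0^{L_{b_0}}\delta_{[\mathcal{Q},(b_0,x_0)]}\,\mathrm{d}x_0$. *)

(* Defs.v *)
From HB Require Import structures.
From mathcomp Require Import all_boot all_order all_algebra.
From mathcomp Require Import all_classical all_reals all_analysis.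
From mathcomp Require Export complex.

Set Implicit Arguments.
Unset Strict Implicit.
Unset Printing Implicit Defensive.

Import Order.TTheory GRing.Theory Num.Theory numFieldNormedType.Exports.

Local Open Scope classical_set_scope.
Local Open Scope ring_scope.
Local Open Scope quotient_scope.

Section complex_matrices.
Variable R : realType.
Local Notation C := R[i].

Definition vnorm n (x : 'cV[C]_n) : R :=
  Num.sqrt (\sum_i (complex.Re (x i 0) ^+ 2 + complex.Im (x i 0) ^+ 2)).

Definition opnorm n (A : 'M[C]_n) : \bar R :=
  ereal_sup [set (vnorm (A *m x))%:E | x in [set x | vnorm x <= 1]].

Definition scat_dist n n' (U : 'M[C]_n) (U' : 'M[C]_n') : \bar R :=
  match pselect (n' = n) with
  | left e => opnorm (U - castmx (e, e) U')
  | right _ => +oo%E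
  end.

(* The range of P^R: the sum of the eigenspaces of U (acting on columns) for
   the eigenvalues other than 1 and -1. *)
Definition robin_space n (U : 'M[C]_n) : set 'cV[C]_n :=
  [set x | exists k (a : 'I_k -> C) (y : 'I_k -> 'cV[C]_n),
    (forall j, [/\ a j != 1, a j != -1 & U *m y j = a j *: y j]) /\
    x = \sum_j y j].

(* y = -i (U + Id)^-1 (U - Id) x, the inverse being that of the restriction of
   U + Id to the range of P^R. *)
Definition Lambda n (U : 'M[C]_n) (x y : 'cV[C]_n) : Prop :=
  [/\ robin_space U x, robin_space U y
    & (U + 1%:M) *m y = - 'i%C *: ((U - 1%:M) *m x)].

Definition Lambda_norm n (U : 'M[C]_n) : \bar R :=
  ereal_sup [set (vnorm xy.2)%:E | xy in
    [set xy : 'cV[C]_n * 'cV[C]_n | vnorm xy.1 <= 1 /\ Lambda U xy.1 xy.2]].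

End complex_matrices.

(* A bond from v to w is the pair (v, w); an edge is the set of its two
   endpoints. The values of [len] outside the edges, and of [pot b] outside
   `[0, L_b] or when b is not a bond, are irrelevant. [vert] is in Set because
   vertex sets are countable; this keeps the equivalence classes of rooted
   quantum graphs in a type. *)
Record qg_data (R : realType) := QgData {
  vert : Set;
  adj : vert -> vert -> bool;
  len : set vert -> R;
  pot : vert * vert -> R -> R;
  deg : vert -> nat;
  lab : forall v, 'I_(deg v) -> vert * vert;
  scat : forall v, 'M[R[i]]_(deg v) }.

HB.instance Definition _ (R : realType) (Q : qg_data R) := gen_eqMixin (vert Q).
HB.instance Definition _ (R : realType) (Q : qg_data R) :=
  gen_choiceMixin (vert Q).

Definition rev_bond (T : Type) (b : T * T) : T * T := (b.2, b.1).
Definition map_bond (T T' : Type) (f : T -> T') (b : T * T) : T' * T' :=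
  (f b.1, f b.2).
Definition edge_of (T : Type) (b : T * T) : set T := [set b.1; b.2].

Section quantum_graphs.
Variable R : realType.
Implicit Types Q : qg_data R.

Definition bonds Q : set (vert Q * vert Q) := [set b | adj b.1 b.2].
Arguments bonds : clear implicits.
Definition edges Q : set (set (vert Q)) := @edge_of _ @` bonds Q.
Arguments edges : clear implicits.
Definition blen (Q : qg_data R) (b : vert Q * vert Q) : R := len (edge_of b).

Record is_quantum_graph Q : Prop := IsQuantumGraph {
  vert_countable : countable [set: vert Q];
  adj_irr : irreflexive (@adj R Q);
  adj_sym : symmetric (@adj R Q);
  adj_connected : forall v w : vert Q,
    exists p : seq (vert Q), path (@adj R Q) v p /\ last v p = w;
  len_gt0 : forall e, edges Q e -> 0 < len e;
  pot_cont : forall b, bonds Q b -> {within `[0, blen b], continuous (pot b)};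
  pot_rev : forall b, bonds Q b -> forall x, x \in `[0, blen b] ->
    pot (rev_bond b) (blen b - x) = pot b x;
  lab_bij : forall v : vert Q,
    set_bij [set: 'I_(deg v)] [set b | bonds Q b /\ b.1 = v] (@lab R Q v);
  scat_unitary : forall v : vert Q, scat v \is unitarymx;
  deg_bounded : exists K, forall v : vert Q, (deg v <= K)%N;
  len_inf : exists2 c, 0 < c & forall e, edges Q e -> c <= len e;
  len_sup : exists K, forall e, edges Q e -> len e <= K;
  pot_bounded : exists K, forall b, bonds Q b ->
    forall x, x \in `[0, blen b] -> `|pot b x| <= K;
  Lambda_bounded : exists K : R,
    forall v : vert Q, (Lambda_norm (scat v) <= K%:E)%E }.

Record quantum_graph := QuantumGraph {
  qg_val :> qg_data R;
  qgP : is_quantum_graph qg_val }.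

Record DmM_bounds (D : nat) (m M : R) Q : Prop := DmMBounds {
  deg_le : forall v : vert Q, (deg v <= D)%N;
  len_itv : forall e, edges Q e -> m <= len e <= M;
  Lambda_le : forall v : vert Q, (Lambda_norm (scat v) <= M%:E)%E;
  pot_le : forall b, bonds Q b ->
    forall x, x \in `[0, blen b] -> `|pot b x| <= M;
  pot_lip : forall b, bonds Q b -> M.-lipschitz_(`[0, blen b]) (pot b) }.

Definition finite_graph Q : Prop :=
  finite_set [set: vert Q] /\ finite_set (edges Q).

Definition total_length Q : R := \sum_(e \in edges Q) len e.

(* Q^{x_0}; [None] is the new vertex v_{x_0}. *)
Section subdivision.
Variables (Q : qg_data R) (b0 : vert Q * vert Q) (x0 : R).

Definition sub_adj (v w : option (vert Q)) : bool :=
  match v, w with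
  | Some v, Some w => [&& adj v w, (v, w) != b0 & (v, w) != rev_bond b0]
  | Some u, None | None, Some u => (u == b0.1) || (u == b0.2)
  | None, None => false
  end.

Definition sub_len (e : set (option (vert Q))) : R :=
  if e == edge_of (None, Some b0.1) then x0
  else if e == edge_of (None, Some b0.2) then blen b0 - x0
  else len (Some @^-1` e).

Definition sub_pot (b : option (vert Q) * option (vert Q)) (x : R) : R :=
  match b with
  | (Some v, Some w) => pot (v, w) x
  | (Some v, None) => if v == b0.1 then pot b0 x else pot (rev_bond b0) x
  | (None, Some w) => if w == b0.1 then pot (rev_bond b0) (blen b0 - x0 + x)
                      else pot b0 (x0 + x)
  | (None, None) => 0
  end.

Definition sub_deg (v : option (vert Q)) : nat :=
  if v is Some u then deg u else 2.

Definition sub_lab (v : option (vert Q)) :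
    'I_(sub_deg v) -> option (vert Q) * option (vert Q) :=
  match v return 'I_(sub_deg v) -> _ with
  | Some u => fun j =>
      if (lab j == b0) || (lab j == rev_bond b0) then (Some u, None)
      else map_bond Some (lab j)
  | None => fun j =>
      if j == 0 :> nat then (None, Some b0.1) else (None, Some b0.2)
  end.

Definition sub_scat (v : option (vert Q)) : 'M[R[i]]_(sub_deg v) :=
  match v return 'M[R[i]]_(sub_deg v) with
  | Some u => scat u
  | None => \matrix_(j, k) (j != k)%:R
  end.

Definition subdivide : qg_data R :=
  QgData sub_adj sub_len sub_pot sub_lab sub_scat.

End subdivision.

(* [rbond], [rpos] is the representative (b_0, x_0) of the root. *)
Record rooted := Rooted {
  rgraph : quantum_graph;
  rbond : vert rgraph * vert rgraph;
  rpos : R;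
  rbondP : bonds rgraph rbond;
  rposP : 0 < rpos < blen rbond }.

HB.instance Definition _ := gen_eqMixin rooted.
HB.instance Definition _ := gen_choiceMixin rooted.

Definition cut (q : rooted) : qg_data R := subdivide (rbond q) (rpos q).
Definition root (q : rooted) : vert (cut q) := None.

Record is_iso Q Q' (phi : vert Q -> vert Q') : Prop := IsIso {
  iso_bij : bijective phi;
  iso_adj : forall v w, adj (phi v) (phi w) = adj v w;
  iso_len : forall b, bonds Q b -> blen (map_bond phi b) = blen b;
  iso_pot : forall b, bonds Q b -> forall x, x \in `[0, blen b] ->
    pot (map_bond phi b) x = pot b x;
  iso_vert : forall v, exists e : deg (phi v) = deg v,
    castmx (e, e) (scat (phi v)) = scat v /\
    forall j, lab j = map_bond phi (lab (cast_ord e j)) }.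

Definition rooted_equiv (q q' : rooted) : Prop :=
  exists2 phi : vert (cut q) -> vert (cut q'),
    is_iso phi & phi (root q) = root q'.

Lemma rooted_equiv_refl q : rooted_equiv q q.
Proof.
have idb (b : vert (cut q) * vert (cut q)) : map_bond id b = b by case: b.
exists id => //; split.
- by exists id.
- by [].
- by [].
- by move=> b _ x _; rewrite idb.
move=> v; exists erefl; split; first by rewrite castmx_id.
by move=> j; rewrite cast_ord_id idb.
Qed.

Lemma rooted_equiv_sym q q' : rooted_equiv q q' -> rooted_equiv q' q.
Proof.
move=> [f [[g fK gK] fadj flen fpot fv] froot].
have gbond b : bonds (cut q') b -> bonds (cut q) (map_bond g b).
  by move=> bb; change (is_true (adj (g b.1) (g b.2))); rewrite -fadj !gK.
have fgb (b : vert (cut q') * vert (cut q')) : map_bond f (map_bond g b) = b.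
  by case: b => b c; rewrite /map_bond /= !gK.
have gfb (b : vert (cut q) * vert (cut q)) : map_bond g (map_bond f b) = b.
  by case: b => b c; rewrite /map_bond /= !fK.
exists g; last by rewrite -froot fK.
split.
- by exists f.
- by move=> v w; rewrite -fadj !gK.
- by move=> b /gbond /flen; rewrite fgb.
- move=> b /gbond gb x; have := fpot _ gb x.
  by rewrite -(flen _ gb) !fgb => h /h.
move=> w; rewrite -(gK w); move: (g w) => v; rewrite fK.
have [e [eU el]] := fv v.
exists (esym e); split; first by rewrite -eU castmxK.
by move=> j; rewrite el gfb cast_ordKV.
Qed.

Lemma rooted_equiv_trans q1 q2 q3 :
  rooted_equiv q1 q2 -> rooted_equiv q2 q3 -> rooted_equiv q1 q3.
Proof.
move=> [f [fb fadj flen fpot fv] fr] [g [gb gadj glen gpot gv] gr].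
have fbond b : bonds (cut q1) b -> bonds (cut q2) (map_bond f b).
  by move=> bb; change (is_true (adj (f b.1) (f b.2))); rewrite fadj.
exists (g \o f); last by rewrite /= fr.
split.
- exact: bij_comp.
- by move=> v w; exact: etrans (gadj _ _) (fadj _ _).
- by move=> b b1; rewrite -(flen _ b1) -(glen _ (fbond _ b1)).
- move=> b b1 x xb; rewrite -(fpot _ b1) // -(gpot _ (fbond _ b1)) //.
  by rewrite flen.
move=> v; have [e [eU el]] := fv v; have [e' [eU' el']] := gv (f v).
exists (etrans e' e); split.
  by rewrite -eU -eU' castmx_comp.
move=> j; apply: (etrans (el' j)); rewrite el; congr (map_bond g (map_bond f (lab _))).
exact: val_inj.
Qed.

Definition rooted_eqb (q q' : rooted) : bool := `[< rooted_equiv q q' >].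

Lemma rooted_eqb_equiv : equiv_class_of rooted_eqb.
Proof.
split.
- by move=> q; apply/asboolP; exact: rooted_equiv_refl.
- by move=> q q'; apply/asboolP/asboolP; exact: rooted_equiv_sym.
- by move=> q2 q1 q3 /asboolP h /asboolP h'; apply/asboolP;
    exact: rooted_equiv_trans h h'.
Qed.

Canonical rooted_equiv_rel := EquivRelPack rooted_eqb_equiv.

Definition Qstar := {eq_quot rooted_eqb}.
HB.instance Definition _ := Choice.on Qstar.
HB.instance Definition _ := EqQuotient.on Qstar.

Definition ball_at Q (v : vert Q) (n : nat) : set (vert Q) :=
  [set w | exists p : seq (vert Q),
    [/\ path (@adj R Q) v p, last v p = w & (size p <= n)%N]].

Record close_iso (r : R) Q Q' (B : set (vert Q)) (B' : set (vert Q'))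
    (phi : vert Q -> vert Q') : Prop := CloseIso {
  close_bij : set_bij B B' phi;
  close_adj : forall v w, B v -> B w -> adj (phi v) (phi w) = adj v w;
  close_lab : forall v, B v -> forall (j : 'I_(deg v)) (k : 'I_(deg (phi v))),
    j = k :> nat -> B (lab j).2 -> lab k = map_bond phi (lab j);
  close_len : forall b, bonds Q b -> B b.1 -> B b.2 ->
    `|blen b - blen (map_bond phi b)| < r^-1;
  close_pot : forall b, bonds Q b -> B b.1 -> B b.2 ->
    (ereal_sup [set `|pot b (t * blen b)
         - pot (map_bond phi b) (t * blen (map_bond phi b))|%:E
      | t in `[0%R, 1%R]] < (r^-1)%:E)%E;
  close_scat : forall v, B v ->
    (scat_dist (scat v) (scat (phi v)) < (r^-1)%:E)%E }.

Definition close (r : R) (q q' : rooted) : Prop :=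
  exists2 phi : vert (cut q) -> vert (cut q'),
    close_iso r (ball_at (root q) (Num.truncn r))
                (ball_at (root q') (Num.truncn r)) phi
    & phi (root q) = root q'.

Definition alpha (q q' : rooted) : \bar R :=
  ereal_sup [set r%:E | r in [set r | 0 < r /\ close r q q']].

(* 1 / (1 + alpha), with 1 / (1 + oo) = 0 and sup set0 = 0. *)
Definition rooted_dist (q q' : rooted) : R :=
  match alpha q q' with
  | EFin a => (1 + a)^-1
  | EPInf => 0
  | ENInf => 1
  end.

Definition Qdist (x y : Qstar) : R := rooted_dist (repr x) (repr y).

Definition Qopen (A : set Qstar) : Prop :=
  forall x, A x -> exists2 e : R, 0 < e & [set y | Qdist x y < e] `<=` A.

Lemma QopenT : Qopen setT.
Proof. by move=> x _; exists 1. Qed.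

Lemma QopenI : setI_closed Qopen.
Proof.
move=> A B oA oB x [/oA[e e0 eA] /oB[d d0 dB]].
exists (Num.min e d); first by rewrite lt_min e0.
by move=> y /=; rewrite lt_min => /andP[/eA ? /dB].
Qed.

Lemma Qopen_bigcup (I : Type) (f : I -> set Qstar) :
  (forall i, Qopen (f i)) -> Qopen (\bigcup_i f i).
Proof.
move=> of_ x [i _ /of_[e e0 ef]]; exists e => // y /ef; by exists i.
Qed.

HB.instance Definition _ :=
  isOpenTopological.Build Qstar QopenT QopenI Qopen_bigcup.

Definition Qstar_DmM (D : nat) (m M : R) : set Qstar :=
  [set x | exists2 q : rooted, x = \pi_Qstar q & DmM_bounds D m M (rgraph q)].

Lemma Qstar_DmM_neq0 D m M (Q : quantum_graph) :
  DmM_bounds D m M Q -> edges Q !=set0 -> Qstar_DmM D m M !=set0.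
Proof.
move=> bQ [e [b bb _]].
have Lb : 0 < blen b by apply: (len_gt0 (qgP Q)); exists b.
have x0 : 0 < blen b / 2 < blen b.
  by rewrite divr_gt0//= ltr_pdivrMr// ltr_pMr// ltr1n.
by exists (\pi_Qstar (Rooted bb x0)), (Rooted bb x0).
Qed.

(* The subspace Q_*^{D,m,M}. The proof of nonemptiness only serves to provide
   the base point required by [measurableType]. *)
Definition QDmM D m M (h : Qstar_DmM D m M !=set0) : Type :=
  set_type (Qstar_DmM D m M).

Section subspace.
Variables (D : nat) (m M : R) (h : Qstar_DmM D m M !=set0).

HB.instance Definition _ := Topological.on (QDmM h).

Definition QDmM_point : QDmM h :=
  let: exist x hx := cid h in exist _ x (mem_set hx).
HB.instance Definition _ := isPointed.Build (QDmM h) QDmM_point.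

Definition QDmM_borel := g_sigma_algebraType (@open (QDmM h)).
HB.instance Definition _ := Measurable.on QDmM_borel.

End subspace.

(* The integrand is x_0 |-> delta_{[Q, (b_0, x_0)]}(A). *)
Definition nu (Q : quantum_graph) (A : set Qstar) : \bar R :=
  (((2 * total_length Q)^-1)%:E *
   \sum_(b \in bonds Q) \int[lebesgue_measure]_(x in `]0%R, blen b[)
     (\1_[set x | exists (bP : bonds Q b) (xP : (0 < x < blen b)%R),
            A (\pi_Qstar (Rooted bP xP))] x)%:E)%E.

Definition nu_DmM D m M (h : Qstar_DmM D m M !=set0) (Q : quantum_graph)
    (A : set (QDmM_borel h)) : \bar R :=
  nu Q (set_val @` A).

Definition cintegral d (T : measurableType d) (mu : set T -> \bar R)
    (F : T -> R[i]) : R[i] :=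
  (fine (\int[mu]_x (complex.Re (F x))%:E)
   +i* fine (\int[mu]_x (complex.Im (F x))%:E))%C.

End quantum_graphs.

Arguments bonds {R} Q.
Arguments edges {R} Q.
Arguments QDmM {R D m M} h.
Arguments QDmM_borel {R D m M} h.
Arguments nu_DmM {R D m M} h Q A.

(* Main.v *)
(* The rooted graphs [Q, (b, s L_b)] with bounds (D, m, M) are parametrised by a
   graph with a marked bond b and a number s in (0,1). A graph with a marked bond
   is described by countably many bounded real coordinates, obtained by walking
   from the marked bond along words of labels: coincidences of endpoints, degrees,
   edge lengths, potentials at rational points of the rescaled edges and entries
   of the scattering matrices. If all coordinates of a sequence converge, then they
   converge to the coordinates of a graph with the same bounds, whose vertices are
   the words modulo eventual coincidence of endpoints, and the rooted graphs
   converge in Q_* for every s.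

   nu_Q is the image of a finitely supported law of marked bonds, with weights
   L_b / 2L(Q), times the uniform law of s. For the laws of marked bonds a
   subsequence has a limit law in the sense of Skorokhod: rational cuts of the
   coordinates organise the marked graphs in a binary tree, the masses of the cells
   converge along a diagonal subsequence, and the limit masses divide [0,1[ into
   nested intervals; sending u to the limit of the cells containing it gives a map X
   such that the means of a continuous function converge to its integral along X.
   The limit probability is the image of the uniform law of (u, s) under
   (u, s) |-> [X u, s]. *)
Require Import Defs.
From HB Require Import structures.
From mathcomp Require Import all_boot all_order all_algebra.
From mathcomp Require Import all_classical all_reals all_analysis.
From mathcomp Require Import spectral sesquilinear measurable_realfun.
From mathcomp Require Import ring lra.

Set Implicit Arguments.
Unset Strict Implicit.
Unset Printing Implicit Defensive.

Import Order.TTheory GRing.Theory Num.Theory numFieldNormedType.Exports.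

Local Open Scope classical_set_scope.
Local Open Scope ring_scope.
Local Open Scope sesquilinear_scope.
Local Open Scope quotient_scope.

(** The obstacle is that limits may leave $\mathbf{Q}_*^{D,m,M}$: when the root runs into a vertex,
    one piece of the cut edge has length tending to 0. Keeping the relative position [s] apart from
    the marked bond removes this. The coordinates of marked graphs have the compactness needed,
    while [s] has the same uniform law for every [N], and this law does not charge 0 and 1. Vertices
    are named by words because the vertex types of different graphs are unrelated. The bound [D]
    leaves finitely many words of each length, so finitely many eventual statements control a ball.
    The distance on $\mathbf{Q}_*$ enters through [close_Qdist]: closeness at radius [r] bounds it
    by [1/(1 + r)]. Hence the preimage of an open set is sequentially open in the coordinates and
    [s]. With countably many coordinates such a set is a countable union of rational boxes, whence
    the measurability of the random limit root. A test function is first averaged over [s];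
    dominated convergence makes the average continuous in the coordinates of the marked graph. *)

(** * Diagonal subsequences *)

Lemma increasing_homo (s : nat -> nat) :
  (forall n, (s n < s n.+1)%N) -> {homo s : j k / (j < k)%N}.
Proof.
by move=> h; apply: homo_ltn => // y x z; exact: ltn_trans.
Qed.

Lemma increasing_ge_id (s : nat -> nat) :
  {homo s : j k / (j < k)%N} -> forall n, (n <= s n)%N.
Proof. by move=> h; elim=> // n IH; exact: leq_ltn_trans IH (h _ _ _). Qed.

Lemma cvg_subseq (T : topologicalType) (u : nat -> T) (l : T) (s : nat -> nat) :
  {homo s : j k / (j < k)%N} -> u @ \oo --> l -> (u \o s) @ \oo --> l.
Proof.
move=> hs ul; apply: cvg_comp ul => A [N _ NA].
by exists N => // n /= Nn; apply: NA => /=; apply: leq_trans Nn _;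
  exact: increasing_ge_id.
Qed.

(** By Tychonoff the coordinate vectors have a cluster point [z] in a product of segments. A
    neighbourhood of [z] may constrain the first [n] coordinates at once, so one increasing choice
    of indices serves all [i]. *)
Lemma diagonal_subsequence (R : realType) (f : nat -> nat -> R) (C : nat -> R) :
  (forall i k, `|f i k| <= C i) ->
  exists2 s : nat -> nat, {homo s : j k / (j < k)%N} &
    forall i, cvgn (f i \o s).
Proof.
move=> fC; pose u k : forall i : nat, R := fun i => f i k.
have Aco := @tychonoff nat (fun=> R : topologicalType)
  (fun i => `[- C i, C i]%classic) (fun i => @segment_compact _ _ _).
have [|z [_ zcl]] := Aco (u @ \oo) _.
  exists 0%N => // k _ /= i; rewrite in_itv/=; have := fC i k.
  by rewrite ler_norml.
have H N n : exists p, (N < p)%N /\ forall i, (i < n)%N ->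
    `|z i - f i p| < n.+1%:R^-1.
  have zn : nbhs z [set g : forall i : nat, R | forall i, (i < n)%N ->
      `|z i - g i| < n.+1%:R^-1].
    elim: {1}n => [|m IH]; first by apply: filterS filterT.
    have := @proj_continuous nat (fun=> R : topologicalType) m z.
    have en : 0 < n.+1%:R^-1 :> R by rewrite invr_gt0 ltr0n.
    move=> /(_ _ (nbhsx_ballx (z m : R^o) _ en)).
    rewrite /= => hm; apply: filterS2 IH hm => g gm gm' i.
    by rewrite ltnS leq_eqVlt => /predU1P[->//|]; exact: gm.
  have uN : (u @ \oo) [set u k | k in [set k | (N < k)%N]].
    by exists N.+1 => // k /= Nk; exists k.
  by have [_ [[k Nk <-] h]] := zcl _ _ uN zn; exists k.
pose pick N n := projT1 (cid (H N n)).
have pickP N n : (N < pick N n)%N /\ forall i, (i < n)%N ->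
    `|z i - f i (pick N n)| < n.+1%:R^-1 by exact: (projT2 (cid (H N n))).
pose s := fix s n := if n is m.+1 then pick (s m) n else 0%N.
exists s; first by apply: increasing_homo => n; have [] := pickP (s n) n.+1.
move=> i; apply/cvg_ex; exists (z i); apply/cvgrPdist_lt => e e0.
near=> n; have [k nk] : exists k, n = k.+1.
  by near: n; exists 1%N => // -[//|k] _; exists k.
apply: lt_trans (_ : n.+1%:R^-1 < e); last first.
  by near: n; exact: near_infty_natSinv_lt (PosNum e0).
have in_ : (i < n)%N by near: n; exact: nbhs_infty_gt.
by rewrite /= nk; have [_] := pickP (s k) k.+1; apply; rewrite -nk.
Unshelve. all: end_near. Qed.

(** * Random variables on the unit interval with given cell masses *)

(* Words are read backwards: the head of [w] is the last choice made, so that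
   [w] and [b :: w] are a node and one of its children. *)
Section dyadic_tree.
Variables (R : realType) (p : seq bool -> R).
Hypothesis p_ge0 : forall w, 0 <= p w.
Hypothesis p_nil : p [::] = 1.
Hypothesis p_cons : forall w, p w = p (false :: w) + p (true :: w).

(** Left end of the interval of length [p w] attached to [w]; at each node the child [false] gets
    the left part. *)
Fixpoint tree_left (w : seq bool) : R :=
  if w is b :: w' then tree_left w' + (if b then p (false :: w') else 0) else 0.

Fixpoint tree_path (n : nat) (u : R) : seq bool :=
  if n is n'.+1 then
    let w := tree_path n' u in (tree_left w + p (false :: w) <= u) :: w
  else [::].

Lemma size_tree_path n u : size (tree_path n u) = n.
Proof. by elim: n => //= n ->. Qed.

Lemma tree_pathP n u : 0 <= u < 1 ->
  tree_left (tree_path n u) <= u < tree_left (tree_path n u) + p (tree_path n u).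
Proof.
move=> u01; elim: n => [|n] /=; first by rewrite p_nil add0r.
set w := tree_path n u => /andP[h1 h2]; have pw := p_cons w.
by case: (leP (tree_left w + p (false :: w)) u) => h /=; apply/andP; split; lra.
Qed.

Lemma tree_path_eq w u : tree_left w <= u < tree_left w + p w ->
  tree_path (size w) u = w.
Proof.
elim: w => // b w IH /= /andP[h1 h2].
have pw := p_cons w; have p0 := p_ge0 (false :: w); have p1 := p_ge0 (true :: w).
have -> : tree_path (size w) u = w.
  by apply: IH; case: b h1 h2 => h1 h2; lra.
by congr cons; case: b h1 h2 => h1 h2; [apply/idP; lra|apply/negbTE; rewrite -ltNge; lra].
Qed.

Lemma tree_left_itv w : 0 <= tree_left w /\ tree_left w + p w <= 1.
Proof.
elim: w => [|b w [h1 h2]] /=; first by rewrite p_nil; lra.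
have pw := p_cons w; have p0 := p_ge0 (false :: w); have p1 := p_ge0 (true :: w).
by case: b; lra.
Qed.

Lemma tree_pathE n w : size w = n ->
  `[0, 1[%classic `&` [set u | tree_path n u = w] =
  `[tree_left w, tree_left w + p w[%classic.
Proof.
move=> sw; have [l0 l1] := tree_left_itv w; apply/seteqP; split => u /=.
  by rewrite !in_itv/= => -[u01 <-]; exact: tree_pathP.
rewrite !in_itv/= => hu; split; last by rewrite -sw tree_path_eq.
by case/andP: hu => h1 h2; apply/andP; split; lra.
Qed.

(** A half-open interval containing [u] has positive length. Cells of limit mass zero are thus never
    visited, so a point can be chosen in every visited cell. *)
Lemma tree_path_gt0 n u : 0 <= u < 1 -> 0 < p (tree_path n u).
Proof. by move=> /(tree_pathP n) /andP[h1 h2]; lra. Qed.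

Local Notation leb := (@lebesgue_measure R).

(** A function of the first [n] choices is a step function on the intervals of depth [n]; this gives
    both its measurability and its integral. *)
Lemma tree_path_sum (g : seq bool -> R) n u : 0 <= u < 1 ->
  g (tree_path n u) = \sum_(t : n.-tuple bool)
    g t * \1_`[tree_left t, tree_left t + p t[%classic u.
Proof.
move=> u01; have sz := size_tree_path n u.
pose t0 : n.-tuple bool := Tuple (introT eqP sz).
rewrite (bigD1 t0)//= big1 ?addr0.
  rewrite indicE mem_set ?mulr1//= in_itv/=; exact: tree_pathP.
move=> t tt0; rewrite indicE memNset ?mulr0//=.
rewrite in_itv/= => /tree_path_eq; rewrite size_tuple => e.
by move/eqP: tt0; apply; exact: val_inj.
Qed.

Lemma measurable_tree_path (g : seq bool -> R) (n : nat) :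
  measurable_fun (`[0, 1[%classic : set R) (fun u : R => g (tree_path n u)).
Proof.
apply: (eq_measurable_fun (fun u => \sum_(t : n.-tuple bool)
    g t * \1_`[tree_left t, tree_left t + p t[%classic u)).
  move=> u; rewrite inE/= in_itv/= => u01; by rewrite -tree_path_sum.
apply: measurable_sum => t; apply: measurable_funM => //.
Qed.

Lemma integral_tree_path (g : seq bool -> R) (n : nat) :
  (\int[leb]_(u in `[0%R, 1%R[) (g (tree_path n u))%:E =
  (\sum_(t : n.-tuple bool) g t * p t)%:E)%E.
Proof.
transitivity (\int[leb]_(u in `[0%R, 1%R[) (\sum_(t : n.-tuple bool)
   (g t)%:E * (\1_`[tree_left t, tree_left t + p t[%classic u)%:E))%E.
  apply: eq_integral => u; rewrite inE/= in_itv/= => u01.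
  by rewrite tree_path_sum// -sumEFin; apply: eq_bigr => t _; rewrite EFinM.
have int t : leb.-integrable `[0, 1[%classic
    (EFin \o (\1_`[tree_left t, tree_left t + p t[%classic : R -> R)).
  apply: (@integrableS _ _ _ leb setT) => //.
  exact: (integrable_indic_itv (tree_left t) (tree_left t + p t) true true).
rewrite integral_sum//=; last by move=> t; apply: integrableZl => //; exact: int.
rewrite -sumEFin; apply: eq_bigr => t _.
rewrite integralZl//; last exact: int.
rewrite (_ : (\int[leb]_(u in `[0%R, 1%R[) _)%E = (p t)%:E) ?EFinM//.
rewrite [LHS]integral_indic// setIC.
rewrite -(tree_pathE (size_tuple t)) setIA setIid tree_pathE ?size_tuple//.
apply: etrans (lebesgue_measure_itv _) _; rewrite /= lte_fin.
case: ifPn; rewrite -?leNgt => h; first by rewrite -EFinD addrAC subrr add0r.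
by rewrite (_ : p t = 0)//; have := p_ge0 t; lra.
Qed.

End dyadic_tree.

(** * Cells cut out by rational thresholds, and the limit law *)

Section skorokhod.
Variables (R : realType) (T : Type) (f : nat -> T -> R) (C : nat -> R).
Hypothesis f_bound : forall i x, `|f i x| <= C i.
Hypothesis f_compact : forall x : nat -> T,
  (forall i, cvgn (fun k => f i (x k))) ->
  exists y, forall i, (fun k => f i (x k)) @ \oo --> f i y.

Definition coordwise_continuous (G : T -> R) : Prop :=
  forall (x : nat -> T) y, (forall i, (fun k => f i (x k)) @ \oo --> f i y) ->
    (fun k => G (x k)) @ \oo --> G y.

Lemma compact_subsequence (x : nat -> T) :
  exists2 s : nat -> nat, {homo s : j k / (j < k)%N} &
    exists y, forall i, (fun k => f i (x (s k))) @ \oo --> f i y.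
Proof.
have [s hs cs] := diagonal_subsequence (fun i k => f_bound i (x k)).
by exists s => //; exact: f_compact.
Qed.

(** Every pair of a coordinate [i] and a rational cut [q] is tested by some digit; a number that
    codes no pair gives a constant digit. *)
Definition cell_digit (n : nat) (x : T) : bool :=
  if unpickle n is Some iq then f iq.1 x < ratr iq.2 else false.

Fixpoint cell (n : nat) (x : T) : seq bool :=
  if n is n'.+1 then cell_digit n' x :: cell n' x else [::].

Lemma size_cell n x : size (cell n x) = n.
Proof. by elim: n => //= n ->. Qed.

Lemma cell_eqW m n x y : (m <= n)%N -> cell n x = cell n y -> cell m x = cell m y.
Proof.
elim: n => [|n IH]; first by rewrite leqn0 => /eqP ->.
by rewrite leq_eqVlt => /predU1P[->//|]; rewrite ltnS => mn /= [_ /(IH mn)].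
Qed.

Lemma cell_eq_digit m n x y : (m < n)%N -> cell n x = cell n y ->
  cell_digit m x = cell_digit m y.
Proof. by move=> mn /(cell_eqW mn) /= []. Qed.

Lemma cell_digit_pickle (i : nat) (q : rat) x :
  cell_digit (pickle (i, q)) x = (f i x < ratr q).
Proof. by rewrite /cell_digit pickleK. Qed.

(** All rational cuts are eventually decided. The rationals eventually below [f i (x k)] form a
    bounded nonempty set whose supremum is the limit: rationals on its two sides eventually enclose
    the sequence. *)
Lemma cvg_cell_digit (x : nat -> T) (d : nat -> bool) :
  (forall m, \forall k \near \oo, cell_digit m (x k) = d m) ->
  forall i, cvgn (fun k => f i (x k)).
Proof.
move=> xd i; pose S := [set r : R | exists2 q : rat, r = ratr q & ~~ d (pickle (i, q))].
have Sle (q : rat) : ~~ d (pickle (i, q)) -> \forall k \near \oo, ratr q <= f i (x k).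
  move=> dq; have := xd (pickle (i, q)); apply: filterS => k.
  by rewrite cell_digit_pickle leNgt => ->.
have Sgt (q : rat) : d (pickle (i, q)) -> \forall k \near \oo, f i (x k) < ratr q.
  move=> dq; have := xd (pickle (i, q)); apply: filterS => k.
  by rewrite cell_digit_pickle => ->.
have ub : ubound S (C i).
  move=> _ [q -> /Sle [N _ h]]; apply: le_trans (h N (leqnn N)) _.
  by have := f_bound i (x N); rewrite ler_norml => /andP[].
have S0 : S !=set0.
  have /rat_in_itvoo[q] : - C i - 1 < - C i by rewrite ltrBlDr ltrDl.
  rewrite in_itv/= => /andP[_ q2].
  exists (ratr q), q => //; apply/negP => /Sgt[N _ h].
  have := h N (leqnn N); have := f_bound i (x N); rewrite ler_norml => /andP[h1 _].
  by move=> h2; have := lt_trans (le_lt_trans h1 h2) q2; rewrite ltxx.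
have hS : has_sup S by split => //; exists (C i).
apply/cvg_ex; exists (sup S); apply/cvgrPdist_lt => e e0.
have [_ [q1 -> /Sle h1] q1l] := sup_adherent e0 hS.
have /rat_in_itvoo[q2] : sup S < sup S + e by rewrite ltrDl.
rewrite in_itv/= => /andP[q2l q2e].
have /Sgt h2 : d (pickle (i, q2)).
  apply/negPn/negP => dq; have : ratr q2 <= sup S.
    by apply: ub_le_sup; [exists (C i)|exists q2].
  by rewrite leNgt q2l.
near=> k; rewrite ltr_distlC; apply/andP; split.
  by apply: lt_le_trans q1l _; near: k.
by apply: lt_trans q2e; near: k.
Unshelve. all: end_near. Qed.

(* Compactness turns continuity into uniform continuity with respect to the
   cells: otherwise two sequences in common cells have limits with the same
   coordinates and different values of [G]. *)
Lemma cell_osc (G : T -> R) (e : R) : coordwise_continuous G -> 0 < e ->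
  exists n, forall x y, cell n x = cell n y -> `|G x - G y| <= e.
Proof.
move=> Gc e0; apply: contrapT => /forallNP H.
have {}H n : exists xy : T * T, cell n xy.1 = cell n xy.2 /\ e < `|G xy.1 - G xy.2|.
  have /existsNP[x /existsNP[y /not_implyP[xy /negP]]] := H n.
  by rewrite -ltNge => h; exists (x, y).
pose z n := projT1 (cid (H n)).
have zP n : cell n (z n).1 = cell n (z n).2 /\ e < `|G (z n).1 - G (z n).2|.
  exact: (projT2 (cid (H n))).
have [s hs [x xl]] := compact_subsequence (fun n => (z n).1).
(* The second extraction runs along the first, so both sequences converge along [s (t k)] and their
   points still share cells of depth tending to infinity. *)
have [t ht [y yl]] := compact_subsequence (fun n => (z (s n)).2).
have xl' i : (fun k => f i (z (s (t k))).1) @ \oo --> f i x.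
  exact: (cvg_subseq ht (xl i)).
have cells i (q : rat) : \forall k \near \oo,
    (f i (z (s (t k))).1 < ratr q) = (f i (z (s (t k))).2 < ratr q).
  exists (pickle (i, q)).+1 => // k /= hk.
  rewrite -!cell_digit_pickle; apply: (cell_eq_digit _ (zP _).1).
  apply: (leq_trans hk); apply: leq_trans (increasing_ge_id ht k) _.
  exact: increasing_ge_id.
(* A rational strictly between the two limits would be a cut that eventually separates two points of
   a common cell. *)
have fxy i : f i x = f i y.
  apply/eqP; rewrite eq_le; apply/andP; split; rewrite leNgt; apply/negP => h.
    have [q] := rat_in_itvoo h; rewrite in_itv/= => /andP[q1 q2].
    near \oo => k; have k1 : ratr q < f i (z (s (t k))).1.
      by near: k; exact: (cvgr_gt _ (xl' i) _ q2).
    have k2 : f i (z (s (t k))).2 < ratr q.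
      by near: k; exact: (cvgr_lt _ (yl i) _ q1).
    have : (f i (z (s (t k))).1 < ratr q) = (f i (z (s (t k))).2 < ratr q).
      by near: k; exact: cells.
    by rewrite k2 ltNge (ltW k1).
  have [q] := rat_in_itvoo h; rewrite in_itv/= => /andP[q1 q2].
  near \oo => k; have k1 : f i (z (s (t k))).1 < ratr q.
    by near: k; exact: (cvgr_lt _ (xl' i) _ q1).
  have k2 : ratr q < f i (z (s (t k))).2.
    by near: k; exact: (cvgr_gt _ (yl i) _ q2).
  have : (f i (z (s (t k))).1 < ratr q) = (f i (z (s (t k))).2 < ratr q).
    by near: k; exact: cells.
  by rewrite k1 ltNge (ltW k2).
have Gx := Gc (fun k => (z (s (t k))).1) x xl'.
have Gy : (fun k => G (z (s (t k))).2) @ \oo --> G x.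
  by apply: Gc => i; rewrite fxy; exact: yl.
have e2 : 0 < e / 2 by rewrite divr_gt0.
near \oo => k; have [_] := zP (s (t k)); rewrite ltNge => /negP; apply.
rewrite (le_trans (ler_distD (G x) _ _))// (splitr e) lerD// ltW//.
  by rewrite distrC; near: k; exact: (cvgr_dist_lt _ _ Gx).
by near: k; exact: (cvgr_dist_lt _ _ Gy).
Unshelve. all: end_near. Qed.

End skorokhod.
Arguments coordwise_continuous [R T] f G.

Section skorokhod_limit.
Variables (R : realType) (T : Type) (f : nat -> T -> R) (C : nat -> R).
Hypothesis f_bound : forall i x, `|f i x| <= C i.
Hypothesis f_compact : forall x : nat -> T,
  (forall i, cvgn (fun k => f i (x k))) ->
  exists y, forall i, (fun k => f i (x k)) @ \oo --> f i y.
Variables (pts : nat -> seq T) (wt : nat -> T -> R).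

Definition mean (N : nat) (G : T -> R) : R := \sum_(x <- pts N) wt N x * G x.

Hypothesis wt_ge0 : forall N x, 0 <= wt N x.
Hypothesis mean1 : forall N, mean N (fun=> 1) = 1.

Definition cell_mass (N : nat) (w : seq bool) : R :=
  mean N (fun x => (cell f (size w) x == w)%:R).

Lemma meanD N G H : mean N (fun x => G x + H x) = mean N G + mean N H.
Proof. by rewrite /mean -big_split; apply: eq_bigr => x _; rewrite mulrDr. Qed.

Lemma ler_mean N G H : (forall x, G x <= H x) -> mean N G <= mean N H.
Proof. by move=> GH; apply: ler_sum => x _; rewrite ler_wpM2l. Qed.

Lemma mean_dist N G H e : (forall x, `|G x - H x| <= e) ->
  `|mean N G - mean N H| <= e.
Proof.
move=> GH; rewrite /mean -sumrB; apply: le_trans (ler_norm_sum _ _ _) _.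
have -> : e = \sum_(x <- pts N) wt N x * e.
  rewrite -mulr_suml -[LHS]mul1r -(mean1 N); congr (_ * _).
  by apply: eq_bigr => x _; rewrite mulr1.
apply: ler_sum => x _; rewrite -mulrBr normrM ger0_norm//.
by rewrite ler_wpM2l.
Qed.

Lemma cell_mass_ge0 N w : 0 <= cell_mass N w.
Proof. by apply: sumr_ge0 => x _; rewrite mulr_ge0. Qed.

Lemma cell_mass_nil N : cell_mass N [::] = 1.
Proof. by rewrite /cell_mass -[RHS](mean1 N). Qed.

Lemma cell_mass_le1 N w : cell_mass N w <= 1.
Proof. by rewrite -(mean1 N); apply: ler_mean => x; rewrite lern1 leq_b1. Qed.

Lemma cell_mass_cons N w :
  cell_mass N w = cell_mass N (false :: w) + cell_mass N (true :: w).
Proof.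
rewrite /cell_mass /= -meanD; apply: eq_bigr => x _; congr (_ * _).
by rewrite !eqseq_cons; case: (cell_digit _ _ _) => /=; rewrite ?add0r ?addr0.
Qed.

Lemma mean_cell N (g : seq bool -> R) n :
  mean N (fun x => g (cell f n x)) = \sum_(t : n.-tuple bool) g t * cell_mass N t.
Proof.
under eq_bigr => t _ do rewrite /cell_mass /mean mulr_sumr.
rewrite exchange_big; apply: eq_bigr => x _.
pose t0 : n.-tuple bool := Tuple (introT eqP (size_cell f n x)).
rewrite (bigD1 t0)//= big1 ?addr0.
  by rewrite size_cell eqxx mulr1 mulrC.
move=> t; rewrite eq_sym => tt0; rewrite size_tuple (_ : (_ == _) = false) ?mulr0//.
by apply/negbTE; apply: contra tt0 => /eqP e; apply/eqP/val_inj.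
Qed.

Local Notation leb := (@lebesgue_measure R).

(* The limit law is realised by the random variable [X] on the unit interval. *)
Lemma limit_law : exists2 s : nat -> nat, {homo s : j k / (j < k)%N} &
  exists X : R -> T,
  (forall i, measurable_fun (`[0, 1[%classic : set R) (f i \o X)) /\
  forall G, coordwise_continuous f G -> (exists K : R, forall x, `|G x| <= K) ->
    measurable_fun (`[0, 1[%classic : set R) (G \o X) /\
    (fun k => (mean (s k) G)%:E) @ \oo --> (\int[leb]_(u in `[0%R, 1%R[) (G (X u))%:E)%E.
Proof.
have mass_bound i N :
    `|if unpickle i is Some w then cell_mass N w else 0| <= (1 : R).
  case: unpickle => [w|]; last by rewrite normr0.
  by rewrite ger0_norm ?cell_mass_ge0// cell_mass_le1.
have [s hs scv] := diagonal_subsequence mass_bound.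
exists s => //.
have {}scv w : cvgn (fun k => cell_mass (s k) w).
  have gE : (fun k => if unpickle (pickle w) is Some w' then cell_mass (s k) w' else 0)
      = fun k => cell_mass (s k) w by apply/funext => k; rewrite pickleK.
  by have := scv (pickle w); rewrite /comp gE.
pose p w := limn (fun k => cell_mass (s k) w).
have pl w : (fun k => cell_mass (s k) w) @ \oo --> p w by exact: scv.
have p_ge0 w : 0 <= p w.
  by apply: limr_ge => //; apply: nearW => k; exact: cell_mass_ge0.
have p_nil : p [::] = 1.
  rewrite /p (_ : (fun k => _) = fun=> 1) ?lim_cst//.
  by apply/funext => k; exact: cell_mass_nil.
have p_cons w : p w = p (false :: w) + p (true :: w).
  rewrite /p -limD//; congr (limn _).
  by apply/funext => k; exact: cell_mass_cons.
have [x0 _] : exists x0 : T, True.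
  apply: contrapT => h; have := mean1 0; rewrite /mean.
  case: (pts 0) => [|x l]; last by case: h; exists x.
  by rewrite big_nil => /esym/eqP; rewrite oner_eq0.
(* A cell without points has mass zero for every law, hence in the limit. *)
have p_cell w : 0 < p w -> exists x, cell f (size w) x = w.
  move=> pw; apply: contrapT => /forallNP h.
  move: pw; rewrite (_ : p w = 0) ?ltxx// /p (_ : (fun k => _) = fun=> 0) ?lim_cst//.
  apply/funext => k; apply: big1 => x _; case: eqP => [/h//|]; by rewrite mulr0.
pose xw w := if pselect (exists x, cell f (size w) x = w) is left e
  then projT1 (cid e) else x0.
have xwP w : (exists x, cell f (size w) x = w) -> cell f (size w) (xw w) = w.
  by rewrite /xw => e; case: pselect => // e'; exact: (projT2 (cid e')).
pose pre n u := tree_path p n u.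
have xpre n u : 0 <= u < 1 -> cell f n (xw (pre n u)) = pre n u.
  move=> u01; rewrite -{1}(size_tree_path p n u); apply/xwP/p_cell.
  exact: tree_path_gt0.
(* The point chosen at depth [n] lies in all the cells above it on the path, so each digit is
   constant from some depth on and [cvg_cell_digit] applies. *)
have preW m n u : 0 <= u < 1 -> (m <= n)%N -> cell f m (xw (pre n u)) = pre m u.
  move=> u01; elim: n => [|n IH]; first by rewrite leqn0 => /eqP->.
  rewrite leq_eqVlt => /predU1P[->|]; first exact: xpre.
  rewrite ltnS => mn; rewrite -(IH mn); apply: (cell_eqW mn).
  by rewrite xpre//; have := xpre n.+1 u u01; rewrite {2}/pre /= => -[_ ].
have pre_cvg u : 0 <= u < 1 -> forall i, cvgn (fun n => f i (xw (pre n u))).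
  move=> u01; apply: (@cvg_cell_digit _ _ _ _ f_bound _
    (fun m => head false (pre m.+1 u))) => m.
  by exists m.+1 => // n mn; rewrite -(preW m.+1 n u).
pose X u := if pselect (exists y, forall i,
  (fun n => f i (xw (pre n u))) @ \oo --> f i y) is left e then projT1 (cid e) else x0.
have XP u : 0 <= u < 1 -> forall i, (fun n => f i (xw (pre n u))) @ \oo --> f i (X u).
  move=> /pre_cvg /f_compact e; rewrite /X; case: pselect => // e'.
  exact: (projT2 (cid e')).
exists X; split.
  move=> i; apply: (measurable_fun_cvg (h := fun n u => f i (xw (pre n u)))).
    by move=> m; exact: (measurable_tree_path p_ge0 p_nil p_cons (fun w => f i (xw w))).
  by move=> u /=; rewrite in_itv/=; move=> /XP; exact.
move=> G Gc [K GK].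
have mG n : measurable_fun (`[0, 1[%classic : set R) (fun u => G (xw (pre n u))).
  exact: (measurable_tree_path p_ge0 p_nil p_cons (fun w => G (xw w))).
have GX u : 0 <= u < 1 -> (fun n => G (xw (pre n u))) @ \oo --> G (X u).
  by move=> /XP /Gc.
have mGX : measurable_fun (`[0, 1[%classic : set R) (G \o X).
  apply: (measurable_fun_cvg mG) => u /=; rewrite in_itv/=; exact: GX.
split=> //.
have leb1 : (leb `[0%R, 1%R[%classic = 1)%E.
  by rewrite lebesgue_measure_itv/= lte_fin ltr01 oppr0 adde0.
have GXae : {ae leb, forall u, (`[0, 1[%classic : set R) u ->
    (fun n => (G (xw (pre n u)))%:E) @ \oo --> (G (X u))%:E}.
  apply: aeW => u /=; rewrite in_itv/= => u01; apply: cvg_EFin; last exact: GX.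
  exact: nearW.
have iK : leb.-integrable (`[0, 1[%classic : set R) (EFin \o cst K).
  apply: measurable_bounded_integrable => //; first
    exact: (eq_ind_r (fun z => (z < +oo)%E) (ltry _) leb1).
  exact: bounded_cst.
have GKae : {ae leb, forall u n, (`[0, 1[%classic : set R) u ->
    (`|(G (xw (pre n u)))%:E| <= (EFin \o cst K) u)%E}.
  by apply: aeW => u n _ /=; rewrite lee_fin.
have mG' n : measurable_fun (`[0, 1[%classic : set R) (fun u => (G (xw (pre n u)))%:E).
  exact/measurable_EFinP.
have mGX' : measurable_fun (`[0, 1[%classic : set R) (fun u => (G (X u))%:E).
  exact/measurable_EFinP.
have [/= iGX _ cvgI] := dominated_convergence (mu := leb) (measurable_itv _) mG' mGX' GXae iK GKae.
have : (fun n => (\sum_(t : n.-tuple bool) G (xw t) * p t)%:E) @ \oo -->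
    (\int[leb]_(u in `[0%R, 1%R[) (G (X u))%:E)%E.
  apply: cvg_trans cvgI; apply: near_eq_cvg; apply: nearW => n.
  by rewrite -(integral_tree_path p_ge0 p_nil p_cons (fun w => G (xw w)) n).
have := integrable_fin_num (mu := leb) (measurable_itv _) iGX.
case: (\int[_]_(_ in _) _)%E => // J _ /fine_cvgP[_ /= JJ].
apply: cvg_EFin; first exact: nearW.
apply/cvgrPdist_le => e e0.
(* Three errors of at most [e / 3]: the sum at depth [n] against the integral, limit masses against
   masses at stage [k], and [G] against its value at the point chosen in the cell. *)
have e3 : 0 < e / 3 by rewrite divr_gt0.
have [n0 oscn] := cell_osc f_bound f_compact Gc e3.
have [n [n0n Jn]] : exists n, (n0 <= n)%N /\
    `|J - \sum_(t : n.-tuple bool) G (xw t) * p t| <= e / 3.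
  near \oo => n; exists n; split; first by near: n; exact: nbhs_infty_ge.
  by near: n; exact: (cvgr_dist_le _ _ JJ).
have sumcv : (fun k => \sum_(t : n.-tuple bool) G (xw t) * cell_mass (s k) t) @ \oo
    --> \sum_(t : n.-tuple bool) G (xw t) * p t.
  apply: cvg_big => [|t _]; first exact: add_continuous.
  by apply: cvgMr; exact: pl.
near=> k.
have h1 : `|\sum_(t : n.-tuple bool) G (xw t) * p t -
    \sum_(t : n.-tuple bool) G (xw t) * cell_mass (s k) t| <= e / 3.
  by near: k; exact: (cvgr_dist_le _ _ sumcv).
have h2 : `|mean (s k) (fun x => G (xw (cell f n x))) - mean (s k) G| <= e / 3.
  apply: mean_dist => x; apply: oscn; apply: (cell_eqW n0n).
  by rewrite -{1}(size_cell f n x) xwP//; exists x; rewrite size_cell.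
move: h2; rewrite (mean_cell _ (fun w => G (xw w))) => h2.
rewrite [X in _ - X](_ : _ = mean (s k) G)//; move: h1 h2 Jn.
set a1 := (\sum_t _); set a2 := (\sum_t _); set a3 := mean _ _.
rewrite !ler_norml => /andP[? ?] /andP[? ?] /andP[? ?]; apply/andP; split; lra.
Unshelve. all: end_near. Qed.

End skorokhod_limit.

(** * Unitary matrices and the bound on Lambda *)

Section complex_matrix_facts.
Variable R : realType.
Local Notation C := R[i].

Definition abs2 (z : C) : R := complex.Re z ^+ 2 + complex.Im z ^+ 2.
Definition vnorm2 n (x : 'cV[C]_n) : R := \sum_i abs2 (x i 0).

Lemma abs2_ge0 z : 0 <= abs2 z.
Proof. by rewrite addr_ge0 ?sqr_ge0. Qed.

Lemma abs2M z w : abs2 (z * w) = abs2 z * abs2 w.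
Proof. by case: z => a b; case: w => c d; rewrite /abs2 /=; ring. Qed.

Lemma abs2C (z : C) : ((abs2 z)%:C)%C = z * z^*.
Proof. by rewrite /abs2 add_Re2_Im2 normCK. Qed.

Lemma abs20 : abs2 0 = 0. Proof. by rewrite /abs2 /= expr0n addr0. Qed.

Lemma vnorm2_ge0 n (x : 'cV[C]_n) : 0 <= vnorm2 x.
Proof. by apply: sumr_ge0 => i _; exact: abs2_ge0. Qed.

Lemma vnormE n (x : 'cV[C]_n) : vnorm x = Num.sqrt (vnorm2 x).
Proof. by []. Qed.

Lemma vnorm2C n (x : 'cV[C]_n) : ((vnorm2 x)%:C)%C = (x^t* *m x) 0 0.
Proof.
rewrite mxE /vnorm2 rmorph_sum /=; apply: eq_bigr => i _.
by rewrite abs2C !mxE mulrC.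
Qed.

Lemma vnorm2_eq0 n (x : 'cV[C]_n) : vnorm2 x = 0 -> x = 0.
Proof.
move=> /eqP; rewrite psumr_eq0 => [/allP h|i _]; last exact: abs2_ge0.
apply/matrixP => i j; rewrite ord1 !mxE.
have := h i (mem_index_enum _); rewrite /abs2 /= paddr_eq0 ?sqr_ge0// !sqrf_eq0.
by move=> /andP[/eqP h1 /eqP h2]; apply/eqP; rewrite eq_complex h1 h2 !eqxx.
Qed.

Lemma vnorm2_unitary n (U : 'M[C]_n) (x : 'cV[C]_n) : U \is unitarymx ->
  vnorm2 (U *m x) = vnorm2 x.
Proof.
move=> Uu; apply: complexI; rewrite !vnorm2C trmx_mul map_mxM /= mulmxA.
by rewrite mulmxKtV// -(trmxC_unitary U).
Qed.

Lemma vnorm2Z n (a : C) (x : 'cV[C]_n) : vnorm2 (a *: x) = abs2 a * vnorm2 x.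
Proof.
by rewrite /vnorm2 mulr_sumr; apply: eq_bigr => i _; rewrite mxE abs2M.
Qed.

Lemma unitary_normalmx n (U : 'M[C]_n) : U \is unitarymx -> U \is normalmx.
Proof.
move=> Uu; apply/normalmxP; rewrite (unitarymxP Uu).
by rewrite -(invmx_unitary Uu) mulVmx// unitarymx_unit.
Qed.

(** Preservation of the norm forces a nonzero eigenvector to have an eigenvalue of modulus 1, so the
    inverse of the eigenvalue is its conjugate. *)
Lemma unitary_eigenC n (U : 'M[C]_n) (y : 'cV[C]_n) a : U \is unitarymx ->
  U *m y = a *: y -> U^t* *m y = a^* *: y.
Proof.
move=> Uu Uy; have [->|y0] := eqVneq y 0; first by rewrite mulmx0 scaler0.
have aa : a * a^* = 1.
  rewrite -abs2C; congr (_%:C)%C; have := vnorm2_unitary y Uu.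
  rewrite Uy vnorm2Z => /eqP; rewrite -subr_eq0 -{2}[vnorm2 y]mul1r -mulrBl mulf_eq0.
  rewrite subr_eq0 => /orP[/eqP//|/eqP/vnorm2_eq0 y00].
  by rewrite y00 eqxx in y0.
have : U^t* *m (U *m y) = y.
  by rewrite mulmxA -(invmx_unitary Uu) mulVmx ?mul1mx// unitarymx_unit.
rewrite Uy -scalemxAr => /(congr1 (fun z => a^* *: z)).
by rewrite scalerA mulrC aa scale1r.
Qed.

(** Eigenvectors of a unitary matrix for different eigenvalues are orthogonal. This makes the
    relation [Lambda] single-valued: its last clause fixes [y] only up to the eigenspace of -1. *)
Lemma robin_orthogonal n (U : 'M[C]_n) (w x : 'cV[C]_n) : U \is unitarymx ->
  U *m w = - w -> robin_space U x -> w^t* *m x = 0.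
Proof.
move=> Uu Uw [k [a [y [ay ->]]]]; rewrite mulmx_sumr big1// => j _.
have [_ a1 Uy] := ay j.
have Uw' : U^t* *m w = - w.
  have Uw1 : U *m w = (-1) *: w by rewrite scaleN1r.
  by rewrite (unitary_eigenC Uu Uw1) rmorphN1 scaleN1r.
have : w^t* *m U *m y j = - (w^t* *m y j).
  have <- : (U^t* *m w)^t* = w^t* *m U.
    by rewrite trmx_mul map_mxM /= trmxCK.
  by rewrite Uw' linearN /= map_mxN mulNmx.
rewrite -mulmxA Uy -scalemxAr => /eqP; rewrite -addr_eq0 -{2}[w^t* *m _]scale1r.
rewrite -scalerDl scaler_eq0 => /orP[|/eqP//].
by rewrite addr_eq0 (negbTE a1).
Qed.

Lemma vnorm_ge0 n (x : 'cV[C]_n) : 0 <= vnorm x.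
Proof. exact: sqrtr_ge0. Qed.

Lemma vnormZ n (a : R) (x : 'cV[C]_n) : 0 <= a -> vnorm ((a%:C)%C *: x) = a * vnorm x.
Proof.
move=> a0; rewrite !vnormE vnorm2Z /abs2 /= expr0n addr0 sqrtrM ?sqr_ge0//.
by rewrite sqrtr_sqr ger0_norm.
Qed.

Lemma robin_scale n (U : 'M[C]_n) (x : 'cV[C]_n) a :
  robin_space U x -> robin_space U (a *: x).
Proof.
move=> [k [b [y [by_ ->]]]]; exists k, b, (fun j => a *: y j); split.
  move=> j; have [? ? Uy] := by_ j; split=> //.
  by rewrite -scalemxAr Uy !scalerA mulrC.
by rewrite scaler_sumr.
Qed.

Lemma Lambda_norm_le n (U : 'M[C]_n) (K : R) x y : 0 <= K ->
  (Lambda_norm U <= K%:E)%E -> Lambda U x y -> vnorm y <= K * vnorm x.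
Proof.
move=> K0 UK [rx ry Uxy].
apply/ler_addgt0Pr => e e0.
have K1 : 0 < K + 1 by rewrite ltr_wpDl.
(* The shift [d] allows [x = 0] in the normalisation; its cost [K * d] is at most [e]. *)
pose d := e / (K + 1); have d0 : 0 < d by rewrite divr_gt0.
have xd : 0 < vnorm x + d by rewrite ltr_wpDl// vnorm_ge0.
pose t := (vnorm x + d)^-1; have t0 : 0 < t by rewrite invr_gt0.
have : vnorm ((t%:C)%C *: y) <= K.
  rewrite -lee_fin; apply: le_trans UK; apply: ereal_sup_ubound.
  exists ((t%:C)%C *: x, (t%:C)%C *: y) => //=; split.
    by rewrite vnormZ ?(ltW t0)// mulrC /t ler_pdivrMr// mul1r lerDl ltW.
  split; [exact: robin_scale|exact: robin_scale|].
  by rewrite -!scalemxAr Uxy scalerA mulrC -scalerA.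
rewrite vnormZ ?(ltW t0)// mulrC /t ler_pdivrMr// => /le_trans; apply.
rewrite mulrDr lerD2l /d mulrCA -[leRHS]mulr1 ler_wpM2l ?(ltW e0)//.
by rewrite ler_pdivrMr// mul1r lerDl.
Qed.

(* ||Lambda|| <= K as a polynomial inequality in the entries of U, hence closed
   under limits, whereas the range of P^R may jump. *)
Definition Lambda_ineq n (K : R) (U : 'M[C]_n) : Prop := forall x : 'cV[C]_n,
  vnorm2 ((U - 1%:M) *m ((U + 1%:M) *m x)) <=
  K ^+ 2 * vnorm2 ((U + 1%:M) *m ((U + 1%:M) *m x)).

Lemma vnorm_le_vnorm2 n (K : R) (x y : 'cV[C]_n) : 0 <= K ->
  (vnorm y <= K * vnorm x) = (vnorm2 y <= K ^+ 2 * vnorm2 x).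
Proof.
move=> K0; rewrite -(ler_pXn2r (n := 2)) ?nnegrE ?mulr_ge0 ?vnorm_ge0// exprMn.
by rewrite !vnormE !sqr_sqrtr ?vnorm2_ge0.
Qed.

Lemma unitary_spectral n (U : 'M[C]_n) : U \is unitarymx ->
  exists P (d : 'rV[C]_n), [/\ P \is unitarymx, P^t* \is unitarymx
    & U = P^t* *m diag_mx d *m P].
Proof.
move=> /unitary_normalmx /orthomx_spectralP UE.
exists (spectralmx U), (spectral_diag U); have Pu := spectral_unitarymx U.
split.
- exact: Pu.
- by move: Pu; generalize (spectralmx U) => P; rewrite -trmxC_unitary.
by rewrite -(invmx_unitary Pu).
Qed.

(** In an orthonormal eigenbasis, [Lambda] relates the Robin part [gx] of [(U + 1)^2 x] to the
    vector [-i (U - 1)(U + 1) x]. The latter has no component for the eigenvalues 1 and -1, and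
    dropping these components from [(U + 1)^2 x] can only decrease its norm. *)
Lemma Lambda_norm_ineq n (U : 'M[C]_n) (K : R) : 0 <= K -> U \is unitarymx ->
  (Lambda_norm U <= K%:E)%E -> Lambda_ineq K U.
Proof.
move=> K0 Uu UK x.
have [P [d [Pu Pi UE]]] := unitary_spectral Uu.
have PK (z : 'cV[C]_n) : P *m (P^t* *m z) = z.
  by rewrite mulmxA (unitarymxP Pu) mul1mx.
have PK' (z : 'cV[C]_n) : P^t* *m (P *m z) = z.
  by rewrite mulmxA -(invmx_unitary Pu) mulVmx ?mul1mx// unitarymx_unit.
pose c i : C := (P *m x) i 0.
(* [F g] multiplies the [i]-th eigencoordinate of [x] by [g i], so that identities between matrices
   become identities between scalars. *)
pose F (g : 'I_n -> C) : 'cV[C]_n := P^t* *m (\col_i (g i * c i)).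
have FE g : vnorm2 (F g) = \sum_i abs2 (g i) * abs2 (c i).
  rewrite /F vnorm2_unitary//; apply: eq_bigr => i _.
  by rewrite mxE abs2M.
have F1 : x = F (fun=> 1).
  rewrite /F (_ : \col_i _ = P *m x) ?PK'//.
  by apply/matrixP => i j; rewrite ord1 mxE mul1r.
have UF g : U *m F g = F (fun i => d 0 i * g i).
  rewrite UE /F -!mulmxA PK; congr (_ *m _).
  apply/matrixP => i j; rewrite mul_diag_mx !mxE; ring.
have FD g h : F g + F h = F (fun i => g i + h i).
  rewrite /F -mulmxDr; congr (_ *m _); apply/matrixP => i j; rewrite !mxE; ring.
have FZ a g : a *: F g = F (fun i => a * g i).
  rewrite /F scalemxAr; congr (_ *m _); apply/matrixP => i j; rewrite !mxE; ring.
have U1F g : (U + 1%:M) *m F g = F (fun i => (d 0 i + 1) * g i).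
  by rewrite mulmxDl mul1mx UF FD; congr F; apply/funext => i; ring.
have U2F g : (U - 1%:M) *m F g = F (fun i => (d 0 i - 1) * g i).
  rewrite mulmxBl mul1mx UF -scaleN1r FZ FD; congr F; apply/funext => i; ring.
pose ok i := (d 0 i != 1) && (d 0 i != -1).
have robinF g : (forall i, ~~ ok i -> g i = 0) -> robin_space U (F g).
  (* On the discarded indices the vectors vanish, and 0 serves as their eigenvalue since it differs
     from 1 and -1. *)
  move=> g0; exists n, (fun i => if ok i then d 0 i else 0),
    (fun i => F (fun j => if j == i then g i else 0)); split.
    move=> i; case: ifPn => [/andP[]|nok]; split => //.
    - rewrite UF FZ; congr F; apply/funext => j; case: eqP => [->//|]; by rewrite !mulr0.
    - by rewrite eq_sym oner_eq0.
    - by rewrite eq_sym oppr_eq0 oner_eq0.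
    - rewrite UF FZ; congr F; apply/funext => j; rewrite g0//.
      by rewrite if_same !mulr0.
  rewrite /F -mulmx_sumr; congr (_ *m _); apply/matrixP => i j.
  rewrite summxE (bigD1 i)//= big1 ?addr0 ?mxE ?eqxx// => k ki.
  by rewrite mxE eq_sym (negbTE ki) mul0r.
pose gx i := if ok i then (d 0 i + 1) * ((d 0 i + 1) * 1) else 0.
pose gy i := - 'i%C * ((d 0 i - 1) * ((d 0 i + 1) * 1)).
have L : Lambda U (F gx) (F gy).
  split.
  - by apply: robinF => i nok; rewrite /gx (negbTE nok).
  - apply: robinF => i; rewrite negb_and !negbK => /orP[] /eqP di; rewrite /gy di; ring.
  rewrite U1F U2F FZ; congr F; apply/funext => i; rewrite /gx /gy.
  case: ifPn => [_|]; first by ring.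
  by rewrite negb_and !negbK => /orP[] /eqP ->; ring.
have := Lambda_norm_le K0 UK L.
rewrite (vnorm_le_vnorm2 _ _ K0) => h.
move: h; rewrite F1 !U1F U2F => h.
apply: le_trans (le_trans h _).
  rewrite !FE le_eqVlt; apply/orP; left; apply/eqP; apply: eq_bigr => i _.
  rewrite /gy [in RHS]abs2M (_ : abs2 (- 'i%C) = 1) ?mul1r//.
  by rewrite /abs2 /=; ring.
rewrite ler_wpM2l ?sqr_ge0// !FE; apply: ler_sum => i _.
rewrite ler_wpM2r ?abs2_ge0// /gx; case: ifP => // _.
by rewrite abs20 abs2_ge0.
Qed.

(** The eigenvalues occurring in [robin_space] differ from -1, so [(U + 1)^2 v = x] is solved
    termwise. The inequality at [v] bounds [q], which is [(U + 1)^-1 (U - 1) x], and [y = -i q]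
    because the difference [w] is orthogonal to itself. *)
Lemma Lambda_ineq_norm n (U : 'M[C]_n) (K : R) : 0 <= K -> U \is unitarymx ->
  Lambda_ineq K U -> (Lambda_norm U <= K%:E)%E.
Proof.
move=> K0 Uu UK; apply: ge_ereal_sup => _ [[x y] /= [x1 [rx ry Uxy]] <-].
rewrite lee_fin.
have [k [a [z [az xE]]]] := rx.
pose q : 'cV[C]_n := \sum_j ((a j - 1) / (a j + 1)) *: z j.
pose v : 'cV[C]_n := \sum_j ((a j + 1) ^- 2) *: z j.
have a1 j : a j + 1 != 0 by have [_ h _] := az j; rewrite addr_eq0.
have Uz c : U *m (\sum_j c j *: z j) = \sum_j (a j * c j) *: z j.
  rewrite mulmx_sumr; apply: eq_bigr => j _; have [_ _ h] := az j.
  by rewrite -scalemxAr h scalerA mulrC.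
have U1z c : (U + 1%:M) *m (\sum_j c j *: z j) = \sum_j ((a j + 1) * c j) *: z j.
  rewrite mulmxDl mul1mx Uz -big_split /=; apply: eq_bigr => j _.
  by rewrite -scalerDl mulrDl mul1r.
have U2z c : (U - 1%:M) *m (\sum_j c j *: z j) = \sum_j ((a j - 1) * c j) *: z j.
  rewrite mulmxBl mul1mx Uz -sumrB /=; apply: eq_bigr => j _.
  by rewrite -scalerBl mulrBl mul1r.
have xv : (U + 1%:M) *m ((U + 1%:M) *m v) = x.
  rewrite !U1z xE; apply: eq_bigr => j _; rewrite -[RHS]scale1r; congr (_ *: _).
  by rewrite mulrA -expr2 divff// expf_neq0.
have qv : (U - 1%:M) *m ((U + 1%:M) *m v) = q.
  rewrite U1z U2z; apply: eq_bigr => j _; congr (_ *: _).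
  by rewrite expr2; field.
have qx : (U + 1%:M) *m q = (U - 1%:M) *m x.
  rewrite U1z xE (_ : \sum_i z i = \sum_i 1 *: z i) ?U2z; last first.
    by apply: eq_bigr => j _; rewrite scale1r.
  by apply: eq_bigr => j _; congr (_ *: _); field.
have rq : robin_space U q.
  exists k, a, (fun j => ((a j - 1) / (a j + 1)) *: z j); split=> // j.
  have [h1 h2 h3] := az j; split=> //.
  by rewrite -scalemxAr h3 !scalerA mulrC.
pose w := y + 'i%C *: q.
have Uw : U *m w = - w.
  apply/eqP; rewrite -addr_eq0 -{2}[w]mul1mx -mulmxDl /w mulmxDr -scalemxAr qx Uxy.
  by rewrite scaleNr addNr.
have w0 : w = 0.
  apply: vnorm2_eq0; apply: complexI; rewrite vnorm2C.
  rewrite {2}/w mulmxDr (robin_orthogonal Uu Uw ry) -scalemxAr.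
  by rewrite (robin_orthogonal Uu Uw rq) scaler0 addr0 mxE.
have yq : y = (- 'i%C) *: q by apply/eqP; rewrite scaleNr -addr_eq0 -/w w0.
have := UK v; rewrite xv qv => h.
have : vnorm y <= K * vnorm x.
  rewrite (vnorm_le_vnorm2 _ _ K0) yq vnorm2Z (_ : abs2 (- 'i%C) = 1) ?mul1r//.
  by rewrite /abs2 /=; ring.
by move=> /le_trans; apply; rewrite -[leRHS]mulr1 ler_wpM2l.
Qed.

End complex_matrix_facts.

(** * Limits of complex matrices *)

Section complex_limits.
Variable R : realType.
Local Notation C := R[i].

Definition cabs (z : C) : R := Num.sqrt (abs2 z).

Lemma normC_cabs (z : C) : `|z| = ((cabs z)%:C)%C.
Proof. by rewrite normc_def. Qed.

Lemma cabs_ge0 z : 0 <= cabs z. Proof. exact: sqrtr_ge0. Qed.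

Lemma cabsM z w : cabs (z * w) = cabs z * cabs w.
Proof. by rewrite /cabs abs2M sqrtrM ?abs2_ge0. Qed.

Lemma cabsD z w : cabs (z + w) <= cabs z + cabs w.
Proof. by rewrite -lecR rmorphD /= -!normC_cabs ler_normD. Qed.

Lemma cabs_sum I (s : seq I) (F : I -> C) :
  cabs (\sum_(i <- s) F i) <= \sum_(i <- s) cabs (F i).
Proof.
elim/big_ind2 : _ => //; first by rewrite /cabs abs20 sqrtr0.
by move=> x a y b xa yb; apply: le_trans (cabsD _ _) _; rewrite lerD.
Qed.

Lemma Re_le_cabs z : `|complex.Re z| <= cabs z.
Proof. by rewrite -sqrtr_sqr ler_sqrt ?abs2_ge0// lerDl sqr_ge0. Qed.

Lemma Im_le_cabs z : `|complex.Im z| <= cabs z.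
Proof. by rewrite -sqrtr_sqr ler_sqrt ?abs2_ge0// lerDr sqr_ge0. Qed.

Lemma cabs_le z : cabs z <= `|complex.Re z| + `|complex.Im z|.
Proof.
rewrite -(ler_pXn2r (n := 2)) ?nnegrE ?cabs_ge0 ?addr_ge0//.
rewrite sqr_sqrtr ?abs2_ge0// /abs2 sqrrD !real_normK ?num_real//.
by rewrite lerD2r lerDl mulrn_wge0// mulr_ge0.
Qed.

Lemma vnorm_le_sum n (x : 'cV[C]_n) : vnorm x <= \sum_i cabs (x i 0).
Proof.
have s0 (s : seq 'I_n) : 0 <= \sum_(i <- s) cabs (x i 0).
  by apply: sumr_ge0 => i _; exact: cabs_ge0.
rewrite -(ler_pXn2r (n := 2)) ?nnegrE ?vnorm_ge0//.
rewrite vnormE sqr_sqrtr ?vnorm2_ge0// /vnorm2.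
elim: (index_enum _) => [|i s IH]; first by rewrite !big_nil expr0n.
rewrite !big_cons sqrrD {1}/cabs sqr_sqrtr ?abs2_ge0// -[leRHS]addrA lerD2l.
by rewrite (le_trans IH)// lerDr mulrn_wge0// mulr_ge0 ?cabs_ge0.
Qed.

Lemma cabs_le_vnorm n (x : 'cV[C]_n) i : cabs (x i 0) <= vnorm x.
Proof.
rewrite /cabs vnormE ler_sqrt ?vnorm2_ge0// /vnorm2 (bigD1 i)//= lerDl.
by apply: sumr_ge0 => j _; exact: abs2_ge0.
Qed.

Lemma opnorm_le_sum n (A : 'M[C]_n) :
  (opnorm A <= (\sum_i \sum_j cabs (A i j))%:E)%E.
Proof.
apply: ge_ereal_sup => _ [x /= x1 <-]; rewrite lee_fin.
apply: le_trans (vnorm_le_sum _) _; apply: ler_sum => i _.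
rewrite mxE; apply: le_trans (cabs_sum _ _) _; apply: ler_sum => j _.
rewrite cabsM -[leRHS]mulr1 ler_wpM2l ?cabs_ge0//.
exact: le_trans (cabs_le_vnorm _ _) x1.
Qed.

Lemma cvg_complexP (T : Type) (F : set_system T) (FF : Filter F) (u : T -> C^o) (l : C^o) :
  u @ F --> l <->
  ((fun x => complex.Re (u x)) @ F --> complex.Re l) /\
  ((fun x => complex.Im (u x)) @ F --> complex.Im l).
Proof.
split=> [/cvgrPdist_lt ul|[/cvgrPdist_lt hR /cvgrPdist_lt hI]].
  have h (e : R) : 0 < e -> \forall x \near F, cabs (l - u x) < e.
    move=> e0; have ec : (0 : C) < (e%:C)%C by rewrite ltcR.
    have := ul _ ec.
    by apply: filterS => x; rewrite normC_cabs ltcR.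
  split; apply/(@cvgrPdist_lt _ R^o) => e /h; apply: (@filterS _ F FF) => x; apply: le_lt_trans.
    by rewrite -raddfB Re_le_cabs.
  by rewrite -raddfB Im_le_cabs.
apply/cvgrPdist_lt => e e0.
have eE : e = ((complex.Re e)%:C)%C.
  by case: e e0 => a b; rewrite ltcE /= => /andP[/eqP->].
have e1 : 0 < complex.Re e by move: e0; rewrite eE ltcR.
have e2 : 0 < complex.Re e / 2 by rewrite divr_gt0.
near=> x; rewrite eE normC_cabs ltcR.
apply: le_lt_trans (cabs_le _) _; rewrite [ltRHS]splitr ltrD// raddfB.
  by near: x; exact: hR.
by near: x; exact: hI.
Unshelve. all: end_near. Qed.

Definition mx_cvg m n (A_ : nat -> 'M[C]_(m, n)) (A : 'M[C]_(m, n)) : Prop :=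
  forall i j, (fun k => A_ k i j : C^o) @ \oo --> (A i j : C^o).

Lemma mx_cvg_cst m n (A : 'M[C]_(m, n)) : mx_cvg (fun=> A) A.
Proof. by move=> i j; exact: cvg_cst. Qed.

Lemma mx_cvgD m n A_ B_ (A B : 'M[C]_(m, n)) : mx_cvg A_ A -> mx_cvg B_ B ->
  mx_cvg (fun k => A_ k + B_ k) (A + B).
Proof.
move=> hA hB i j; rewrite mxE.
rewrite (_ : (fun k => _) = (fun k => (A_ k i j : C^o) + B_ k i j)).
  exact: cvgD.
by apply/funext => k; rewrite mxE.
Qed.

Lemma mx_cvgN m n A_ (A : 'M[C]_(m, n)) : mx_cvg A_ A ->
  mx_cvg (fun k => - A_ k) (- A).
Proof.
move=> hA i j; rewrite mxE.
rewrite (_ : (fun k => _) = (fun k => - (A_ k i j : C^o))).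
  exact: cvgN.
by apply/funext => k; rewrite mxE.
Qed.

Lemma mx_cvgM m n p A_ B_ (A : 'M[C]_(m, n)) (B : 'M[C]_(n, p)) :
  mx_cvg A_ A -> mx_cvg B_ B -> mx_cvg (fun k => A_ k *m B_ k) (A *m B).
Proof.
move=> hA hB i j; rewrite mxE.
rewrite (_ : (fun k => _) = (fun k => \sum_l (A_ k i l : C^o) * B_ k l j)).
  apply: cvg_big => [|l _]; first exact: add_continuous.
  by apply: cvgM; [exact: hA|exact: hB].
by apply/funext => k; rewrite mxE.
Qed.

Lemma mx_cvg_trmxC m n A_ (A : 'M[C]_(m, n)) : mx_cvg A_ A ->
  mx_cvg (fun k => (A_ k)^t*) (A^t*).
Proof.
move=> hA i j; have /cvg_complexP[hR hI] := hA j i.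
have eR (z : C) : complex.Re (z^*) = complex.Re z by case: z.
have eI (z : C) : complex.Im (z^*) = - complex.Im z by case: z.
apply/cvg_complexP; split; rewrite !mxE.
  by under eq_fun do rewrite !mxE eR; rewrite eR.
by under eq_fun do rewrite !mxE eI; rewrite eI; exact: cvgN.
Qed.

Lemma mx_cvg_unique m n A_ (A B : 'M[C]_(m, n)) :
  mx_cvg A_ A -> mx_cvg A_ B -> A = B.
Proof.
move=> hA hB; apply/matrixP => i j.
have /cvg_complexP[aR aI] := hA i j; have /cvg_complexP[bR bI] := hB i j.
apply/eqP; rewrite eq_complex; apply/andP; split; apply/eqP.
  exact: (cvg_unique _ aR bR).
exact: (cvg_unique _ aI bI).
Qed.

Lemma mx_cvg_near m n A_ B_ (A : 'M[C]_(m, n)) :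
  (\forall k \near \oo, A_ k = B_ k) -> mx_cvg A_ A -> mx_cvg B_ A.
Proof.
move=> AB hA i j; apply: cvg_trans (hA i j); apply: near_eq_cvg.
by apply: filterS AB => k ->.
Qed.

Lemma cvg_vnorm2 n x_ (x : 'cV[C]_n) : mx_cvg x_ x ->
  (fun k => vnorm2 (x_ k)) @ \oo --> vnorm2 x.
Proof.
move=> hx; apply: cvg_big => [|i _]; first exact: add_continuous.
have /cvg_complexP[hR hI] := hx i 0.
by apply: cvgD; rewrite /GRing.exp /=; apply: cvgM.
Qed.

Lemma unitary_limit n U_ (U : 'M[C]_n) : mx_cvg U_ U ->
  (\forall k \near \oo, U_ k \is unitarymx) -> U \is unitarymx.
Proof.
move=> hU Uu; apply/unitarymxP.
have h : mx_cvg (fun k => U_ k *m (U_ k)^t*) 1%:M.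
  apply: (@mx_cvg_near n n (fun=> 1%:M)); last exact: mx_cvg_cst.
  by apply: filterS Uu => k /unitarymxP ->.
exact: mx_cvg_unique (mx_cvgM hU (mx_cvg_trmxC hU)) h.
Qed.

Lemma Lambda_norm_limit n U_ (U : 'M[C]_n) (K : R) : 0 <= K -> mx_cvg U_ U ->
  (\forall k \near \oo, U_ k \is unitarymx /\ (Lambda_norm (U_ k) <= K%:E)%E) ->
  (Lambda_norm U <= K%:E)%E.
Proof.
move=> K0 hU UK.
have Uu : U \is unitarymx by apply: (unitary_limit hU); apply: filterS UK => k [].
apply: Lambda_ineq_norm => // x.
have hD := mx_cvgD hU (@mx_cvg_cst n n 1%:M).
have hB := mx_cvgD hU (mx_cvgN (@mx_cvg_cst n n 1%:M)).
have hx := @mx_cvg_cst n 1 x.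
have h1 := cvg_vnorm2 (mx_cvgM hB (mx_cvgM hD hx)).
have h2 : (fun k => K ^+ 2 * vnorm2 ((U_ k + 1%:M) *m ((U_ k + 1%:M) *m x))) @ \oo
    --> K ^+ 2 * vnorm2 ((U + 1%:M) *m ((U + 1%:M) *m x)).
  by apply: cvgMr; exact: cvg_vnorm2 (mx_cvgM hD (mx_cvgM hD hx)).
apply: (ler_cvg_to h1 h2).
by apply: filterS UK => k [Uk Lk]; exact: Lambda_norm_ineq.
Qed.

Lemma opnorm_cvg0 n U_ (U : 'M[C]_n) (e : R) : 0 < e -> mx_cvg U_ U ->
  \forall k \near \oo, (opnorm (U - U_ k) < e%:E)%E.
Proof.
move=> e0 hU.
have h : (fun k => \sum_i \sum_j cabs ((U - U_ k) i j)) @ \oo --> (0 : R).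
  rewrite -[X in _ --> X](_ : \sum_(i < n) \sum_(j < n) (0 : R) = 0); last first.
    by rewrite big1// => i _; rewrite big1.
  apply: cvg_big => [|i _]; first exact: add_continuous.
  apply: cvg_big => [|j _]; first exact: add_continuous.
  apply/cvgrPdist_lt => d d0.
  have dc : (0 : C) < (d%:C)%C by rewrite ltcR.
  move/cvgrPdist_lt : (hU i j) => /(_ _ dc).
  apply: filterS => k; rewrite normC_cabs ltcR sub0r normrN !mxE.
  by rewrite ger0_norm ?cabs_ge0.
near=> k; apply: le_lt_trans (opnorm_le_sum _) _; rewrite lte_fin.
by near: k; exact: (cvgr_lt _ h).
Unshelve. all: end_near. Qed.

Lemma unitary_entry_le n (U : 'M[C]_n) i j : U \is unitarymx -> cabs (U i j) <= 1.
Proof.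
move=> /unitarymxP /matrixP /(_ i i); rewrite !mxE eqxx => h.
have {}h : \sum_k abs2 (U i k) = 1.
  apply: complexI; rewrite rmorph_sum /=; apply: etrans h; apply: eq_bigr => k _.
  by rewrite abs2C !mxE.
rewrite -sqrtr1 ler_sqrt// -h (bigD1 j)//= lerDl.
by apply: sumr_ge0 => k _; exact: abs2_ge0.
Qed.

End complex_limits.

(** * Convergent integers and equi-Lipschitz functions *)

Section real_sequences.
Variable R : realType.

Lemma natr_dist_lt1 (a b : nat) : `|a%:R - b%:R| < (1 : R) -> a = b.
Proof.
rewrite ltr_norml => /andP[h1 h2]; apply/eqP; rewrite eqn_leq.
apply/andP; split; rewrite leqNgt; apply/negP => h.
  have : (b.+1%:R : R) <= a%:R by rewrite ler_nat.
  by rewrite -natr1; lra.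
have : (a.+1%:R : R) <= b%:R by rewrite ler_nat.
by rewrite -natr1; lra.
Qed.

Lemma cvg_nat_near (u : nat -> nat) (l : nat) :
  (fun k => (u k)%:R : R) @ \oo --> (l%:R : R) -> \forall k \near \oo, u k = l.
Proof.
move=> /cvgrPdist_lt /(_ 1 ltr01); apply: filterS => k /=.
by move=> /natr_dist_lt1.
Qed.

Lemma is_cvg_nat (u : nat -> nat) :
  cvgn (fun k => (u k)%:R : R) -> exists l, \forall k \near \oo, u k = l.
Proof.
move=> /cvg_ex[/= l /cvgrPdist_lt ul].
have h2 : (0 : R) < 1 / 2 by rewrite divr_gt0.
have [N _ hN] := ul _ h2; exists (u N); exists N => // k /= Nk.
have h1 := hN N (leqnn N); have h3 := hN k Nk.
apply: natr_dist_lt1.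
rewrite (le_lt_trans (ler_distD l _ _))// [ltRHS](splitr 1) ltrD//.
by rewrite distrC.
Qed.

Lemma rat_near01 (t e : R) : 0 <= t <= 1 -> 0 < e ->
  exists q : rat, 0 <= (ratr q : R) <= 1 /\ `|t - ratr q| < e.
Proof.
move=> /andP[t0 t1] e0; have [->|tn0] := eqVneq t 0.
  by exists 0; rewrite rmorph0 lexx ler01 subrr normr0.
have tp : 0 < t by rewrite lt_neqAle eq_sym tn0.
have /rat_in_itvoo[q] : Num.max 0 (t - e) < t by rewrite gt_max tp/= ltrBlDr ltrDl.
rewrite in_itv/= gt_max => /andP[/andP[q0 qe] qt].
exists q; split; first by rewrite ltW//= (le_trans (ltW qt)).
by rewrite gtr0_norm ?subr_gt0// ltrBlDl -ltrBlDr.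
Qed.

Lemma nbhs_all_in (I : eqType) (s : seq I) (P : I -> nat -> Prop) :
  (forall i, i \in s -> \forall k \near \oo, P i k) ->
  \forall k \near \oo, forall i, i \in s -> P i k.
Proof.
elim: s => [|i s IH] h; first by apply: nearW => k i.
have h1 : \forall k \near \oo, P i k by apply: h; rewrite mem_head.
have h2 : \forall k \near \oo, forall i, i \in s -> P i k.
  by apply: IH => j js; apply: h; rewrite in_cons js orbT.
near=> k => j; rewrite in_cons => /orP[/eqP->|js]; first by near: k.
have : forall i, i \in s -> P i k by near: k.
exact.
Unshelve. all: end_near. Qed.

Section lipschitz_sequences.
Variables (g : nat -> R -> R) (K : R).
Hypothesis K0 : 0 < K.
Hypothesis g_lip : forall k t t', 0 <= t <= 1 -> 0 <= t' <= 1 ->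
  `|g k t - g k t'| <= K * `|t - t'|.

(** Potentials are recorded at rational points only; the common Lipschitz constant makes the values
    at any other [t] a Cauchy sequence. *)
Lemma is_cvg_lipschitz :
  (forall q : rat, 0 <= (ratr q : R) <= 1 -> cvgn (fun k => g k (ratr q))) ->
  forall t, 0 <= t <= 1 -> cvgn (fun k => g k t).
Proof.
move=> hq t t01; apply/cauchy_cvgP/cauchy_ballP => e e0.
have e4 : 0 < e / 4 by rewrite divr_gt0.
have eK : 0 < e / 4 / K by rewrite divr_gt0.
have [q [q01 tq]] := rat_near01 t01 eK.
have /cvg_ex[l hl] := hq q q01.
have gl := @cvgr_dist_lt _ _ _ _ _ _ _ hl _ e4.
have [N _ hN] : \forall k \near \oo, `|l - g k (ratr q)| < e / 4 by exact: gl.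
have key k : (N <= k)%N -> `|l - g k t| < e / 2.
  move=> Nk; rewrite (le_lt_trans (ler_distD (g k (ratr q)) _ _))//.
  have h1 : `|l - g k (ratr q)| < e / 4 := hN k Nk.
  have h2 : `|g k (ratr q) - g k t| <= e / 4.
    apply: le_trans (g_lip _ q01 t01) _.
    by rewrite -ler_pdivlMl// mulrC distrC ltW.
  lra.
exists ([set x | `|l - x| < e / 2], [set x | `|l - x| < e / 2]) => /=.
  by split; exists N => // k; exact: key.
move=> [a b] /= [ha hb]; rewrite /ball/= (le_lt_trans (ler_distD l _ _))//.
by rewrite [ltRHS]splitr ltrD// distrC.
Qed.

Lemma lipschitz_uniform_limit (h : R -> R) :
  (forall t t', 0 <= t <= 1 -> 0 <= t' <= 1 -> `|h t - h t'| <= K * `|t - t'|) ->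
  (forall q : rat, 0 <= (ratr q : R) <= 1 ->
    (fun k => g k (ratr q)) @ \oo --> h (ratr q)) ->
  forall e : R, 0 < e -> \forall k \near \oo, forall t : R, 0 <= t <= 1 ->
    `|h t - g k t| <= e.
Proof.
move=> h_lip hq e e0.
(* A grid of mesh [1/n] with [K / n <= e / 3]: one third of [e] is for the grid points, which are
   rational, and one third each for the Lipschitz bounds of [h] and [g k]. *)
pose n := (Num.truncn (3 * K / e)).+1.
have n0 : (0 : R) < n%:R by rewrite ltr0n.
have nK : K / n%:R <= e / 3.
  have : 3 * K / e < n%:R by rewrite truncnS_gt.
  rewrite ltr_pdivrMr// => hn.
  by rewrite ler_pdivrMr//; lra.
have grid (i : nat) : (i <= n)%N -> 0 <= (i%:R / n%:R : R) <= 1.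
  move=> i_n; rewrite divr_ge0//= ler_pdivrMr// mul1r ler_nat//.
have ratE (i : nat) : ratr (i%:R / n%:R) = i%:R / n%:R :> R.
  by rewrite fmorph_div !rmorph_nat.
have : \forall k \near \oo, forall i, i \in iota 0 n.+1 ->
    `|h (i%:R / n%:R) - g k (i%:R / n%:R)| <= e / 3.
  apply: nbhs_all_in => i; rewrite mem_iota /= add0n ltnS => i_n.
  have e3 : 0 < e / 3 by rewrite divr_gt0.
  have := hq (i%:R / n%:R); rewrite ratE => /(_ (grid i i_n)) /cvgrPdist_le.
  exact.
apply: filterS => k hk t t01; have /andP[t0 t1] := t01.
pose i := Num.truncn (t * n%:R).
have tn0 : 0 <= t * n%:R by rewrite mulr_ge0// ltW.
have /andP[i1 i2] := truncn_itv tn0.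
have i_n : (i <= n)%N.
  by rewrite -(ler_nat R) (le_trans i1)// ler_piMl// ltW.
have ti : `|t - i%:R / n%:R| <= n%:R^-1.
  have i1' : i%:R / n%:R <= t by rewrite ler_pdivrMr.
  rewrite ger0_norm ?subr_ge0// lerBlDl.
  have -> : i%:R / n%:R + n%:R^-1 = i.+1%:R / n%:R :> R.
    by rewrite -natr1 mulrDl mul1r.
  by rewrite ler_pdivlMr// ltW.
have hi := hk i; rewrite mem_iota /= add0n ltnS in hi.
have {hi} hi := hi i_n.
have h1 := h_lip _ _ t01 (grid i i_n); have h2 := g_lip k t01 (grid i i_n).
have h3 : K * `|t - i%:R / n%:R| <= e / 3.
  by apply: le_trans nK; rewrite ler_wpM2l// ltW.
have -> : h t - g k t = (h t - h (i%:R / n%:R)) + (h (i%:R / n%:R) - g k (i%:R / n%:R))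
    - (g k t - g k (i%:R / n%:R)) by ring.
have -> : e = e / 3 + e / 3 + e / 3 by field.
apply: le_trans (ler_normB _ _) _; apply: lerD; last exact: le_trans h2 h3.
apply: le_trans (ler_normD _ _) _; apply: lerD => //; exact: le_trans h1 h3.
Qed.

End lipschitz_sequences.
End real_sequences.

(** * Coordinates of graphs with a marked bond *)

Section walks.
Variable R : realType.
Variable Q : qg_data R.
Implicit Types v w : vert Q.

(* The label [j] leads back to [v] when [j >= deg v]. *)
Definition nbr v (j : nat) : vert Q :=
  if insub j is Some j' then (@lab R Q v j').2 else v.

Definition walk v (s : seq nat) : vert Q := foldl nbr v s.

Lemma walk_rcons v s j : walk v (rcons s j) = nbr (walk v s) j.
Proof. by rewrite /walk -cats1 foldl_cat. Qed.

Lemma nbrE v (j : 'I_(deg v)) : nbr v j = (lab j).2.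
Proof. by rewrite /nbr valK. Qed.

Lemma nbr_ge v j : (deg v <= j)%N -> nbr v j = v.
Proof. by move=> h; rewrite /nbr insubF// ltnNge h. Qed.

(** Here and in [sentry], padding by zero indexes the coordinates by the same labels for all graphs,
    whatever their degrees. *)
Definition elen v j : R := if (j < deg v)%N then blen (v, nbr v j) else 0.

(* The potential along the bond of label [j], rescaled to [0,1]; zero outside. *)
Definition epot v j (t : R) : R :=
  if (j < deg v)%N && (0 <= t <= 1)
  then pot (v, nbr v j) (t * blen (v, nbr v j)) else 0.

Definition sentry v (a b : nat) : R[i] :=
  if insub a is Some a' then
    if insub b is Some b' then @scat R Q v a' b' else 0
  else 0.

Lemma sentryE v (a b : 'I_(deg v)) : sentry v a b = scat v a b.
Proof. by rewrite /sentry !valK. Qed.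

Hypothesis QP : is_quantum_graph Q.

Lemma labE v (j : 'I_(deg v)) : lab j = (v, nbr v j).
Proof.
have [/(_ j I) /= [_ e] _ _] := lab_bij QP v.
by rewrite nbrE; move: (lab j) e => [a b] /= ->.
Qed.

Lemma adj_nbr v j : (j < deg v)%N -> adj v (nbr v j).
Proof.
move=> jv; pose j' := Ordinal jv.
have [/(_ j' I) /= [b _] _ _] := lab_bij QP v.
by move: b; rewrite /bonds /= labE.
Qed.

Lemma bonds_nbr v j : (j < deg v)%N -> bonds Q (v, nbr v j).
Proof. exact: adj_nbr. Qed.

Lemma adjP v w : adj v w -> exists2 j, (j < deg v)%N & nbr v j = w.
Proof.
move=> vw; have [_ _ /(_ (v, w))] := lab_bij QP v.
by case=> [|j _ jE]; [split|exists j => //; rewrite nbrE jE].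
Qed.

Lemma nbr_inj v i j : (i < deg v)%N -> (j < deg v)%N -> nbr v i = nbr v j -> i = j.
Proof.
move=> iv jv e; have [_ inj _] := lab_bij QP v.
have := inj (Ordinal iv) (Ordinal jv); rewrite !in_setT => /(_ isT isT).
by rewrite !labE /= e => /(_ erefl) [].
Qed.

Lemma nbr_neq v j : (j < deg v)%N -> nbr v j <> v.
Proof. by move=> jv e; have := adj_nbr jv; rewrite e (adj_irr QP). Qed.

End walks.

Section marked_graphs.
Variables (R : realType) (D : nat) (m M : R).

Record marked := Marked {
  mgraph : quantum_graph R;
  mbond : vert mgraph * vert mgraph;
  mbondP : bonds mgraph mbond;
  mboundsP : DmM_bounds D m M mgraph }.

Definition mwalk (x : marked) (s : seq nat) : vert (mgraph x) :=
  walk (mbond x).1 s.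

Lemma mlab_subproof (x : marked) :
  exists j, (j < deg (mbond x).1)%N /\ nbr (mbond x).1 j = (mbond x).2.
Proof. by have [j ? ?] := adjP (qgP (mgraph x)) (mbondP x); exists j. Qed.

Definition mlab (x : marked) : nat := projT1 (cid (mlab_subproof x)).

Lemma mlabP x : (mlab x < deg (mbond x).1)%N /\ nbr (mbond x).1 (mlab x) = (mbond x).2.
Proof. exact: projT2 (cid (mlab_subproof x)). Qed.

Definition code := (nat * (seq nat * seq nat) * (nat * nat) * rat)%type.

(** Truth values and integers are embedded in the reals, where convergence makes them eventually
    constant. *)
Definition mcoord_at (c : code) (x : marked) : R :=
  let: (tag, (s, s'), (a, b), q) := c in
  match tag with
  | 0 => (mwalk x s == mwalk x s')%:R
  | 1 => (deg (mwalk x s))%:R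
  | 2 => (mlab x)%:R
  | 3 => elen (mwalk x s) a
  | 4 => epot (mwalk x s) a (ratr q)
  | 5 => complex.Re (sentry (mwalk x s) a b)
  | _ => complex.Im (sentry (mwalk x s) a b)
  end.

Definition mcoord (n : nat) (x : marked) : R :=
  if unpickle n is Some c then mcoord_at c x else 0.

Lemma mcoord_pickle c x : mcoord (pickle c) x = mcoord_at c x.
Proof. by rewrite /mcoord pickleK. Qed.

Hypothesis m_gt0 : 0 < m.
Hypothesis m_lt_M : m < M.

Let M_gt0 : 0 < M. Proof. exact: lt_trans m_lt_M. Qed.

Lemma elen_itv (x : marked) (v : vert (mgraph x)) j : (j < deg v)%N ->
  m <= elen v j <= M.
Proof.
move=> jv; rewrite /elen jv; apply: (len_itv (mboundsP x)).
by exists (v, nbr v j) => //; exact: (bonds_nbr (qgP (mgraph x))).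
Qed.

Lemma scale_itv (x : marked) (v : vert (mgraph x)) j (t : R) : (j < deg v)%N ->
  0 <= t <= 1 -> t * blen (v, nbr v j) \in `[0, blen (v, nbr v j)].
Proof.
move=> jv /andP[t0 t1]; have := elen_itv jv; rewrite /elen jv => /andP[h _].
have L0 : 0 <= blen (v, nbr v j) by apply: le_trans h; exact: ltW.
by rewrite in_itv/= mulr_ge0//= ler_piMl.
Qed.

(** Rescaling to the unit interval multiplies the Lipschitz constant [M] by the edge length, again
    at most [M]. *)
Lemma epot_lip (x : marked) (v : vert (mgraph x)) j t t' :
  0 <= t <= 1 -> 0 <= t' <= 1 ->
  `|epot v j t - epot v j t'| <= M * M * `|t - t'|.
Proof.
move=> t01 t01'; rewrite /epot t01 t01' !andbT.
case: ifPn => jv; last by rewrite subrr normr0 !mulr_ge0 ?(ltW M_gt0).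
have b : bonds (mgraph x) (v, nbr v j) by exact: (bonds_nbr (qgP (mgraph x))).
have /(_ (t * blen (v, nbr v j), t' * blen (v, nbr v j))) := pot_lip (mboundsP x) b.
have s1 := scale_itv jv t01; have s2 := scale_itv jv t01'.
move=> /(_ (conj s1 s2)) /le_trans; apply.
rewrite /= -mulrBl normrM -mulrA ler_wpM2l ?(ltW M_gt0)// mulrC ler_wpM2r//.
have := elen_itv jv; rewrite /elen jv => /andP[h1 h2].
by rewrite ger0_norm// (le_trans _ h1)// ltW.
Qed.

Lemma epot_le (x : marked) (v : vert (mgraph x)) j t : `|epot v j t| <= M.
Proof.
rewrite /epot; case: ifPn => [/andP[jv t01]|]; last by rewrite normr0 (ltW M_gt0).
have b : bonds (mgraph x) (v, nbr v j) by exact: (bonds_nbr (qgP (mgraph x))).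
exact: (pot_le (mboundsP x) b (scale_itv jv t01)).
Qed.

Lemma sentry_le (x : marked) (v : vert (mgraph x)) a b : cabs (sentry v a b) <= 1.
Proof.
have c0 : cabs 0 <= (1 : R) by rewrite /cabs abs20 sqrtr0.
rewrite /sentry; case: insubP => [a' _ _|_//]; case: insubP => [b' _ _|_//].
by apply: unitary_entry_le; exact: scat_unitary (qgP (mgraph x)) v.
Qed.

Lemma mcoord_bound n x : `|mcoord n x| <= 1 + D%:R + M.
Proof.
have D0 : (0 : R) <= D%:R by [].
have M0 := ltW M_gt0.
rewrite /mcoord; case: unpickle => [[[[tag [s s']] [a b]] q]|]; last first.
  by rewrite normr0 !addr_ge0.
have degD (v : vert (mgraph x)) : (deg v)%:R <= (D%:R : R).
  by rewrite ler_nat; exact: deg_le (mboundsP x) v.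
case: tag => [|[|[|[|[|[|tag]]]]]] /=.
- by case: eqP => _; rewrite ?normr0 ?normr1; lra.
- by rewrite ger0_norm//; have := degD (mwalk x s); lra.
- rewrite ger0_norm//; have [h _] := mlabP x.
  have : (mlab x)%:R <= (deg (mbond x).1)%:R :> R by rewrite ler_nat ltnW.
  by have := degD (mbond x).1; lra.
- have [h|h] := ltnP a (deg (mwalk x s)).
    have /andP[h1 h2] := elen_itv h.
    rewrite ger0_norm; first by lra.
    by apply: le_trans h1; exact: ltW.
  by rewrite /elen ltnNge h /= normr0; lra.
- by have := epot_le (mwalk x s) a (ratr q); lra.
- have := Re_le_cabs (sentry (mwalk x s) a b); have := sentry_le (mwalk x s) a b; lra.
- have := Im_le_cabs (sentry (mwalk x s) a b); have := sentry_le (mwalk x s) a b; lra.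
Qed.

End marked_graphs.

Section edges_of.
Variable T : Type.
Implicit Types u v : T.

Lemma edge_ofC u v : edge_of (u, v) = edge_of (v, u).
Proof. by rewrite /edge_of /= setUC. Qed.

Lemma edge_of_inj (u v w : T) : edge_of (u, v) = edge_of (u, w) -> v = w.
Proof.
move=> e; have : edge_of (u, w) v by rewrite -e; right.
have : edge_of (u, v) w by rewrite e; right.
by move=> [/= ->|//] [/= ->|].
Qed.

End edges_of.

(** * Transfer of vertices along words *)

Section agreement.
Variables (R : realType) (D : nat) (m M : R).
Local Notation marked := (@marked R D m M).

(** Labels are below [D], so there are finitely many such words for each [k], and they reach all
    vertices at distance at most [k] from the origin of the marked bond. *)
Definition short (k : nat) (w : seq nat) : bool :=
  (size w <= k)%N && all (fun j => j < D)%N w.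

Lemma shortW k l w : (k <= l)%N -> short k w -> short l w.
Proof. by move=> kl /andP[h1 h2]; rewrite /short h2 (leq_trans h1). Qed.

Lemma deg_leD (x : marked) (v : vert (mgraph x)) : (deg v <= D)%N.
Proof. exact: deg_le (mboundsP x) v. Qed.

Lemma short_rcons (x : marked) (v : vert (mgraph x)) k w j :
  short k w -> (j < deg v)%N -> short k.+1 (rcons w j).
Proof.
move=> /andP[h1 h2] jv; rewrite /short size_rcons ltnS h1 all_rcons h2 andbT /=.
exact: leq_trans jv (deg_leD v).
Qed.

Lemma mwalk_rcons (x : marked) w j : mwalk x (rcons w j) = nbr (mwalk x w) j.
Proof. exact: walk_rcons. Qed.

Lemma mbond1 (x : marked) : (mbond x).1 = mwalk x [::]. Proof. by []. Qed.

Lemma mbond2 (x : marked) : (mbond x).2 = mwalk x [:: mlab x].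
Proof. by have [_ <-] := mlabP x. Qed.

Lemma mlab_ltD (x : marked) : (mlab x < D)%N.
Proof. by have [h _] := mlabP x; exact: leq_trans h (deg_leD _). Qed.

Definition interp (x : marked) (a : option (seq nat)) : option (vert (mgraph x)) :=
  omap (mwalk x) a.

Definition oshort k (a : option (seq nat)) : bool :=
  if a is Some w then short k w else true.

Lemma oshortW k l a : (k <= l)%N -> oshort k a -> oshort l a.
Proof. by case: a => //= w; exact: shortW. Qed.

Lemma adj_mwalk (x : marked) w w' : adj (mwalk x w) (mwalk x w') =
  [exists j : 'I_D, (j < deg (mwalk x w))%N && (mwalk x (rcons w j) == mwalk x w')].
Proof.
apply/idP/existsP => [/(adjP (qgP (mgraph x)))[j jv e]|[j /andP[jv /eqP <-]]].
  exists (Ordinal (leq_trans jv (deg_leD _))) => /=.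
  by rewrite jv mwalk_rcons e eqxx.
by rewrite mwalk_rcons; exact: (adj_nbr (qgP (mgraph x))).
Qed.

(** A step to an old neighbour adds one letter, and a step from the inserted vertex [None] restarts
    at [[::]] or [[:: mlab x]]. Words of length [n] are thus enough for the ball of radius [n]
    around the root. *)
Lemma sub_path_words (x : marked) p a i : oshort i a ->
  path (sub_adj (mbond x)) (interp x a) p ->
  exists q, p = map (interp x) q /\ all (oshort (i + size p)) q.
Proof.
elim: p a i => [|u p IH] a i ai; first by exists [::].
move=> /= /andP[au up].
have [b ub bi] : exists2 b, u = interp x b & oshort i.+1 b.
  move: au; case: a ai => [w|_] /=.
    case: u {up} => [v|]; last by exists None.
    move=> wi /and3P[/(adjP (qgP (mgraph x)))[j jv e] _ _].
    exists (Some (rcons w j)); first by rewrite /= mwalk_rcons e.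
    exact: (short_rcons (v := mwalk x w)).
  case: u {up} => [v|//] /orP[/eqP->|/eqP->].
    by exists (Some [::]).
  exists (Some [:: mlab x]); first by rewrite /= -mbond2.
  by rewrite /= /short /= mlab_ltD.
rewrite ub in up; have [q [-> qi]] := IH b i.+1 bi up.
exists (b :: q); rewrite /= ub; split=> //; rewrite size_map addnS -addSn.
rewrite (oshortW _ bi) ?leq_addr//=; by move: qi; rewrite size_map.
Qed.

Section two_graphs.
Variables (x y : marked) (n : nat).
Hypothesis eq_walk : forall w w', short n.+1 w -> short n.+1 w' ->
  (mwalk x w == mwalk x w') = (mwalk y w == mwalk y w').
Hypothesis eq_deg : forall w, short n.+1 w -> deg (mwalk x w) = deg (mwalk y w).
Hypothesis eq_lab : mlab x = mlab y.

Lemma short_lab k : short k.+1 [:: mlab x].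
Proof. by rewrite /short /= mlab_ltD. Qed.

(** Adjacency is the coincidence of the second word with the first one followed by a letter. This
    extra letter is the reason for [n.+1] in the hypotheses. *)
Lemma eq_adj w w' : short n w -> short n w' ->
  adj (mwalk x w) (mwalk x w') = adj (mwalk y w) (mwalk y w').
Proof.
move=> wn wn'; rewrite !adj_mwalk; apply: eq_existsb => j.
rewrite eq_deg ?(shortW _ wn)//; case: ltnP => //= jv.
by apply: eq_walk; [exact: short_rcons wn jv|exact: shortW wn'].
Qed.

Lemma eq_bond w w' : short n.+1 w -> short n.+1 w' ->
  ((mwalk x w, mwalk x w') == mbond x) = ((mwalk y w, mwalk y w') == mbond y).
Proof.
move=> wn wn'; rewrite [mbond x]surjective_pairing [mbond y]surjective_pairing.
rewrite !xpair_eqE !mbond1 !mbond2 -eq_lab !eq_walk//; exact: short_lab.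
Qed.

Lemma eq_rev_bond w w' : short n.+1 w -> short n.+1 w' ->
  ((mwalk x w, mwalk x w') == rev_bond (mbond x)) =
  ((mwalk y w, mwalk y w') == rev_bond (mbond y)).
Proof.
move=> wn wn'; rewrite /rev_bond.
rewrite !xpair_eqE !mbond1 !mbond2 -eq_lab !eq_walk//; exact: short_lab.
Qed.

Lemma eq_sub_adj a b : oshort n a -> oshort n b ->
  sub_adj (mbond x) (interp x a) (interp x b) =
  sub_adj (mbond y) (interp y a) (interp y b).
Proof.
case: a b => [w|] [w'|] //= h h'.
- have hW := shortW (leqnSn n) h; have hW' := shortW (leqnSn n) h'.
  by rewrite eq_adj// eq_bond// eq_rev_bond.
- by rewrite !mbond1 !mbond2 -eq_lab !eq_walk ?short_lab ?(shortW (leqnSn n) h)//.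
- by rewrite !mbond1 !mbond2 -eq_lab !eq_walk ?short_lab ?(shortW (leqnSn n) h')//.
Qed.

Lemma eq_sub_path q a : oshort n a -> all (oshort n) q ->
  path (sub_adj (mbond x)) (interp x a) (map (interp x) q) =
  path (sub_adj (mbond y)) (interp y a) (map (interp y) q).
Proof.
elim: q a => //= b q IH a an /andP[bn qn].
by rewrite IH// eq_sub_adj.
Qed.

Lemma eq_interp a b : oshort n.+1 a -> oshort n.+1 b ->
  (interp x a == interp x b) = (interp y a == interp y b).
Proof.
case: a b => [w|] [w'|] //= h h'.
by rewrite !(inj_eq (@Some_inj _)) eq_walk.
Qed.

(** The same word read in the other graph; [eq_walk] makes the choice of the word immaterial. *)
Definition transfer0 (v : vert (mgraph x)) : vert (mgraph y) :=
  if pselect (exists w, short n.+1 w /\ mwalk x w = v) is left e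
  then mwalk y (projT1 (cid e)) else mwalk y [::].

Definition transfer := omap transfer0.

Lemma transfer0E w : short n.+1 w -> transfer0 (mwalk x w) = mwalk y w.
Proof.
move=> wn; rewrite /transfer0; case: pselect => [e|[]]; last by exists w.
have [h1 h2] := projT2 (cid e); apply/eqP.
by rewrite -eq_walk// h2.
Qed.

Lemma transferE a : oshort n.+1 a -> transfer (interp x a) = interp y a.
Proof. by case: a => //= w wn; rewrite transfer0E. Qed.

End two_graphs.
End agreement.

Section subdivision_facts.
Variables (R : realType) (Q : qg_data R) (b0 : vert Q * vert Q) (x0 : R).
Hypothesis b0_neq : b0.1 <> b0.2.

Lemma sub_len_origin : sub_len b0 x0 (edge_of (None, Some b0.1)) = x0.
Proof. by rewrite /sub_len eqxx. Qed.

Lemma sub_len_terminus : sub_len b0 x0 (edge_of (None, Some b0.2)) = blen b0 - x0.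
Proof.
rewrite /sub_len; case: eqP => [e|_]; last by rewrite eqxx.
by have [e'] := edge_of_inj e; case: b0_neq.
Qed.

Lemma sub_len_old (u v : vert Q) : sub_len b0 x0 (edge_of (Some u, Some v)) = blen (u, v).
Proof.
have no (w : vert Q) : edge_of (Some u, Some v) <> edge_of (None, Some w).
  move=> e; have : edge_of (Some u, Some v) None by rewrite e; left.
  by move=> [].
rewrite /sub_len; do 2 (case: eqP => [/no//|_]).
rewrite /blen; congr len; apply/seteqP; split => w /=.
  by move=> [[->]|[->]]; [left|right].
by move=> [->|->]; [left|right].
Qed.

End subdivision_facts.

Section scat_dist_facts.
Variable R : realType.

Lemma opnorm0 n : opnorm (0 : 'M[R[i]]_n) = 0%E.
Proof.
have e (x : 'cV[R[i]]_n) : vnorm (0 *m x) = 0.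
  by rewrite mul0mx vnormE /vnorm2 big1 ?sqrtr0// => i _; rewrite mxE abs20.
apply/eqP; rewrite eq_le; apply/andP; split.
  by apply: ge_ereal_sup => _ [x _ <-]; rewrite e.
apply: ereal_sup_ubound; exists 0; last by rewrite e.
by rewrite /= vnormE /vnorm2 big1 ?sqrtr0 ?ler01// => i _; rewrite mxE abs20.
Qed.

Lemma scat_dist_refl n (U : 'M[R[i]]_n) : scat_dist U U = 0%E.
Proof.
rewrite /scat_dist; case: pselect => // e.
by rewrite (eq_irrelevance e erefl) castmx_id subrr opnorm0.
Qed.

End scat_dist_facts.

(** * Closeness of rooted graphs with close coordinates *)

Section close_mpoint.
Variables (R : realType) (D : nat) (m M : R).
Local Notation marked := (@marked R D m M).
Hypothesis m_gt0 : 0 < m.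
Hypothesis m_lt_M : m < M.

Lemma blen_mbond (x : marked) :
  blen (mbond x) = elen (mbond x).1 (mlab x).
Proof. by rewrite /elen; have [-> ->] := mlabP x; rewrite -surjective_pairing. Qed.

Lemma blen_mbond_itv (x : marked) : m <= blen (mbond x) <= M.
Proof. by rewrite blen_mbond; apply: elen_itv; have [] := mlabP x. Qed.

Lemma mbond_neq (x : marked) : (mbond x).1 <> (mbond x).2.
Proof. by have [h <-] := mlabP x => /esym; exact: (nbr_neq (qgP (mgraph x))). Qed.

Lemma mpoint_subproof (x : marked) (s : R) : 0 < s < 1 ->
  0 < s * blen (mbond x) < blen (mbond x).
Proof.
move=> /andP[s0 s1]; have /andP[h _] := blen_mbond_itv x.
have L0 := lt_le_trans m_gt0 h.
by rewrite mulr_gt0//= gtr_pMl.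
Qed.

Definition mpoint (x : marked) (s : R) (h : 0 < s < 1) : rooted R :=
  Rooted (mbondP x) (mpoint_subproof x h).

Definition mpot (x : marked) (t : R) : R := epot (mbond x).1 (mlab x) t.

Lemma pot_mbond (x : marked) (t : R) : 0 <= t <= 1 ->
  pot (mbond x) (t * blen (mbond x)) = mpot x t.
Proof.
move=> t01; rewrite /mpot /epot t01; have [-> ->] := mlabP x.
by rewrite -surjective_pairing.
Qed.

Lemma pot_rev_mbond (x : marked) (t : R) : 0 <= t <= 1 ->
  pot (rev_bond (mbond x)) (t * blen (mbond x)) = mpot x (1 - t).
Proof.
move=> t01; have t01' : 0 <= 1 - t <= 1 by case/andP: t01 => h1 h2; apply/andP; split; lra.
rewrite -pot_mbond// -(pot_rev (qgP (mgraph x)) (mbondP x)).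
  by congr pot; ring.
have /andP[h _] := blen_mbond_itv x; have L0 := lt_le_trans m_gt0 h.
case/andP: t01' => h1 h2; rewrite in_itv/= mulr_ge0 ?(ltW L0)//= ler_piMl//.
exact: ltW.
Qed.

Section bounds.
Variables (x y : marked) (s s' : R) (hs : 0 < s < 1) (hs' : 0 < s' < 1).
Variables (r e : R).
Hypothesis r_gt0 : 0 < r.
Hypothesis e_r : e < r^-1.
Local Notation n := (Num.truncn r).
Hypothesis eq_walk : forall w w', short D n.+1 w -> short D n.+1 w' ->
  (mwalk x w == mwalk x w') = (mwalk y w == mwalk y w').
Hypothesis eq_deg : forall w, short D n.+1 w -> deg (mwalk x w) = deg (mwalk y w).
Hypothesis eq_lab : mlab x = mlab y.
Hypothesis elen_le : forall w j, short D n w -> (j < D)%N ->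
  `|elen (mwalk x w) j - elen (mwalk y w) j| <= e.
Hypothesis epot_leE : forall w j t, short D n w -> (j < D)%N -> 0 <= t <= 1 ->
  `|epot (mwalk x w) j t - epot (mwalk y w) j t| <= e.
Hypothesis scat_lt : forall w, short D n w ->
  (scat_dist (scat (mwalk x w)) (scat (mwalk y w)) < (r^-1)%:E)%E.
Hypothesis pos_le : `|s * blen (mbond x) - s' * blen (mbond y)| <= e.
Hypothesis pos_le' :
  `|(1 - s) * blen (mbond x) - (1 - s') * blen (mbond y)| <= e.
Hypothesis mpot_le : forall t t', 0 <= t <= 1 -> 0 <= t' <= 1 ->
  `|t - t'| <= `|s - s'| -> `|mpot x t - mpot y t'| <= e.

Let q := mpoint x hs.
Let q' := mpoint y hs'.
Let phi : vert (Defs.cut q) -> vert (Defs.cut q') := @transfer R D m M x y n.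

Let e_ge0 : 0 <= e. Proof. exact: le_trans pos_le. Qed.

(** Membership in the ball becomes a condition on words, which [eq_sub_path] carries from one graph
    to the other. *)
Lemma mem_ball_words (z : marked) (t : R) (ht : 0 < t < 1) u :
  ball_at (Defs.root (mpoint z ht)) n u <->
  exists p, [/\ all (oshort D n) p, path (sub_adj (mbond z)) None (map (interp z) p),
    (size p <= n)%N & u = interp z (last None p)].
Proof.
split=> [[p [pp pu pn]]|[p [pn pp ps ->]]].
  have := @sub_path_words R D m M z p None 0 isT pp.
  move=> [p' [pE p'n]]; exists p'; split.
  - by apply: sub_all p'n => a; apply: oshortW.
  - by rewrite -pE.
  - by move: pn; rewrite pE size_map.
  - rewrite -pu pE; exact: (last_map (interp z) p' None).
exists (map (interp z) p); split; first exact: pp.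
  exact: (last_map (interp z) p None).
by rewrite size_map.
Qed.

Lemma oshort_last p : all (oshort D n) p -> oshort D n (last None p).
Proof.
move=> pn; have := mem_last None p; rewrite in_cons => /orP[/eqP->//|].
by move/allP: pn; apply.
Qed.

Lemma ball_wordP (z : marked) (t : R) (ht : 0 < t < 1) u :
  ball_at (Defs.root (mpoint z ht)) n u -> exists2 a, oshort D n a & u = interp z a.
Proof.
move=> /mem_ball_words[p [pn _ _ ->]]; exists (last None p) => //.
exact: oshort_last.
Qed.

Lemma phiE a : oshort D n.+1 a -> phi (interp x a) = interp y a.
Proof. exact: transferE. Qed.

Lemma sub_bond_cases (u v : vert (Defs.cut q)) :
  bonds (Defs.cut q) (u, v) -> ball_at (Defs.root q) n u -> ball_at (Defs.root q) n v ->
  [\/ exists w j, [/\ short D n w, (j < deg (mwalk x w))%N,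
        u = Some (mwalk x w) & v = Some (mwalk x (rcons w j))],
      (u, v) = (None, Some (mbond x).1) \/ (u, v) = (Some (mbond x).1, None) |
      (u, v) = (None, Some (mbond x).2) \/ (u, v) = (Some (mbond x).2, None)].
Proof.
move=> + /ball_wordP[a an uE] /ball_wordP[b bn vE]; rewrite uE vE /bonds /=.
case: a an {uE} => [w|] wn; last first.
  case: b bn {vE} => [w'|//] _ /orP[] /eqP /= ->; [apply: Or32|apply: Or33]; by left.
case: b bn {vE} => [w'|] wn'.
  move=> /and3P[/(adjP (qgP (mgraph x)))[j jv jE] _ _]; apply: Or31.
  by exists w, j; split => //=; rewrite mwalk_rcons jE.
by move=> /orP[] /eqP /= ->; [apply: Or32|apply: Or33]; right.
Qed.

Lemma phi_origin : phi (Some (mbond x).1) = Some (mbond y).1.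
Proof. exact: (phiE (a := Some [::])). Qed.

Lemma phi_terminus : phi (Some (mbond x).2) = Some (mbond y).2.
Proof.
rewrite !mbond2 (phiE (a := Some [:: mlab x])) ?eq_lab//.
by rewrite -eq_lab; exact: short_lab.
Qed.

Lemma blen_cut_origin (z : marked) (t : R) (ht : 0 < t < 1)
    (b : vert (Defs.cut (mpoint z ht)) * _) :
  b = (None, Some (mbond z).1) \/ b = (Some (mbond z).1, None) ->
  blen b = t * blen (mbond z).
Proof.
by move=> [] ->; rewrite /blen ?[edge_of (Some _, _)]edge_ofC; exact: sub_len_origin.
Qed.

Lemma blen_cut_terminus (z : marked) (t : R) (ht : 0 < t < 1)
    (b : vert (Defs.cut (mpoint z ht)) * _) :
  b = (None, Some (mbond z).2) \/ b = (Some (mbond z).2, None) ->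
  blen b = (1 - t) * blen (mbond z).
Proof.
rewrite mulrBl mul1r.
move=> [] ->; rewrite /blen ?[edge_of (Some _, _)]edge_ofC;
  apply: sub_len_terminus; exact: mbond_neq.
Qed.

Lemma blen_cut_old (z : marked) (t : R) (ht : 0 < t < 1) (u v : vert (mgraph z)) :
  @blen _ (Defs.cut (mpoint z ht)) (Some u, Some v) = blen (u, v).
Proof. exact: sub_len_old. Qed.

Lemma pot_cut_origin (z : marked) (t : R) (ht : 0 < t < 1) (u : R) : 0 <= u <= 1 ->
  @pot _ (Defs.cut (mpoint z ht)) (Some (mbond z).1, None) (u * (t * blen (mbond z)))
    = mpot z (t * u) /\
  @pot _ (Defs.cut (mpoint z ht)) (None, Some (mbond z).1) (u * (t * blen (mbond z)))
    = mpot z (t * (1 - u)).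
Proof.
move=> /andP[u0 u1]; case/andP: (ht) => t0 t1.
rewrite /= eqxx; split.
  rewrite -pot_mbond; first by congr pot; ring.
  by apply/andP; split; nra.
have E : blen (mbond z) - t * blen (mbond z) + u * (t * blen (mbond z)) =
    (1 - t * (1 - u)) * blen (mbond z) by ring.
apply: etrans (congr1 _ E) _.
rewrite pot_rev_mbond; first by congr mpot; ring.
by apply/andP; split; nra.
Qed.

Lemma pot_cut_terminus (z : marked) (t : R) (ht : 0 < t < 1) (u : R) : 0 <= u <= 1 ->
  @pot _ (Defs.cut (mpoint z ht)) (Some (mbond z).2, None) (u * ((1 - t) * blen (mbond z)))
    = mpot z (1 - u * (1 - t)) /\
  @pot _ (Defs.cut (mpoint z ht)) (None, Some (mbond z).2) (u * ((1 - t) * blen (mbond z)))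
    = mpot z (t + u * (1 - t)).
Proof.
move=> /andP[u0 u1]; case/andP: (ht) => t0 t1.
have /negbTE neq : (mbond z).2 != (mbond z).1.
  by apply/eqP => /esym; exact: mbond_neq.
rewrite /= neq; split.
  have E : u * ((1 - t) * blen (mbond z)) = (u * (1 - t)) * blen (mbond z) by ring.
  apply: etrans (congr1 _ E) _; rewrite pot_rev_mbond//.
  by apply/andP; split; nra.
have E : t * blen (mbond z) + u * ((1 - t) * blen (mbond z)) =
    (t + u * (1 - t)) * blen (mbond z) by ring.
apply: etrans (congr1 _ E) _; rewrite pot_mbond//.
by apply/andP; split; nra.
Qed.

(** Points at the same relative position [u] on corresponding halves of the marked bonds have
    positions affine in [s], with slope [u] or [1 - u]. They differ by at most [|s - s'|], as
    [mpot_le] requires. *)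
Lemma mpot_affine (c a a' : R) : 0 <= a <= 1 -> 0 <= a' <= 1 -> `|c| <= 1 ->
  a - a' = c * (s - s') -> `|mpot x a - mpot y a'| <= e.
Proof.
by move=> h h' c1 E; apply: mpot_le => //; rewrite E normrM ler_piMl.
Qed.

(** Every clause is checked on words. The halves of the marked bond need the separate estimates
    [pos_le], [pos_le'] and [mpot_le], since their lengths and potentials depend on the position of
    the root. *)
Lemma close_mpoint : Defs.close r q q'.
Proof.
case/andP: (hs) => s0 s1; case/andP: (hs') => s0' s1'.
exists phi => //; split.
- split.
  + move=> u /mem_ball_words[p [pn pp ps ->]].
    apply/mem_ball_words; exists p; split => //.
      by rewrite -(eq_sub_path eq_walk eq_deg eq_lab (a := None)).
    by rewrite phiE//; apply: oshortW (oshort_last pn).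
  + move=> u v; rewrite !inE => /ball_wordP[a an ->] /ball_wordP[b bn ->].
    have an' := oshortW (leqnSn _) an; have bn' := oshortW (leqnSn _) bn.
    rewrite !phiE// => e1; have : interp x a == interp x b.
      by rewrite (eq_interp eq_walk)//; apply/eqP.
    by move/eqP.
  + move=> u /mem_ball_words[p [pn pp ps ->]].
    exists (interp x (last None p)); last first.
      by rewrite phiE//; apply: oshortW (oshort_last pn).
    apply/mem_ball_words; exists p; split => //.
    by rewrite (eq_sub_path eq_walk eq_deg eq_lab (a := None)).
- move=> u v /ball_wordP[a an ->] /ball_wordP[b bn ->].
  have an' := oshortW (leqnSn _) an; have bn' := oshortW (leqnSn _) bn.
  by rewrite !phiE//; apply/esym; exact: (eq_sub_adj eq_walk eq_deg eq_lab).
- move=> u /ball_wordP[[w|] wn ->] /=;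
    last by move=> j k jk _; rewrite jk; case: ifP; rewrite /map_bond /= => _;
      [have := phi_origin|have := phi_terminus]; rewrite /phi /= => ->.
  have wn' := shortW (leqnSn _) wn.
  rewrite /= => j k jk _.
  rewrite (labE (qgP (mgraph x))) (labE (qgP (mgraph y))) -jk.
  have jd : (j < deg (mwalk x w))%N by [].
  have wj := short_rcons wn jd.
  rewrite transfer0E// -!mwalk_rcons.
  rewrite -!(eq_bond eq_walk eq_lab)// -!(eq_rev_bond eq_walk eq_lab)//.
  case: ifP => _; rewrite /map_bond /= !transfer0E//.
- move=> [u v] uv; rewrite /= => uB vB.
  have [[w [j [wn jd uE vE]]]|uvE|uvE] := sub_bond_cases uv uB vB.
  + apply: le_lt_trans e_r; rewrite uE vE /map_bond.
    have wn' := shortW (leqnSn _) wn; have wj := short_rcons wn jd.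
    have jD : (j < D)%N by apply: leq_trans jd (deg_leD _).
    have := elen_le wn jD; rewrite /elen -eq_deg// jd -!mwalk_rcons.
    rewrite -(@blen_cut_old x s hs) -(@blen_cut_old y s' hs').
    have pw := phiE (a := Some w) wn'; have pj := phiE (a := Some (rcons w j)) wj.
    by rewrite /= in pw pj; rewrite /= pw pj.
  + have E1 : @blen _ (Defs.cut q) (u, v) = s * blen (mbond x) := blen_cut_origin uvE.
    have E2 : @blen _ (Defs.cut q') (map_bond phi (u, v)) = s' * blen (mbond y).
      apply: blen_cut_origin.
      by case: uvE => -[-> ->]; rewrite /map_bond /fst /snd phi_origin; [left|right].
    have h := pos_le; rewrite -E1 -E2 in h; apply: le_lt_trans e_r; exact: h.
  + have E1 : @blen _ (Defs.cut q) (u, v) = (1 - s) * blen (mbond x) := blen_cut_terminus uvE.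
    have E2 : @blen _ (Defs.cut q') (map_bond phi (u, v)) = (1 - s') * blen (mbond y).
      apply: blen_cut_terminus.
      by case: uvE => -[-> ->]; rewrite /map_bond /fst /snd phi_terminus; [left|right].
    have h := pos_le'; rewrite -E1 -E2 in h; apply: le_lt_trans e_r; exact: h.
- move=> [u v] uv; rewrite /= => uB vB.
  apply: (@le_lt_trans _ _ e%:E); last by rewrite lte_fin.
  apply: ge_ereal_sup => _ [t /= + <-]; rewrite in_itv/= lee_fin => t01.
  case/andP: (t01) => t0 t1.
  have [[w [j [wn jd uE vE]]]|uvE|uvE] := sub_bond_cases uv uB vB.
  + have wn' := shortW (leqnSn _) wn; have wj := short_rcons wn jd.
    have jD : (j < D)%N by apply: leq_trans jd (deg_leD _).
    have := epot_leE wn jD t01; rewrite /epot -eq_deg// jd t01 -!mwalk_rcons.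
    rewrite -(@blen_cut_old x s hs) -(@blen_cut_old y s' hs') uE vE.
    have pw := transfer0E eq_walk wn'; have pj := transfer0E eq_walk wj.
    by rewrite /map_bond /= pw pj.
  + have E1 : @blen _ (Defs.cut q) (u, v) = s * blen (mbond x) := blen_cut_origin uvE.
    have E2 : @blen _ (Defs.cut q') (map_bond phi (u, v)) = s' * blen (mbond y).
      apply: blen_cut_origin.
      by case: uvE => -[-> ->]; rewrite /map_bond /fst /snd phi_origin; [left|right].
    have [p1 p2] := pot_cut_origin x hs t01; have [p3 p4] := pot_cut_origin y hs' t01.
    rewrite -E1 in p1 p2; rewrite -E2 in p3 p4.
    case: uvE E1 E2 p1 p2 p3 p4 => -[-> ->];
      rewrite /map_bond /fst /snd phi_origin => E1 E2 p1 p2 p3 p4.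
      rewrite [X in `|X - _|]p2 [X in `|_ - X|]p4;
        apply: (@mpot_affine (1 - t)); [by apply/andP; split; nra
      |by apply/andP; split; nra|by rewrite ler_norml; apply/andP; split; lra|ring].
    rewrite [X in `|X - _|]p1 [X in `|_ - X|]p3; apply: (@mpot_affine t); [by apply/andP; split; nra
      |by apply/andP; split; nra|by rewrite ler_norml; apply/andP; split; lra|ring].
  + have E1 : @blen _ (Defs.cut q) (u, v) = (1 - s) * blen (mbond x) := blen_cut_terminus uvE.
    have E2 : @blen _ (Defs.cut q') (map_bond phi (u, v)) = (1 - s') * blen (mbond y).
      apply: blen_cut_terminus.
      by case: uvE => -[-> ->]; rewrite /map_bond /fst /snd phi_terminus; [left|right].
    have [p1 p2] := pot_cut_terminus x hs t01; have [p3 p4] := pot_cut_terminus y hs' t01.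
    rewrite -E1 in p1 p2; rewrite -E2 in p3 p4.
    case: uvE E1 E2 p1 p2 p3 p4 => -[-> ->];
      rewrite /map_bond /fst /snd phi_terminus => E1 E2 p1 p2 p3 p4.
      rewrite [X in `|X - _|]p2 [X in `|_ - X|]p4;
        apply: (@mpot_affine (1 - t)); [by apply/andP; split; nra
      |by apply/andP; split; nra|by rewrite ler_norml; apply/andP; split; lra|ring].
    rewrite [X in `|X - _|]p1 [X in `|_ - X|]p3; apply: (@mpot_affine t); [by apply/andP; split; nra
      |by apply/andP; split; nra|by rewrite ler_norml; apply/andP; split; lra|ring].
- move=> u /ball_wordP[[w|] wn ->]; last by rewrite scat_dist_refl lte_fin invr_gt0.
  rewrite /= transfer0E//; last exact: shortW wn.
  exact: scat_lt.
Qed.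

End bounds.
End close_mpoint.

(** * From convergence of coordinates to closeness *)

Section short_words.
Variable D : nat.

Fixpoint short_words (n : nat) : seq (seq nat) :=
  if n is n'.+1 then [::] :: [seq j :: w | j <- iota 0 D, w <- short_words n']
  else [:: [::]].

Lemma mem_short_words n w : short D n w -> w \in short_words n.
Proof.
elim: n w => [|n IH] [|j w] //; rewrite /short /= ltnS => /andP[sw /andP[jD wD]].
rewrite in_cons; apply/orP; right; apply/allpairsP; exists (j, w); split => //=.
  by rewrite mem_iota.
by apply: IH; apply/andP.
Qed.

(** Finiteness of the set of short words lets the two quantifiers be exchanged. *)
Lemma near_short (P : seq nat -> nat -> Prop) n :
  (forall w, short D n w -> \forall k \near \oo, P w k) ->
  \forall k \near \oo, forall w, short D n w -> P w k.
Proof.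
move=> h.
have : \forall k \near \oo, forall w, w \in short_words n -> short D n w -> P w k.
  apply: nbhs_all_in => w _.
  have [ws|ws] := boolP (short D n w); last exact: nearW.
  by apply: filterS (h w ws) => k Pk _.
by apply: filterS => k hk w ws; apply: hk => //; exact: mem_short_words.
Qed.

Lemma near_short_letter (P : seq nat -> nat -> nat -> Prop) n :
  (forall w j, short D n w -> (j < D)%N -> \forall k \near \oo, P w j k) ->
  \forall k \near \oo, forall w j, short D n w -> (j < D)%N -> P w j k.
Proof.
move=> h.
have : \forall k \near \oo, forall w, short D n w -> forall j, j \in iota 0 D -> P w j k.
  apply: near_short => w ws; apply: nbhs_all_in => j.
  by rewrite mem_iota/= add0n => jD; exact: h.
by apply: filterS => k hk w j ws jD; apply: hk => //; rewrite mem_iota.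
Qed.

End short_words.

Section convergence.
Variables (R : realType) (D : nat) (m M : R).
Local Notation marked := (@marked R D m M).
Hypothesis m_gt0 : 0 < m.
Hypothesis m_lt_M : m < M.

Definition mcvg (x_ : nat -> marked) (y : marked) : Prop :=
  forall n, (fun k => mcoord n (x_ k)) @ \oo --> mcoord n y.

Section mcvg_facts.
Variables (x_ : nat -> marked) (y : marked).
Hypothesis xy : mcvg x_ y.

Lemma mcvg_code c : (fun k => mcoord_at c (x_ k)) @ \oo --> mcoord_at c y.
Proof.
have := @xy (pickle c); rewrite mcoord_pickle.
by under eq_fun do rewrite mcoord_pickle.
Qed.

(** A convergent sequence of integers is eventually constant; the same reason gives the next two
    lemmas. *)
Lemma mcvg_walk w w' : \forall k \near \oo,
  (mwalk y w == mwalk y w') = (mwalk (x_ k) w == mwalk (x_ k) w').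
Proof.
have /cvg_nat_near := (@mcvg_code ((0, (w, w'), (0, 0))%N, 0 : rat)).
by apply: filterS => k /=; do 2 case: eqP.
Qed.

Lemma mcvg_deg w : \forall k \near \oo, deg (mwalk y w) = deg (mwalk (x_ k) w).
Proof.
have /cvg_nat_near := (@mcvg_code ((1, (w, [::]), (0, 0))%N, 0 : rat)).
by apply: filterS => k /=.
Qed.

Lemma mcvg_lab : \forall k \near \oo, mlab y = mlab (x_ k).
Proof.
have /cvg_nat_near := (@mcvg_code ((2, ([::], [::]), (0, 0))%N, 0 : rat)).
by apply: filterS => k /=.
Qed.

Lemma mcvg_elen w j :
  (fun k => elen (mwalk (x_ k) w) j) @ \oo --> elen (mwalk y w) j.
Proof. exact: (@mcvg_code ((3, (w, [::]), (j, 0))%N, 0 : rat)). Qed.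

Let MM_gt0 : 0 < M * M. Proof. by rewrite mulr_gt0// (lt_trans m_gt0). Qed.

Lemma mcvg_epot w j (e : R) : 0 < e -> \forall k \near \oo, forall t : R, 0 <= t <= 1 ->
  `|epot (mwalk y w) j t - epot (mwalk (x_ k) w) j t| <= e.
Proof.
move=> e0; apply: (lipschitz_uniform_limit MM_gt0) => //.
- by move=> k t t' t01 t01'; exact: (epot_lip m_gt0 m_lt_M).
- by move=> t t' t01 t01'; exact: (epot_lip m_gt0 m_lt_M).
by move=> q _; exact: (@mcvg_code ((4, (w, [::]), (j, 0))%N, q)).
Qed.

Lemma mcvg_sentry w a b :
  (fun k => sentry (mwalk (x_ k) w) a b : R[i]^o) @ \oo --> (sentry (mwalk y w) a b : R[i]^o).
Proof.
apply/cvg_complexP; split.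
  exact: (@mcvg_code ((5, (w, [::]), (a, b))%N, 0 : rat)).
exact: (@mcvg_code ((6, (w, [::]), (a, b))%N, 0 : rat)).
Qed.

Lemma mcvg_scat w (e : R) : 0 < e -> \forall k \near \oo,
  (scat_dist (scat (mwalk y w)) (scat (mwalk (x_ k) w)) < e%:E)%E.
Proof.
move=> e0; pose d := deg (mwalk y w).
(* The size of [scat] varies with [k]. The padded entries give matrices of the fixed size [d], which
   agree with [scat] once the degree is [d]. *)
pose U k : 'M[R[i]]_d := \matrix_(a, b) sentry (mwalk (x_ k) w) a b.
have hU : mx_cvg U (scat (mwalk y w)).
  move=> a b; rewrite -sentryE.
  rewrite (_ : (fun k => _) = (fun k => sentry (mwalk (x_ k) w) a b : R[i]^o)).
    exact: mcvg_sentry.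
  by apply/funext => k; rewrite mxE.
near=> k.
have dk : d = deg (mwalk (x_ k) w) by near: k; exact: mcvg_deg.
have ok : (opnorm (scat (mwalk y w) - U k) < e%:E)%E.
  by near: k; exact: opnorm_cvg0.
rewrite /scat_dist; case: pselect => [E|]; last by rewrite -dk.
rewrite (_ : castmx _ _ = U k)//.
apply/matrixP => a b; rewrite castmxE mxE -sentryE /=.
by [].
Unshelve. all: end_near. Qed.

Lemma mcvg_blen : (fun k => blen (mbond (x_ k))) @ \oo --> blen (mbond y).
Proof.
rewrite blen_mbond; apply: cvg_trans (@mcvg_elen [::] (mlab y)).
apply: near_eq_cvg; near=> k; rewrite blen_mbond /=.
suff -> : mlab y = mlab (x_ k) by [].
by near: k; exact: mcvg_lab.
Unshelve. all: end_near. Qed.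

Variables (s_ : nat -> R) (s : R) (hs_ : forall k, 0 < s_ k < 1) (hs : 0 < s < 1).
Hypothesis ss : s_ @ \oo --> s.

Theorem mcvg_close (r : R) : 0 < r ->
  \forall k \near \oo, Defs.close r (mpoint m_gt0 y hs) (mpoint m_gt0 (x_ k) (hs_ k)).
Proof.
move=> r0; pose e := r^-1 / 2.
have ri : 0 < r^-1 by rewrite invr_gt0.
have e0 : 0 < e by rewrite divr_gt0.
have er : e < r^-1 by rewrite ltr_pdivrMr// ltr_pMr// ltr1n.
have e2 : 0 < e / 2 by rewrite divr_gt0.
pose n := Num.truncn r.
near=> k; apply: (@close_mpoint R D m M m_gt0 y (x_ k) s (s_ k) hs (hs_ k) r e) => //.
- near: k.
  have : \forall k \near \oo, forall w, short D n.+1 w -> forall w', short D n.+1 w' ->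
      (mwalk y w == mwalk y w') = (mwalk (x_ k) w == mwalk (x_ k) w').
    by apply: near_short => w _; apply: near_short => w' _; exact: mcvg_walk.
  by apply: filterS => k hk w w' ws ws'; exact: hk.
- by near: k; apply: near_short => w _; exact: mcvg_deg.
- by near: k; exact: mcvg_lab.
- near: k; apply: near_short_letter => w j _ _.
  exact: (cvgr_dist_le _ _ (@mcvg_elen w j)).
- have h : forall w j, short D n w -> (j < D)%N -> forall t : R, 0 <= t <= 1 ->
      `|epot (mwalk y w) j t - epot (mwalk (x_ k) w) j t| <= e.
    by near: k; apply: near_short_letter => w j _ _; exact: mcvg_epot.
  by move=> w j t ws jD; exact: h.
- by near: k; apply: near_short => w _; exact: mcvg_scat.
- near: k; have : (fun k => s_ k * blen (mbond (x_ k))) @ \oo --> s * blen (mbond y).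
    by apply: cvgM => //; exact: mcvg_blen.
  by move=> h; exact: (cvgr_dist_le _ _ h).
- near: k; have : (fun k => (1 - s_ k) * blen (mbond (x_ k))) @ \oo --> (1 - s) * blen (mbond y).
    by apply: cvgM; [apply: cvgB => //; exact: cvg_cst|exact: mcvg_blen].
  by move=> h; exact: (cvgr_dist_le _ _ h).
have lk : mlab y = mlab (x_ k) by near: k; exact: mcvg_lab.
have h : forall t : R, 0 <= t <= 1 -> `|mpot y t - mpot (x_ k) t| <= e / 2.
  rewrite /mpot -lk; near: k; exact: (mcvg_epot [::]).
(* The other half of [e] pays for the different positions [s] and [s_ k], through the Lipschitz
   constant [M * M] of the rescaled potentials. *)
have h2 : M * M * `|s - s_ k| <= e / 2.
  rewrite -ler_pdivlMl//; near: k; apply: (cvgr_dist_le _ _ ss).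
  by rewrite mulr_gt0// invr_gt0.
move=> t t' t01 t01' tt; rewrite (le_trans (ler_distD (mpot (x_ k) t) _ _))//.
rewrite [leRHS]splitr lerD ?h// (le_trans (epot_lip m_gt0 m_lt_M _ _ t01 t01'))//.
by rewrite (le_trans _ h2)// ler_wpM2l// ltW.
Unshelve. all: end_near. Qed.

End mcvg_facts.
End convergence.

(** * Invariance of closeness under equivalence *)

Section rooted_invariance.
Variable R : realType.

Lemma blen_cut_gt0 (q : rooted R) (b : vert (Defs.cut q) * vert (Defs.cut q)) :
  bonds (Defs.cut q) b -> 0 < blen b.
Proof.
have QP := qgP (Defs.rgraph q).
have /andP[x0 x1] := rposP q.
have nb : (rbond q).1 <> (rbond q).2.
  move=> e; have : adj (rbond q).1 (rbond q).2 by exact: (rbondP q).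
  by rewrite -e (adj_irr QP).
have lo : 0 < sub_len (rbond q) (rpos q) (edge_of (None, Some (rbond q).1)).
  by rewrite sub_len_origin.
have lt : 0 < sub_len (rbond q) (rpos q) (edge_of (None, Some (rbond q).2)).
  by rewrite sub_len_terminus// subr_gt0.
case: b => -[u|] [v|] //=; rewrite /bonds /=.
- move=> /and3P[uv _ _]; rewrite /blen /= sub_len_old.
  by apply: (len_gt0 QP); exists (u, v).
- by move=> /orP[] /eqP ->; rewrite /blen edge_ofC.
- by move=> /orP[] /eqP ->.
Qed.

Lemma scat_dist_castl n n' n'' (e : n = n') (U : 'M[R[i]]_n) (V : 'M[R[i]]_n'') :
  scat_dist (castmx (e, e) U) V = scat_dist U V.
Proof. by case: _ / e; rewrite castmx_id. Qed.

Lemma scat_dist_castr n n' n'' (e : n = n') (U : 'M[R[i]]_n) (V : 'M[R[i]]_n'') :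
  scat_dist V (castmx (e, e) U) = scat_dist V U.
Proof. by case: _ / e; rewrite castmx_id. Qed.

Section iso_ball.
Variables (Q Q' : qg_data R) (f : vert Q -> vert Q').
Hypothesis fi : is_iso f.

Lemma iso_ball n (v w : vert Q) : ball_at v n w -> ball_at (f v) n (f w).
Proof.
move=> [p [pv <- pn]]; exists (map f p); split.
- rewrite path_map; apply: sub_path pv => a b ab.
  by change (is_true (adj (f a) (f b))); rewrite (iso_adj fi).
- by rewrite last_map.
- by rewrite size_map.
Qed.

Lemma iso_ball_inv n (v : vert Q) w' : ball_at (f v) n w' ->
  exists2 w, ball_at v n w & w' = f w.
Proof.
have [g fK gK] := iso_bij fi.
move=> [p [pv <- pn]]; exists (last v (map g p)); last first.
  by rewrite -(last_map f) -map_comp (eq_map (g := id)) ?map_id// => z /=; rewrite gK.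
exists (map g p); split; [|by []|by rewrite size_map].
rewrite -{1}(fK v) path_map; apply: sub_path pv => a b ab.
by change (is_true (adj (g a) (g b))); rewrite -(iso_adj fi) !gK.
Qed.

Lemma iso_bond b : bonds Q b -> bonds Q' (map_bond f b).
Proof. by move=> h; change (is_true (adj (f b.1) (f b.2))); rewrite (iso_adj fi). Qed.

End iso_ball.

(** [Qdist] is computed on the representatives chosen by [repr]; this lemma and the next reduce
    closeness of these to closeness of any others. *)
Lemma close_equivl (r : R) (q1 q2 q3 : rooted R) :
  rooted_equiv q1 q2 -> Defs.close r q2 q3 -> Defs.close r q1 q3.
Proof.
move=> [f fi fr] [phi [pbij padj plab plen ppot pscat] pr].
have fB v : ball_at (Defs.root q1) (Num.truncn r) v ->
    ball_at (Defs.root q2) (Num.truncn r) (f v).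
  by rewrite -fr; exact: iso_ball.
have [pfun pinj psurj] := pbij.
exists (phi \o f); last by rewrite /= fr.
have blenE b : bonds (Defs.cut q1) b -> blen (map_bond f b) = blen b by exact: (iso_len fi).
split.
- split.
  + by move=> v /fB /pfun.
  + move=> v w; rewrite !inE => vB wB /= e; apply: (bij_inj (iso_bij fi)).
    by apply: pinj e; rewrite inE; exact: fB.
  + move=> w /psurj[v' vB <-].
    have [v vB' ->] : exists2 v, ball_at (Defs.root q1) (Num.truncn r) v & v' = f v.
      by apply: (iso_ball_inv fi); rewrite fr.
    by exists v.
- move=> v w /fB vB /fB wB; exact: etrans (padj _ _ vB wB) (iso_adj fi v w).
- move=> v vB j k jk jB /=; have [e [_ el]] := iso_vert fi v.
  pose j' := cast_ord (esym e) j.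
  have lj : lab j' = map_bond f (lab j) by rewrite el cast_ordKV.
  have := plab (f v) (fB v vB) j' k jk; rewrite lj; apply.
  exact: fB.
- move=> b bb b1 b2; rewrite -blenE//.
  by apply: plen; [exact: iso_bond|exact: fB|exact: fB].
- move=> b bb b1 b2.
  apply: le_lt_trans (ppot _ (iso_bond fi bb) (fB _ b1) (fB _ b2)).
  apply: ge_ereal_sup => _ [t t01 <-]; apply: ereal_sup_ubound; exists t => //.
  rewrite blenE// (iso_pot fi)//; move: t01; rewrite /= !in_itv/= => /andP[t0 t1].
  have L0 := blen_cut_gt0 bb.
  by rewrite mulr_ge0 ?(ltW L0)//= ler_piMl// ltW.
- move=> v vB; have [e [eU _]] := iso_vert fi v.
  by rewrite -eU scat_dist_castl; exact: pscat (fB v vB).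
Qed.

Lemma close_equivr (r : R) (q1 q2 q3 : rooted R) :
  Defs.close r q1 q2 -> rooted_equiv q2 q3 -> Defs.close r q1 q3.
Proof.
move=> [phi [pbij padj plab plen ppot pscat] pr] [f fi fr].
have [pfun pinj psurj] := pbij.
exists (f \o phi); last by rewrite /= pr.
have pbond b : bonds (Defs.cut q1) b -> ball_at (Defs.root q1) (Num.truncn r) b.1 ->
    ball_at (Defs.root q1) (Num.truncn r) b.2 -> bonds (Defs.cut q2) (map_bond phi b).
  move=> bb b1 b2; change (is_true (adj (phi b.1) (phi b.2))); by rewrite padj.
have blenE b : bonds (Defs.cut q2) b -> blen (map_bond f b) = blen b by exact: (iso_len fi).
split.
- split.
  + by move=> v /pfun h /=; rewrite -fr; exact: iso_ball.
  + by move=> v w vB wB /= /(bij_inj (iso_bij fi)); exact: pinj.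
  + move=> w; rewrite -fr => /(iso_ball_inv fi)[v' /psurj[v vB <-] ->].
    by exists v.
- move=> v w vB wB; exact: etrans (iso_adj fi _ _) (padj _ _ vB wB).
- move=> v vB j k jk jB; have [e [_ el]] := iso_vert fi (phi v).
  by rewrite [lab k]el (plab v vB j (cast_ord e k)).
- move=> b bb b1 b2; have := plen b bb b1 b2.
  by rewrite -(blenE (map_bond phi b))//; exact: pbond.
- move=> b bb b1 b2; have pb := pbond _ bb b1 b2.
  apply: le_lt_trans (ppot _ bb b1 b2).
  apply: ge_ereal_sup => _ [t t01 <-]; apply: ereal_sup_ubound; exists t => //.
  have E1 : blen (map_bond (f \o phi) b) = blen (map_bond phi b) := blenE _ pb.
  rewrite E1 -(iso_pot fi pb)//; move: t01; rewrite /= !in_itv/= => /andP[t0 t1].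
  have L0 := blen_cut_gt0 pb.
  by rewrite mulr_ge0 ?(ltW L0)//= ler_piMl// ltW.
- move=> v vB; have [e [eU _]] := iso_vert fi (phi v).
  by have := pscat v vB; rewrite -eU scat_dist_castr.
Qed.

Lemma equiv_repr_pi (q : rooted R) : rooted_equiv (repr (\pi_(Qstar R) q)) q.
Proof.
have : \pi_(Qstar R) (repr (\pi_(Qstar R) q)) = \pi_(Qstar R) q by rewrite reprK.
by move/eqmodP => /asboolP.
Qed.

Lemma close_Qdist (q q' : rooted R) (r : R) : 0 < r -> Defs.close r q q' ->
  Qdist (\pi_(Qstar R) q) (\pi_(Qstar R) q') <= (1 + r)^-1.
Proof.
move=> r0 h; rewrite /Qdist /rooted_dist.
have {}h : Defs.close r (repr (\pi_(Qstar R) q)) (repr (\pi_(Qstar R) q')).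
  apply: close_equivl (equiv_repr_pi q) _; apply: close_equivr h _.
  exact: rooted_equiv_sym (equiv_repr_pi q').
have : (r%:E <= Defs.alpha (repr (\pi_(Qstar R) q)) (repr (\pi_(Qstar R) q')))%E.
  by apply: ereal_sup_ubound; exists r.
have r1 : 0 < 1 + r by rewrite addr_gt0.
case: Defs.alpha => [a| |//].
  rewrite lee_fin => ra; rewrite lef_pV2 ?posrE ?lerD2l//.
  by rewrite (lt_le_trans r1)// lerD2l.
by move=> _; rewrite invr_ge0 ltW.
Qed.

End rooted_invariance.

Lemma edge_of_eq (T : Type) (a b c d : T) : edge_of (a, b) = edge_of (c, d) ->
  a = c /\ b = d \/ a = d /\ b = c.
Proof.
move=> e.
have ha : edge_of (c, d) a by rewrite -e; left.
have hb : edge_of (c, d) b by rewrite -e; right.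
have hc : edge_of (a, b) c by rewrite e; left.
have hd : edge_of (a, b) d by rewrite e; right.
move: ha hb hc hd; rewrite /edge_of /=.
by move=> [] -> [] -> [] h1 [] h2; rewrite ?h1 ?h2; auto.
Qed.

(** * The limit graph *)

(* [nx v j] is the end of the bond of label [j] at [v]; [el v j] and [ep v j]
   are its length and potential. *)
Section flat_graph.
Variables (R : realType) (V : Set) (d : V -> nat) (nx : V -> nat -> V).
Variables (el : V -> nat -> R) (ep : V -> nat -> R -> R).
Variable S : forall v, 'M[R[i]]_(d v).

Definition flat_adj (v w : V) : bool := `[< exists j, (j < d v)%N /\ nx v j = w >].

Definition flat_len (e : set V) : R :=
  if pselect (exists vj : V * nat,
    (vj.2 < d vj.1)%N /\ edge_of (vj.1, nx vj.1 vj.2) = e) is left h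
  then el (projT1 (cid h)).1 (projT1 (cid h)).2 else 0.

Definition flat_pot (b : V * V) (x : R) : R :=
  if pselect (exists j, (j < d b.1)%N /\ nx b.1 j = b.2) is left h
  then ep b.1 (projT1 (cid h)) x else 0.

Definition flat_lab (v : V) (j : 'I_(d v)) : V * V := (v, nx v j).

Definition flat : qg_data R := QgData flat_adj flat_len flat_pot flat_lab S.

Variables (D : nat) (m M : R) (o : V).
Hypothesis m_gt0 : 0 < m.
Hypothesis V_countable : countable [set: V].
Hypothesis nx_neq : forall v j, (j < d v)%N -> nx v j <> v.
Hypothesis nx_inj : forall v i j, (i < d v)%N -> (j < d v)%N -> nx v i = nx v j -> i = j.
Hypothesis nx_ge : forall v j, (d v <= j)%N -> nx v j = v.
Hypothesis nx_sym : forall v j, (j < d v)%N -> exists k,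
  [/\ (k < d (nx v j))%N, nx (nx v j) k = v, el (nx v j) k = el v j &
    forall x, 0 <= x <= el v j -> ep (nx v j) k (el v j - x) = ep v j x].
Hypothesis nx_reach : forall v, exists w, foldl nx o w = v.
Hypothesis d_le : forall v, (d v <= D)%N.
Hypothesis el_itv : forall v j, (j < d v)%N -> m <= el v j <= M.
Hypothesis ep_le : forall v j x, (j < d v)%N -> 0 <= x <= el v j -> `|ep v j x| <= M.
Hypothesis ep_lip : forall v j x x', (j < d v)%N -> 0 <= x <= el v j ->
  0 <= x' <= el v j -> `|ep v j x - ep v j x'| <= M * `|x - x'|.
Hypothesis S_unitary : forall v, S v \is unitarymx.
Hypothesis S_Lambda : forall v, (Lambda_norm (S v) <= M%:E)%E.

Lemma flat_adjP v w : flat_adj v w <-> exists2 j, (j < d v)%N & nx v j = w.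
Proof.
rewrite /flat_adj; split=> [|[j jv jw]]; last by apply/asboolP; exists j.
by move=> /asboolP[j [jv jw]]; exists j.
Qed.

(** An edge has two descriptions by a vertex and a label. If [flat_len] has chosen the one at the
    same end, [nx_inj] identifies the labels; otherwise [nx_sym] equates the lengths. *)
Lemma flat_blen v j : (j < d v)%N -> @blen _ flat (v, nx v j) = el v j.
Proof.
move=> jv; rewrite /blen /= /flat_len.
case: pselect => [h|[]]; last by exists (v, j).
have [] := projT2 (cid h); move: (projT1 (cid h)) => [v' j'] /= jv' ee.
have [[e e2]|[e e2]] := edge_of_eq ee.
  by subst v'; rewrite (nx_inj jv' jv e2).
have [k [kv kE <- _]] := nx_sym jv.
by subst v'; rewrite (nx_inj kv jv') // kE e2.
Qed.

Lemma flat_potE v j : (j < d v)%N -> flat_pot (v, nx v j) = ep v j.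
Proof.
move=> jv; apply/funext => x; rewrite /flat_pot; case: pselect => [h|[]]; last by exists j.
by have [h1 h2] := projT2 (cid h); rewrite (nx_inj h1 jv h2).
Qed.

Lemma flat_bonds b : bonds flat b -> exists j, (j < d b.1)%N /\ b = (b.1, nx b.1 j).
Proof.
case: b => v w bb; have /flat_adjP[j jv jE] : flat_adj v w by exact: bb.
by exists j; split=> //=; rewrite jE.
Qed.

Lemma flat_adj_sym : symmetric flat_adj.
Proof.
suff h v w : flat_adj v w -> flat_adj w v by move=> v w; apply/idP/idP; exact: h.
move=> /flat_adjP[j jv <-]; apply/flat_adjP.
by have [k [kv kE _ _]] := nx_sym jv; exists k.
Qed.

Lemma flat_reach_path w : exists p, path flat_adj o p /\ last o p = foldl nx o w.
Proof.
elim/last_ind: w => [|w j [p [pp pl]]]; first by exists [::].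
rewrite -cats1 foldl_cat /=; have [h|h] := ltnP j (d (foldl nx o w)); last first.
  by rewrite nx_ge//; exists p.
exists (rcons p (nx (foldl nx o w) j)); rewrite rcons_path last_rcons pp pl.
by split=> //; apply/flat_adjP; exists j.
Qed.

Lemma flat_edges e : edges flat e -> exists v j, (j < d v)%N /\ len e = el v j.
Proof.
move=> [b /flat_bonds[j [jv ->]] <-]; exists b.1, j; split=> //.
exact: flat_blen.
Qed.

Lemma flat_connected (v w : V) : exists p, path flat_adj v p /\ last v p = w.
Proof.
have [s <-] := nx_reach v; have [t <-] := nx_reach w.
have [p [pp <-]] := flat_reach_path s; have [q [qp <-]] := flat_reach_path t.
exists (rev (belast o p) ++ q); split.
  rewrite cat_path; apply/andP; split.
    by rewrite rev_path; apply: sub_path pp => a b; rewrite flat_adj_sym.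
  case: p {pp} => [//|a p]; by rewrite /= rev_cons last_rcons.
rewrite last_cat; case: p {pp} => [//|a p]; by rewrite /= rev_cons last_rcons.
Qed.

Lemma flat_quantum_graph : is_quantum_graph flat.
Proof.
split.
- exact: V_countable.
- move=> v; apply/negbTE/negP => /flat_adjP[j jv]; exact: nx_neq.
- exact: flat_adj_sym.
- exact: flat_connected.
- move=> e /flat_edges[v [j [jv ->]]]; have /andP[h _] := el_itv jv.
  exact: lt_le_trans h.
- move=> b /flat_bonds[j [jv ->]].
  rewrite flat_blen// /= (flat_potE jv).
  apply/subspace_continuousP => x /=; rewrite in_itv/= => xb.
  apply/cvgrPdist_le => e e0.
  (* [ep_le] gives [0 <= M], and [M + 1] is then a Lipschitz constant by which one can divide. *)
  have M0 : 0 < M + 1.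
    rewrite ltr_wpDl// (le_trans _ (ep_le jv xb))//.
  have eM : 0 < e / (M + 1) by rewrite divr_gt0.
  near=> x'; apply: le_trans (ep_lip jv xb _) _.
    by near: x'; apply: withinT => x' /=; rewrite in_itv.
  have /ltW h : `|x - x'| < e / (M + 1).
    by near: x'; apply: cvg_within; exact: (nbhsx_ballx x _ eM).
  have -> : e = (M + 1) * (e / (M + 1)) by rewrite mulrCA divff ?mulr1// gt_eqF.
  by apply: ler_pM => //; rewrite ?lerDl// (le_trans _ (ep_le jv xb)).
- move=> b /flat_bonds[j [jv ->]] x.
  rewrite flat_blen// in_itv/= => xb.
  have [k [kv kE ek pk]] := nx_sym jv.
  have E : rev_bond (b.1, nx b.1 j) = (nx b.1 j, nx (nx b.1 j) k).
    by rewrite /rev_bond /= kE.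
  by rewrite E /= (flat_potE kv) (flat_potE jv) pk.
- move=> v; split.
  + by move=> j _; split=> //; apply/flat_adjP; exists j.
  + by move=> i j _ _ [e]; apply: val_inj; exact: (nx_inj (ltn_ord i) (ltn_ord j)).
  + move=> [a b] [/flat_adjP[j jv jE] /= av]; subst a.
    by exists (Ordinal jv) => //; rewrite /= /flat_lab /= jE.
- exact: S_unitary.
- by exists D; exact: d_le.
- by exists m => // e /flat_edges[v [j [jv ->]]]; have /andP[] := el_itv jv.
- by exists M => e /flat_edges[v [j [jv ->]]]; have /andP[] := el_itv jv.
- exists M => b /flat_bonds[j [jv ->]] x; rewrite flat_blen// in_itv/= => xb.
  by rewrite /= (flat_potE jv) ep_le.
- by exists M.
Unshelve. all: end_near. Qed.

Lemma flat_bounds : DmM_bounds D m M flat.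
Proof.
split.
- exact: d_le.
- by move=> e /flat_edges[v [j [jv ->]]]; exact: el_itv.
- exact: S_Lambda.
- move=> b /flat_bonds[j [jv ->]] x; rewrite flat_blen// in_itv/= => xb.
  by rewrite /= (flat_potE jv) ep_le.
move=> b /flat_bonds[j [jv ->]]; rewrite flat_blen// => -[x x'].
rewrite /= !in_itv/= => -[xb xb'].
by rewrite (flat_potE jv) ep_lip.
Qed.

Lemma flat_nbr (v : V) j : @nbr _ flat v j = nx v j.
Proof.
rewrite /nbr; case: insubP => [j' jv <-//|]; rewrite -leqNgt => jv.
by rewrite nx_ge.
Qed.

Lemma flat_walk (v : V) w : @walk _ flat v w = foldl nx v w.
Proof.
by rewrite /walk; elim: w v => //= j w IH v; rewrite flat_nbr IH.
Qed.

Lemma flat_elen (v : V) j : @elen _ flat v j = if (j < d v)%N then el v j else 0.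
Proof.
by rewrite /elen [X in (j < X)%N]/=; case: ifPn => // jv; rewrite flat_nbr flat_blen.
Qed.

Lemma flat_epot (v : V) j t : @epot _ flat v j t =
  if (j < d v)%N && (0 <= t <= 1) then ep v j (t * el v j) else 0.
Proof.
rewrite /epot [X in (j < X)%N]/=; case: ifPn => // /andP[jv t01].
by rewrite flat_nbr flat_blen// /= (flat_potE jv).
Qed.

End flat_graph.

(** * The limit of a convergent sequence of marked graphs *)

Section marked_edges.
Variables (R : realType) (D : nat) (m M : R).
Local Notation marked := (@marked R D m M).
Hypothesis m_gt0 : 0 < m.
Hypothesis m_lt_M : m < M.
Variables (x : marked) (v : vert (mgraph x)) (j : nat).
Hypothesis jv : (j < deg v)%N.

Lemma elen_sym i : (i < deg (nbr v j))%N -> nbr (nbr v j) i = v ->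
  elen (nbr v j) i = elen v j.
Proof. by move=> iv e; rewrite /elen iv jv e /blen edge_ofC. Qed.

Lemma epot_sym i t : (i < deg (nbr v j))%N -> nbr (nbr v j) i = v -> 0 <= t <= 1 ->
  epot (nbr v j) i (1 - t) = epot v j t.
Proof.
move=> iv e t01; have t01' : 0 <= 1 - t <= 1.
  by case/andP: t01 => h1 h2; apply/andP; split; lra.
rewrite /epot iv jv t01 t01' /= e.
have b : bonds (mgraph x) (v, nbr v j) := bonds_nbr (qgP (mgraph x)) jv.
rewrite -(pot_rev (qgP (mgraph x)) b); last exact: (scale_itv m_gt0 jv t01).
have -> : blen (nbr v j, v) = blen (v, nbr v j) by rewrite /blen edge_ofC.
by congr pot; ring.
Qed.

(** Unlike [epot_lip], this keeps the edge length: it cancels in the limit against the division by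
    [llen], leaving the constant [M] demanded by [DmM_bounds]. *)
Lemma epot_lip_elen t t' : 0 <= t <= 1 -> 0 <= t' <= 1 ->
  `|epot v j t - epot v j t'| <= M * (elen v j * `|t - t'|).
Proof.
move=> t01 t01'; rewrite /epot t01 t01' !andbT jv /elen jv.
have b : bonds (mgraph x) (v, nbr v j) := bonds_nbr (qgP (mgraph x)) jv.
have /(_ (t * blen (v, nbr v j), t' * blen (v, nbr v j))) := pot_lip (mboundsP x) b.
have s1 := scale_itv m_gt0 jv t01; have s2 := scale_itv m_gt0 jv t01'.
move=> /(_ (conj s1 s2)) /le_trans; apply.
rewrite /= -mulrBl normrM ler_wpM2l ?(ltW (lt_trans m_gt0 m_lt_M))// mulrC ler_wpM2r//.
have /andP[h _] := elen_itv jv; rewrite /elen jv in h.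
by rewrite ger0_norm// (le_trans _ h)// ltW.
Qed.

Lemma sentry_matrix n : deg v = n ->
  let U : 'M[R[i]]_n := \matrix_(a, b) sentry v a b in
  U \is unitarymx /\ (Lambda_norm U <= M%:E)%E.
Proof.
move=> e; case: _ / e => /=.
have -> : \matrix_(a, b) sentry v a b = scat v.
  by apply/matrixP => a b; rewrite mxE sentryE.
split; first exact: scat_unitary (qgP (mgraph x)) v.
exact: Lambda_le (mboundsP x) v.
Qed.

End marked_edges.

Section limit_graph.
Variables (R : realType) (D : nat) (m M : R).
Local Notation marked := (@marked R D m M).
Hypothesis m_gt0 : 0 < m.
Hypothesis m_lt_M : m < M.
Variable x_ : nat -> marked.
Hypothesis x_cvg : forall n, cvgn (fun k => mcoord n (x_ k)).

Lemma code_cvg c : cvgn (fun k => mcoord_at c (x_ k)).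
Proof.
have := @x_cvg (pickle c).
suff -> : (fun k => mcoord (pickle c) (x_ k)) = (fun k => mcoord_at c (x_ k)) by [].
by apply/funext => k; rewrite mcoord_pickle.
Qed.

Definition sim (w w' : seq nat) : Prop :=
  \forall k \near \oo, mwalk (x_ k) w = mwalk (x_ k) w'.

(** The indicator of coincidence converges, hence is eventually constant. Both alternatives are
    eventual, so finitely many of them can be realised at a common index. *)
Lemma simP w w' : sim w w' \/ \forall k \near \oo, mwalk (x_ k) w <> mwalk (x_ k) w'.
Proof.
have [l hl] := is_cvg_nat (@code_cvg ((0, (w, w'), (0, 0))%N, 0 : rat)).
case: l hl => [|l] hl; [right|left]; apply: filterS hl => k /=; by case: eqP.
Qed.

Lemma sim_refl w : sim w w. Proof. exact: nearW. Qed.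

Lemma sim_sym w w' : sim w w' -> sim w' w.
Proof. by apply: filterS => k ->. Qed.

Lemma sim_trans w w' w'' : sim w w' -> sim w' w'' -> sim w w''.
Proof. by move=> h1 h2; apply: filterS2 h1 h2 => k -> ->. Qed.

Lemma sim_rcons w w' j : sim w w' -> sim (rcons w j) (rcons w' j).
Proof. by apply: filterS => k e; rewrite !mwalk_rcons e. Qed.

(** A chosen word in each class makes the vertices a subtype of the words, hence a countable type in
    [Set], as [vert] requires. *)
Definition canon (w : seq nat) : seq nat := choose (fun w' => `[< sim w' w >]) w.

Lemma canon_sim w : sim (canon w) w.
Proof. by apply/asboolP/(@chooseP _ (fun w' => `[< sim w' w >])); apply/asboolP/sim_refl. Qed.

Lemma canon_eq w w' : sim w w' -> canon w = canon w'.
Proof.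
move=> h; rewrite /canon.
rewrite (@eq_choose _ _ (fun z => `[< sim z w' >])); last first.
  by move=> z; apply/asboolP/asboolP => h'; [exact: sim_trans h' h|exact: sim_trans h' (sim_sym h)].
by apply: choose_id; apply/asboolP; [exact: h|exact: sim_refl].
Qed.

Lemma canonK w : canon (canon w) == canon w.
Proof. by apply/eqP/canon_eq/canon_sim. Qed.

Definition lvert : Set := {w : seq nat | canon w == w}.

Definition cl (w : seq nat) : lvert := exist _ (canon w) (canonK w).

Definition rep (v : lvert) : seq nat := sval v.

Lemma clP w w' : cl w = cl w' <-> sim w w'.
Proof.
split=> [[e]|h]; last by apply: val_inj; exact: canon_eq.
by apply: sim_trans (sim_sym (canon_sim w)) _; rewrite e; exact: canon_sim.
Qed.

Lemma rep_cl w : sim (rep (cl w)) w. Proof. exact: canon_sim. Qed.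

Lemma cl_rep v : cl (rep v) = v.
Proof. by apply: val_inj => /=; apply/eqP; exact: (svalP v). Qed.

Lemma deg_cvg w : exists l, \forall k \near \oo, deg (mwalk (x_ k) w) = l.
Proof. exact: (is_cvg_nat (@code_cvg ((1, (w, [::]), (0, 0))%N, 0 : rat))). Qed.

Definition ldeg (v : lvert) : nat := projT1 (cid (deg_cvg (rep v))).

Lemma ldegP v : \forall k \near \oo, deg (mwalk (x_ k) (rep v)) = ldeg v.
Proof. exact: projT2 (cid (deg_cvg (rep v))). Qed.

Lemma ldeg_cl w : \forall k \near \oo, deg (mwalk (x_ k) w) = ldeg (cl w).
Proof. by apply: filterS2 (ldegP (cl w)) (rep_cl w) => k + e; rewrite e. Qed.

Definition lnbr (v : lvert) (j : nat) : lvert := cl (rcons (rep v) j).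

Lemma lnbr_cl w j : lnbr (cl w) j = cl (rcons w j).
Proof. by apply/clP/sim_rcons/rep_cl. Qed.

Lemma lwalk w : foldl lnbr (cl [::]) w = cl w.
Proof.
elim/last_ind: w => // w j IH; by rewrite -cats1 foldl_cat /= IH lnbr_cl cats1.
Qed.

Definition llen (v : lvert) (j : nat) : R :=
  limn (fun k => elen (mwalk (x_ k) (rep v)) j).

Lemma llen_cl w j : (fun k => elen (mwalk (x_ k) w) j) @ \oo --> llen (cl w) j.
Proof.
have h : (fun k => elen (mwalk (x_ k) (rep (cl w))) j) @ \oo --> llen (cl w) j.
  exact: (@code_cvg ((3, (rep (cl w), [::]), (j, 0))%N, 0 : rat)).
apply: cvg_trans h; apply: near_eq_cvg.
by apply: filterS (rep_cl w) => k ->.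
Qed.

Lemma llenP v j : (fun k => elen (mwalk (x_ k) (rep v)) j) @ \oo --> llen v j.
Proof. by have := @llen_cl (rep v) j; rewrite cl_rep. Qed.

Definition lepot (v : lvert) (j : nat) (t : R) : R :=
  limn (fun k => epot (mwalk (x_ k) (rep v)) j t).

Lemma lepot_cl w j t : 0 <= t <= 1 ->
  (fun k => epot (mwalk (x_ k) w) j t) @ \oo --> lepot (cl w) j t.
Proof.
move=> t01.
have h : (fun k => epot (mwalk (x_ k) (rep (cl w))) j t) @ \oo --> lepot (cl w) j t.
  have MM : 0 < M * M by rewrite mulr_gt0// (lt_trans m_gt0).
  apply: (@is_cvg_lipschitz _ (fun k => epot (mwalk (x_ k) (rep (cl w))) j) _ MM) => //.
    by move=> k s s' s01 s01'; exact: (epot_lip m_gt0 m_lt_M).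
  by move=> q _; exact: (@code_cvg ((4, (rep (cl w), [::]), (j, 0))%N, q)).
apply: cvg_trans h; apply: near_eq_cvg.
by apply: filterS (rep_cl w) => k ->.
Qed.

Lemma lepotP v j t : 0 <= t <= 1 ->
  (fun k => epot (mwalk (x_ k) (rep v)) j t) @ \oo --> lepot v j t.
Proof. by move=> t01; have := @lepot_cl (rep v) j t t01; rewrite cl_rep. Qed.

(** Limits of potentials are taken on the unit interval because the lengths vary with [k]; dividing
    by the limit length returns to the edge. *)
Definition lpot (v : lvert) (j : nat) (y : R) : R := lepot v j (y / llen v j).

Definition lsentry (v : lvert) (a b : nat) : R[i] :=
  (limn (fun k => complex.Re (sentry (mwalk (x_ k) (rep v)) a b))
   +i* limn (fun k => complex.Im (sentry (mwalk (x_ k) (rep v)) a b)))%C.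

Lemma lsentry_cl w a b :
  (fun k => sentry (mwalk (x_ k) w) a b : R[i]^o) @ \oo --> (lsentry (cl w) a b : R[i]^o).
Proof.
have h : (fun k => sentry (mwalk (x_ k) (rep (cl w))) a b : R[i]^o) @ \oo
    --> (lsentry (cl w) a b : R[i]^o).
  apply/cvg_complexP; split.
    exact: (@code_cvg ((5, (rep (cl w), [::]), (a, b))%N, 0 : rat)).
  exact: (@code_cvg ((6, (rep (cl w), [::]), (a, b))%N, 0 : rat)).
apply: cvg_trans h; apply: near_eq_cvg.
by apply: filterS (rep_cl w) => k ->.
Qed.

Definition lscat (v : lvert) : 'M[R[i]]_(ldeg v) := \matrix_(a, b) lsentry v a b.

Lemma near_rep v (P : nat -> Prop) :
  (forall k, deg (mwalk (x_ k) (rep v)) = ldeg v -> P k) -> \forall k \near \oo, P k.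
Proof. by move=> h; apply: filterS (ldegP v). Qed.

Lemma lnbr_sim v w j : lnbr v j = cl w -> sim (rcons (rep v) j) w.
Proof. by move/clP. Qed.

(** The pattern for local axioms: finitely many eventual facts hold together at some [k], where the
    axiom for [mgraph (x_ k)] applies. *)
Lemma lnbr_neq v j : (j < ldeg v)%N -> lnbr v j <> v.
Proof.
rewrite -{3}(cl_rep v) => jv /lnbr_sim e.
have [k [+ dk]] := filter_ex (filterI e (ldegP v)).
rewrite mwalk_rcons; apply: (nbr_neq (qgP (mgraph (x_ k)))).
by rewrite dk.
Qed.

Lemma lnbr_inj v i j : (i < ldeg v)%N -> (j < ldeg v)%N -> lnbr v i = lnbr v j -> i = j.
Proof.
move=> iv jv /lnbr_sim e.
have [k [+ dk]] := filter_ex (filterI e (ldegP v)).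
by rewrite !mwalk_rcons; apply: (nbr_inj (qgP (mgraph (x_ k)))); rewrite dk.
Qed.

Lemma lnbr_ge v j : (ldeg v <= j)%N -> lnbr v j = v.
Proof.
move=> vj; rewrite -[RHS]cl_rep; apply/clP; apply: (@near_rep v) => k dk.
by rewrite mwalk_rcons nbr_ge// dk.
Qed.

Lemma ldeg_leD v : (ldeg v <= D)%N.
Proof.
have [k <-] := filter_ex (ldegP v); exact: deg_le (mboundsP (x_ k)) _.
Qed.

Lemma llen_itv v j : (j < ldeg v)%N -> m <= llen v j <= M.
Proof.
move=> jv; apply/andP; split.
  apply: (cvgr_to_ge (@llenP v j)); apply: (@near_rep v) => k dk.
  by have /andP[] := @elen_itv _ _ _ _ (x_ k) (mwalk (x_ k) (rep v)) j
    (etrans (congr1 (fun n => (j < n)%N) dk) jv).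
apply: (cvgr_to_le (@llenP v j)); apply: (@near_rep v) => k dk.
by have /andP[] := @elen_itv _ _ _ _ (x_ k) (mwalk (x_ k) (rep v)) j
    (etrans (congr1 (fun n => (j < n)%N) dk) jv).
Qed.

(** The label of the reversed bond may change with [k]. If no fixed label led back, [simP] would
    make each of the finitely many labels below [D] fail eventually, and a common [k] would
    contradict the symmetry of adjacency in that graph. *)
Lemma lnbr_back v j : (j < ldeg v)%N ->
  exists2 i, (i < ldeg (lnbr v j))%N & lnbr (lnbr v j) i = v.
Proof.
move=> jv; apply: contrapT => /forall2NP H.
set w := rcons (rep v) j.
have hn : \forall k \near \oo, forall i, i \in iota 0 D ->
    (i < deg (mwalk (x_ k) w))%N -> mwalk (x_ k) (rcons w i) <> mwalk (x_ k) (rep v).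
  apply: nbhs_all_in => i _.
  have [iw|iw] := ltnP i (ldeg (cl w)).
    have [|hs] := simP (rcons w i) (rep v); last by apply: filterS hs => k hk _.
    move=> hs; have [//|] := H i; rewrite lnbr_cl => -[].
    by rewrite -[RHS]cl_rep; apply/clP.
  by apply: filterS (ldeg_cl w) => k ->; rewrite ltnNge iw.
have [k [hk dk]] := filter_ex (filterI hn (ldegP v)).
have QP := qgP (mgraph (x_ k)).
have ad : adj (mwalk (x_ k) w) (mwalk (x_ k) (rep v)).
  by rewrite (adj_sym QP) /w mwalk_rcons; apply: (adj_nbr QP); rewrite dk.
have [i iw iE] := adjP QP ad.
apply: (hk i) => //; last by rewrite mwalk_rcons.
by rewrite mem_iota /= add0n; exact: leq_trans iw (deg_leD _).
Qed.

Lemma lnbr_sym v j : (j < ldeg v)%N -> exists i,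
  [/\ (i < ldeg (lnbr v j))%N, lnbr (lnbr v j) i = v, llen (lnbr v j) i = llen v j &
    forall y, 0 <= y <= llen v j -> lpot (lnbr v j) i (llen v j - y) = lpot v j y].
Proof.
move=> jv; have [i iw iE] := lnbr_back jv; exists i.
have /andP[Lm _] := llen_itv jv; have L0 := lt_le_trans m_gt0 Lm.
set w := rcons (rep v) j.
have back : \forall k \near \oo, [/\ (j < deg (mwalk (x_ k) (rep v)))%N,
    (i < deg (nbr (mwalk (x_ k) (rep v)) j))%N &
    nbr (nbr (mwalk (x_ k) (rep v)) j) i = mwalk (x_ k) (rep v)].
  have e : sim (rcons w i) (rep v).
    by apply/clP; rewrite -lnbr_cl cl_rep.
  apply: filterS2 (filterI e (ldeg_cl w)) (ldegP v) => k [e1 e2] dk.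
  by split; [rewrite dk|rewrite -mwalk_rcons e2|rewrite -!mwalk_rcons e1].
have lenE : llen (lnbr v j) i = llen v j.
  have h : (fun k => elen (mwalk (x_ k) w) i) @ \oo --> llen v j.
    apply: cvg_trans (@llenP v j).
    apply: near_eq_cvg; apply: filterS back => k [k1 k2 k3].
    by rewrite /w mwalk_rcons (elen_sym k1 k2 k3).
  exact: (cvg_unique _ (@llen_cl w i) h).
split; [exact: iw|exact: iE|exact: lenE|move=> y /andP[y0 yL]]; rewrite /lpot lenE.
have t01 : 0 <= y / llen v j <= 1.
  by rewrite divr_ge0 ?(ltW L0)//= ler_pdivrMr// mul1r.
have -> : (llen v j - y) / llen v j = 1 - y / llen v j by rewrite mulrBl divff// gt_eqF.
have t01' : 0 <= 1 - y / llen v j <= 1.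
  by case/andP: t01 => h1 h2; apply/andP; split; lra.
have h : (fun k => epot (mwalk (x_ k) w) i (1 - y / llen v j)) @ \oo
    --> lepot v j (y / llen v j).
  apply: cvg_trans (@lepotP v j _ t01).
  apply: near_eq_cvg; apply: filterS back => k [k1 k2 k3].
  by rewrite /w mwalk_rcons (epot_sym m_gt0 k1 k2 k3).
exact: (cvg_unique _ (@lepot_cl w i _ t01') h).
Qed.

Lemma lpot_arg v j y : (j < ldeg v)%N -> 0 <= y <= llen v j -> 0 <= y / llen v j <= 1.
Proof.
move=> jv /andP[y0 yL]; have /andP[Lm _] := llen_itv jv; have L0 := lt_le_trans m_gt0 Lm.
by rewrite divr_ge0 ?(ltW L0)//= ler_pdivrMr// mul1r.
Qed.

Lemma lpot_le v j y : (j < ldeg v)%N -> 0 <= y <= llen v j -> `|lpot v j y| <= M.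
Proof.
move=> jv /(lpot_arg jv) t01.
have h : (fun k => `|epot (mwalk (x_ k) (rep v)) j (y / llen v j)|) @ \oo -->
    `|lepot v j (y / llen v j)| by apply: cvg_norm; exact: lepotP.
rewrite /lpot; apply: (cvgr_to_le h); apply: nearW => k; exact: epot_le.
Qed.

Lemma lpot_lip v j y y' : (j < ldeg v)%N -> 0 <= y <= llen v j -> 0 <= y' <= llen v j ->
  `|lpot v j y - lpot v j y'| <= M * `|y - y'|.
Proof.
move=> jv yb yb'; have t01 := lpot_arg jv yb; have t01' := lpot_arg jv yb'.
have /andP[Lm _] := llen_itv jv; have L0 := lt_le_trans m_gt0 Lm.
have h : (fun k => `|epot (mwalk (x_ k) (rep v)) j (y / llen v j) -
      epot (mwalk (x_ k) (rep v)) j (y' / llen v j)|) @ \oo -->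
    `|lepot v j (y / llen v j) - lepot v j (y' / llen v j)|.
  by apply: cvg_norm; apply: cvgB; exact: lepotP.
have h' : (fun k => M * (elen (mwalk (x_ k) (rep v)) j * `|y / llen v j - y' / llen v j|))
    @ \oo --> M * `|y - y'|.
  have -> : `|y - y'| = llen v j * `|y / llen v j - y' / llen v j|.
    rewrite -mulrBl normrM normfV (gtr0_norm L0) mulrCA divff ?mulr1//.
    by rewrite gt_eqF.
  by apply: cvgMr; apply: cvgMl; exact: llenP.
apply: (ler_cvg_to h h'); apply: (@near_rep v) => k dk.
by apply: (epot_lip_elen m_gt0 m_lt_M) => //; rewrite dk.
Qed.

Lemma lscat_bounds v : lscat v \is unitarymx /\ (Lambda_norm (lscat v) <= M%:E)%E.
Proof.
pose U k : 'M[R[i]]_(ldeg v) := \matrix_(a, b) sentry (mwalk (x_ k) (rep v)) a b.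
have hU : mx_cvg U (lscat v).
  move=> a b; rewrite mxE.
  rewrite (_ : (fun k => _) = (fun k => sentry (mwalk (x_ k) (rep v)) a b : R[i]^o)).
    by have := @lsentry_cl (rep v) a b; rewrite cl_rep.
  by apply/funext => k; rewrite mxE.
have UP : \forall k \near \oo, U k \is unitarymx /\ (Lambda_norm (U k) <= M%:E)%E.
  by apply: (@near_rep v) => k dk; exact: sentry_matrix.
split; first by apply: (unitary_limit hU); apply: filterS UP => k [].
by apply: (Lambda_norm_limit _ hU UP); exact: ltW (lt_trans m_gt0 m_lt_M).
Qed.

Lemma lvert_countable : countable [set: lvert].
Proof. exact: countableP. Qed.

Lemma lreach v : exists w, foldl lnbr (cl [::]) w = v.
Proof. by exists (rep v); rewrite lwalk cl_rep. Qed.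

Definition lgraph : quantum_graph R := QuantumGraph
  (@flat_quantum_graph R lvert ldeg lnbr llen lpot lscat D m M (cl [::]) m_gt0
    lvert_countable lnbr_neq lnbr_inj lnbr_ge lnbr_sym lreach ldeg_leD llen_itv
    lpot_le lpot_lip (fun v => (lscat_bounds v).1) (fun v => (lscat_bounds v).2)).

Lemma lgraph_bounds : DmM_bounds D m M lgraph.
Proof.
apply: flat_bounds.
- exact: lnbr_inj.
- exact: lnbr_sym.
- exact: ldeg_leD.
- exact: llen_itv.
- exact: lpot_le.
- exact: lpot_lip.
- by move=> v; exact: (lscat_bounds v).2.
Qed.

Lemma lab_cvg : exists l, \forall k \near \oo, mlab (x_ k) = l.
Proof. exact: (is_cvg_nat (@code_cvg ((2, ([::], [::]), (0, 0))%N, 0 : rat))). Qed.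

(** Supplies the hypothesis [f_compact] for the coordinates [mcoord]. The limit is marked at the
    class of the empty word, with the eventual value of [mlab (x_ k)] as label. *)
Lemma limit_marked : exists y : marked, mcvg x_ y.
Proof.
have [l hl] := lab_cvg.
have lv : (l < ldeg (cl [::]))%N.
  have [k [<- <-]] := filter_ex (filterI hl (ldeg_cl [::])).
  by have [] := mlabP (x_ k).
pose b : vert lgraph * vert lgraph := (cl [::], lnbr (cl [::]) l).
have bP : bonds lgraph b by apply/flat_adjP; exists l.
pose y : marked := Marked bP lgraph_bounds.
exists y => n; rewrite /mcoord; case: unpickle => [c|]; last exact: cvg_cst.
have walkE w : mwalk y w = cl w.
  by apply: etrans (flat_walk _ _ _ lnbr_ge _ _) _; exact: lwalk.
have labE : mlab y = l.
  have [h1 h2] := mlabP y; apply: (lnbr_inj h1 lv).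
  by apply: etrans h2; apply/esym; exact: (flat_nbr _ _ _ lnbr_ge _ _).
have near_cvg (u : nat -> R) (c0 : R) : (\forall k \near \oo, u k = c0) -> u @ \oo --> c0.
  move=> h; apply: cvg_trans (@cvg_cst _ c0 _ \oo _); apply: near_eq_cvg.
  by apply: filterS h => k ->.
case: c => [[[tag [w w']] [a b']] q].
case: tag => [|[|[|[|[|tag]]]]].
- rewrite /mcoord_at !walkE; apply: near_cvg.
  have [h|h] := simP w w'; apply: filterS (h) => k hk.
    by rewrite hk eqxx ((clP w w').2 h) eqxx.
  have -> : (mwalk (x_ k) w == mwalk (x_ k) w') = false by apply/eqP.
  have -> // : (cl w == cl w' :> vert lgraph) = false.
  apply/eqP => /clP h'.
  by have [k' [h1 h2]] := filter_ex (filterI h h').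
- rewrite /mcoord_at walkE; apply: near_cvg.
  by apply: filterS (ldeg_cl w) => k /= ->.
- by rewrite /mcoord_at labE; apply: near_cvg; apply: filterS hl => k ->.
- rewrite /mcoord_at walkE [elen _ _](flat_elen lscat lnbr_inj lnbr_ge lnbr_sym).
  case: ifPn => ha; first exact: llen_cl.
  apply: near_cvg; apply: filterS (ldeg_cl w) => k dk.
  by rewrite /elen dk (negbTE ha).
- rewrite /mcoord_at walkE [epot _ _ _](flat_epot lscat lnbr_inj lnbr_ge lnbr_sym).
  case: ifPn => [/andP[ha t01]|ha].
    rewrite /lpot mulfK; first exact: lepot_cl.
    have /andP[Lm _] := llen_itv ha; by rewrite gt_eqF// (lt_le_trans m_gt0 Lm).
  apply: near_cvg; apply: filterS (ldeg_cl w) => k dk.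
  by rewrite /epot dk (negbTE ha).
have sE : sentry (mwalk y w) a b' =
    if (a < ldeg (cl w))%N && (b' < ldeg (cl w))%N then lsentry (cl w) a b' else 0.
  rewrite walkE /sentry; case: insubP => [a1 ha aE|]; last first.
    by rewrite -leqNgt => ha; rewrite ltnNge ha.
  case: insubP => [b1 hb bE|]; last by rewrite -leqNgt => hb; rewrite andbC ltnNge hb.
  by rewrite [LHS]mxE aE bE ha hb.
have sc : (fun k => sentry (mwalk (x_ k) w) a b' : R[i]^o) @ \oo -->
    (sentry (mwalk y w) a b' : R[i]^o).
  rewrite sE; case: ifPn => hab; first exact: lsentry_cl.
  apply: cvg_trans (@cvg_cst _ (0 : R[i]^o) _ \oo _); apply: near_eq_cvg.
  apply: filterS (ldeg_cl w) => k dk; rewrite /cst /sentry.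
  case: insubP => [a1 ha _|//]; case: insubP => [b1 hb _|//].
  by move: hab; rewrite -dk ha hb.
have /cvg_complexP[sR sI] := sc.
by case: tag => [|tag]; [exact: sR|exact: sI].
Qed.

End limit_graph.

(** * The measures nu and their limit *)

Section sequentially_open.
Context (d : measure_display) (T : measurableType d) (R : realType).
Variables (D : set T) (mD : measurable D) (g : nat -> T -> R).
Hypothesis mg : forall i, measurable_fun D (g i).

(* A set which is sequentially open for countably many measurable functions is a
   countable union of preimages of rational boxes. *)
Lemma measurable_seq_open (A : set T) :
  (forall t (t_ : nat -> T), D t -> A t -> (forall k, D (t_ k)) ->
    (forall i, (fun k => g i (t_ k)) @ \oo --> g i t) -> exists k, A (t_ k)) ->
  measurable (D `&` A).
Proof.
move=> Aop.
(* Otherwise some points [t_ n] outside [A] have all their values converging to those of [t], and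
   the hypothesis puts one of them in [A]. *)
have loc t : D t -> A t -> exists n, forall t', D t' ->
    (forall i, (i < n)%N -> `|g i t' - g i t| < n.+1%:R^-1) -> A t'.
  move=> Dt At; apply: contrapT => /forallNP H.
  have {}H n : exists t', [/\ D t', ~ A t' &
      forall i, (i < n)%N -> `|g i t' - g i t| < n.+1%:R^-1].
    by have /existsNP[t' /not_implyP[h1 /not_implyP[h2 h3]]] := H n; exists t'.
  pose t_ n := projT1 (cid (H n)).
  have tP n : [/\ D (t_ n), ~ A (t_ n) &
      forall i, (i < n)%N -> `|g i (t_ n) - g i t| < n.+1%:R^-1].
    exact: projT2 (cid (H n)).
  have [|i|k Ak] := Aop t t_ Dt At; last by have [] := tP k.
    by move=> k; have [] := tP k.
  apply/cvgrPdist_lt => e e0; near=> k; have [_ _ h] := tP k.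
  rewrite distrC; apply: lt_trans (h i _) _; first by near: k; exact: nbhs_infty_gt.
  by near: k; exact: near_infty_natSinv_lt (PosNum e0).
(* The half-width [1/(2(n + 1))] makes the values of two points of a box differ by less than the
   radius [1/(n + 1)] of [loc]. *)
pose box (c : nat * seq rat) : set T := D `&` [set t | forall i, (i < c.1)%N ->
  `|g i t - ratr (nth 0 c.2 i)| < (c.1.+1%:R)^-1 / 2].
have mbox c : measurable (box c).
  rewrite (_ : box c = \bigcap_(i in [set i | (i < c.1)%N])
      (D `&` g i @^-1` `](ratr (nth 0 c.2 i) - (c.1.+1%:R)^-1 / 2),
        (ratr (nth 0 c.2 i) + (c.1.+1%:R)^-1 / 2)[%classic) `&` D).
    apply: measurableI => //; apply: bigcap_measurableType => i _.
    exact: mg.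
  apply/seteqP; split=> [t [Dt ht]|t [ht Dt]]; split=> //.
    by move=> i /ht h; split=> //; rewrite /= in_itv/= -ltr_distl.
  by move=> i /ht [_]; rewrite /= in_itv/= -ltr_distl.
pose F (n : nat) : set T := if unpickle n is Some c
  then if pselect (box c `<=` A) is left _ then box c else set0 else set0.
have -> : D `&` A = \bigcup_n F n.
  apply/seteqP; split=> [t [Dt At]|t [n _]]; last first.
    rewrite /F; case: unpickle => [c|//]; case: pselect => // cA ct.
    by split; [case: ct|exact: cA].
  have [n hn] := loc t Dt At.
  have e0 : 0 < n.+1%:R^-1 / 2 :> R by rewrite divr_gt0// invr_gt0.
  have H i : exists q : rat, `|g i t - ratr q| < n.+1%:R^-1 / 2.
    have /rat_in_itvoo[q] : g i t - n.+1%:R^-1 / 2 < g i t + n.+1%:R^-1 / 2.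
      by rewrite ltrBlDr -addrA ltrDl addr_gt0.
    by rewrite in_itv/= -ltr_distl distrC => h; exists q.
  pose q i := projT1 (cid (H i)).
  have qP i : `|g i t - ratr (q i)| < n.+1%:R^-1 / 2 := projT2 (cid (H i)).
  pose c := (n, mkseq q n).
  have cE i : (i < n)%N -> nth 0 c.2 i = q i by move=> i_n; rewrite nth_mkseq.
  have ct : box c t by split=> // i /= i_n; rewrite cE.
  have cA : box c `<=` A.
    move=> t' [Dt' ht']; apply: hn => // i i_n.
    rewrite (le_lt_trans (ler_distD (ratr (q i)) _ _))// [ltRHS]splitr ltrD//.
      by have := ht' i i_n; rewrite cE.
    by rewrite distrC.
  by exists (pickle c) => //; rewrite /F pickleK; case: pselect.
apply: bigcupT_measurable => n; rewrite /F; case: unpickle => [c|//].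
by case: pselect.
Unshelve. all: end_near. Qed.

End sequentially_open.

(** * The uniform law and scaling of Lebesgue measure *)

Section unit_interval.
Variable R : realType.
Local Notation leb := (@lebesgue_measure R).

Local Notation unif := (uniform_prob (@ltr01 R)).

Lemma unif_itv (A : set R) : measurable A -> unif A = leb (A `&` `[0, 1]).
Proof.
move=> mA; rewrite /uniform_prob integral_uniform_pdf.
rewrite (eq_integral (fun=> 1%E)); last first.
  move=> x; rewrite inE/= => -[_]; rewrite in_itv/= /uniform_pdf => ->.
  by rewrite subr0 invr1.
rewrite integral_cst ?mul1e//; exact: measurableI.
Qed.

Lemma unif_oitv (A : set R) : measurable A -> unif A = leb (A `&` `]0, 1[).
Proof.
move=> mA; rewrite unif_itv//.
have mI (E : set R) : measurable_fun E (EFin \o (\1_A : R -> R)).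
  by apply/measurable_EFinP; exact: measurable_indic.
transitivity (\int[leb]_(x in `[0%R, 1%R]) (\1_A x)%:E)%E.
  by rewrite integral_indic.
rewrite -integral_itv_bndo_bndc; last exact: mI.
rewrite -integral_itv_obnd_cbnd; last exact: mI.
by rewrite integral_indic.
Qed.

Lemma integral_unif (f : R -> \bar R) : measurable_fun [set: R] f ->
  (forall x, (0 <= f x)%E) ->
  (\int[unif]_x f x = \int[leb]_(x in `[0%R, 1%R[) f x)%E.
Proof.
move=> mf f0; rewrite integral_uniform// subr0 invr1 mul1e.
by rewrite integral_itv_bndo_bndc//; exact: measurable_funTS.
Qed.

(** The image of Lebesgue measure under division by [c], weighted by [1/c], has the right value on
    half-open intervals, and these determine Lebesgue measure. *)
Lemma lebesgue_scale (c : R) (A : set R) : 0 < c -> measurable A ->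
  leb ((fun x => x / c) @^-1` A) = (c%:E * leb A)%E.
Proof.
move=> c0 mA; have ci : 0 <= c^-1 by rewrite invr_ge0 ltW.
pose phi : R -> measurableTypeR R := fun x => x / c.
have mphi : measurable_fun [set: measurableTypeR R] phi.
  by apply: measurable_funM => //; exact: measurable_cst.
pose mu : {measure set (measurableTypeR R) -> \bar R} :=
  mscale (NngNum ci) (pushforward leb phi).
have E : leb A = mu mphi A.
  apply: lebesgue_measure_unique => // _ [[a b] _ <-].
  have pE : phi @^-1` `]a, b]%classic = `](a * c), (b * c)]%classic.
    by apply/seteqP; split=> x; rewrite /= !in_itv/= /phi ltr_pdivlMr// ler_pdivrMr.
  suff : leb `]a, b]%classic = (c^-1%:E * leb (phi @^-1` `]a, b]%classic))%E by [].
  rewrite pE !lebesgue_measure_itv/= !lte_fin ltr_pM2r//.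
  case: ifP => _; last by rewrite mule0.
  rewrite -!EFinD -EFinM -mulrBl mulrCA mulVf ?mulr1//.
  by rewrite gt_eqF.
have {}E : leb A = (c^-1%:E * leb (phi @^-1` A))%E by [].
by rewrite E muleA -EFinM divff ?mul1e// gt_eqF.
Qed.

End unit_interval.

(** * Rooted graphs as functions of the marked bond and the position *)

Section rooted_points.
Variables (R : realType) (D : nat) (m M : R).
Local Notation marked := (@marked R D m M).
Hypothesis m_gt0 : 0 < m.
Hypothesis m_lt_M : m < M.
Variable h : Qstar_DmM D m M !=set0.

Lemma mpoint_DmM (x : marked) (s : R) (hs : 0 < s < 1) :
  Qstar_DmM D m M (\pi_(Qstar R) (mpoint m_gt0 x hs)).
Proof. by exists (mpoint m_gt0 x hs) => //; exact: (mboundsP x). Qed.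

(** The base point makes the map total; the uniform law does not charge the values of [s] where it
    is used. *)
Definition qpoint (x : marked) (s : R) : QDmM h :=
  if pselect (0 < s < 1) is left hs
  then exist _ (\pi_(Qstar R) (mpoint m_gt0 x hs)) (mem_set (mpoint_DmM x hs))
  else QDmM_point h.

Lemma set_val_qpoint (x : marked) (s : R) (hs : 0 < s < 1) :
  set_val (qpoint x s) = \pi_(Qstar R) (mpoint m_gt0 x hs).
Proof.
rewrite /qpoint; case: pselect => // hs'.
by rewrite (Prop_irrelevance hs' hs).
Qed.

Lemma qpoint_open (U : set (QDmM h)) (x_ : nat -> marked) y (s_ : nat -> R) (s : R) :
  open U -> mcvg x_ y -> (forall k, 0 < s_ k < 1) -> 0 < s < 1 ->
  s_ @ \oo --> s -> U (qpoint y s) -> \forall k \near \oo, U (qpoint (x_ k) (s_ k)).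
Proof.
move=> [A oA <-] xy s01_ s01 ss /=; rewrite (set_val_qpoint _ s01) => Ay.
have [e e0 eA] : exists2 e : R, 0 < e &
    [set z | Qdist (\pi_(Qstar R) (mpoint m_gt0 y s01)) z < e] `<=` A.
  exact: oA.
(* Closeness at radius [1/e] bounds the distance by [1/(1 + 1/e)], which is below [e]. *)
have r0 : 0 < e^-1 by rewrite invr_gt0.
have re : (1 + e^-1)^-1 < e.
  by rewrite invf_plt ?posrE ?addr_gt0// ltrDr.
have := @mcvg_close R D m M m_gt0 m_lt_M x_ y xy s_ s s01_ s01 ss _ r0.
apply: filterS => k hk; rewrite (set_val_qpoint _ (s01_ k)); apply: eA => /=.
exact: le_lt_trans (close_Qdist r0 hk) re.
Qed.

Lemma continuous_qpoint (T : topologicalType) (F : QDmM h -> T) (x_ : nat -> marked) y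
    (s_ : nat -> R) (s : R) : continuous F -> mcvg x_ y -> (forall k, 0 < s_ k < 1) ->
  0 < s < 1 -> s_ @ \oo --> s ->
  (fun k => F (qpoint (x_ k) (s_ k))) @ \oo --> F (qpoint y s).
Proof.
move=> Fc xy s01_ s01 ss V /Fc; rewrite nbhsE => -[U [oU Uy] UV].
have := qpoint_open oU xy s01_ s01 ss Uy; apply: filterS => k /UV.
by [].
Qed.

Lemma measurable_continuous (F : QDmM h -> R) : continuous F ->
  measurable_fun [set: QDmM_borel h] F.
Proof.
move=> Fc; apply: (measurability _ (RGenOInfty.measurableE R)).
move=> _ [_ [a ->] <-]; rewrite setTI; apply: sub_sigma_algebra.
have : open (F @^-1` `]a, +oo[%classic).
  by apply: open_comp => [x _|]; [exact: Fc|exact: rray_open].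
by [].
Qed.

Lemma measurable_qpoint d (T : measurableType d) (E : set T) (X : T -> marked)
    (S : T -> R) : measurable E ->
  (forall i, measurable_fun E (fun t => mcoord i (X t))) -> measurable_fun E S ->
  (forall t, E t -> 0 < S t < 1) ->
  measurable_fun [set: T] (fun t =>
    (if t \in E then qpoint (X t) (S t) else QDmM_point h) : QDmM_borel h).
Proof.
move=> mE mX mS S01; set Z := fun t => _.
apply: (@measurability _ _ T (QDmM_borel h) setT Z (@open (QDmM h))) => // _ [U oU <-].
rewrite setTI.
have mEU : measurable (E `&` Z @^-1` U).
  pose g i t := if i is j.+1 then mcoord j (X t) else S t.
  apply: (@measurable_seq_open _ T R E mE g) => [[|i]|t t_ Et Ut Et_ tt].
  - exact: mS.
  - exact: mX.
  have Uq : U (qpoint (X t) (S t)) by move: Ut; rewrite /Z/= mem_set.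
  have xy : mcvg (X \o t_) (X t) by move=> i; exact: (tt i.+1).
  have := @qpoint_open U (X \o t_) (X t) (S \o t_) (S t) oU xy
    (fun k => S01 _ (Et_ k)) (S01 _ Et) (tt 0%N) Uq.
  move=> /filter_ex[k Uk]; exists k.
  by rewrite /Z/= mem_set//; exact: Et_.
(* Off [E] the value is the base point, so the complement of [E] belongs to the preimage exactly
   when [U] contains that point. *)
have [UP|UP] := pselect (U (QDmM_point h)).
  rewrite (_ : Z @^-1` U = (E `&` Z @^-1` U) `|` ~` E).
    by apply: measurableU => //; exact: measurableC.
  apply/seteqP; split=> t /=.
    by move=> Ut; have [Et|Et] := pselect (E t); [left|right].
  by move=> [[]//|Et]; rewrite /Z memNset.
rewrite (_ : Z @^-1` U = E `&` Z @^-1` U)//.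
apply/seteqP; split=> t /=; last by case.
move=> Ut; split=> //; apply: contrapT => Et.
by apply: UP; move: Ut; rewrite /Z memNset.
Qed.

End rooted_points.

(** * Finite graphs and the decomposition of their measures *)

Section finite_graphs.
Variables (R : realType) (Q : quantum_graph R).
Hypothesis Qfin : finite_graph Q.

Lemma finite_bonds : finite_set (bonds Q).
Proof.
apply: (@sub_finite_set _ _ ([set: vert Q] `*` [set: vert Q])) => //.
by apply: finite_setX; exact: Qfin.1.
Qed.

Definition bond_seq : seq (vert Q * vert Q) := finmap.enum_fset (fset_set (bonds Q)).

Lemma mem_bond_seq b : b \in bond_seq = (b \in bonds Q).
Proof. exact: (in_fset_set finite_bonds). Qed.

(** Each edge carries exactly two bonds, distinct because there are no loops. This makes the weights
    of the marked bonds sum to 1. *)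
Lemma sum_blen : \sum_(b <- bond_seq) blen b = 2 * total_length Q.
Proof.
rewrite /total_length fsbig_finite/=; last exact: Qfin.2.
rewrite (fset_set_image (@edge_of _) finite_bonds) /bond_seq.
rewrite (finmap.partition_big_imfset _ (@edge_of (vert Q)))/= mulr_sumr big_seq [RHS]big_seq.
apply: eq_bigr => _ /finmap.imfsetP[/= b0 bB ->].
have b0b : bonds Q b0 by move: bB; rewrite (in_fset_set finite_bonds) => /set_mem.
rewrite -big_filter (perm_big [:: b0; rev_bond b0])/=.
  rewrite !big_cons big_nil addr0 mulr_natl mulr2n; congr (_ + _).
  by case: b0 {bB b0b} => b1 b2; rewrite /blen edge_ofC.
apply: uniq_perm => [||b]; first by rewrite filter_uniq ?finmap.fset_uniq.
  rewrite /= andbT inE; apply/eqP => b0E; have := adj_irr (qgP Q) b0.1.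
  by move: b0b; rewrite /bonds/= [in X in X -> _]b0E/=; rewrite {1}b0E/= => ->.
rewrite mem_filter !inE (in_fset_set finite_bonds).
apply/andP/orP => [[/eqP e _]|].
  move: e; case: b => b1 b2; case: (b0) => c1 c2 e.
  by have := edge_of_eq e => -[[-> ->]|[-> ->]]; [left|right].
case=> /eqP ->; first by rewrite eqxx mem_set.
split; last by rewrite mem_set// /bonds/= (adj_sym (qgP Q)).
by case: (b0) => b1 b2; rewrite edge_ofC.
Qed.

Lemma total_length_ge0 : 0 <= total_length Q.
Proof. by apply: fsumr_ge0 => e /(len_gt0 (qgP Q)) /ltW. Qed.

Lemma total_length_gt0 : edges Q !=set0 -> 0 < total_length Q.
Proof.
move=> [_ [b bb _]]; have b0 : 0 < blen b by apply: (len_gt0 (qgP Q)); exists b.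
rewrite lt_neqAle total_length_ge0 andbT eq_sym; apply/eqP => t0.
have := sum_blen; rewrite t0 mulr0 big_seq => /eqP.
rewrite psumr_eq0 => [/allP/(_ b)|b']; last first.
  rewrite mem_bond_seq => /set_mem bb'.
  by rewrite ltW//; apply: (len_gt0 (qgP Q)); exists b'.
rewrite mem_bond_seq mem_set// => /(_ isT)/=.
by rewrite gt_eqF.
Qed.

End finite_graphs.

Lemma Rooted_eq (R : realType) (Q : quantum_graph R) b (bP : bonds Q b) (x x' : R)
    (xP : 0 < x < blen b) (xP' : 0 < x' < blen b) :
  x = x' -> Rooted bP xP = Rooted bP xP'.
Proof. by move=> xx'; case: _ / xx' xP' => xP'; rewrite (Prop_irrelevance xP xP'). Qed.

Section integral_raw.
Local Open Scope ereal_scope.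

Import HBNNSimple.

(* [mu] and [nu] need not be measures: [nu_DmM] is only known to agree with a
   measure on measurable sets. *)
Lemma eq_integral_set_fun d (T : measurableType d) (R : realType)
    (mu nu : set T -> \bar R) (f : T -> \bar R) :
  (forall A, measurable A -> mu A = nu A) -> \int[mu]_x f x = \int[nu]_x f x.
Proof.
move=> mn; rewrite /integral.
have E (h : {nnsfun T >-> R}) : sintegral mu h = sintegral nu h.
  by rewrite /sintegral; apply: eq_fsbigr => x _; rewrite mn.
by congr (ereal_sup _ - ereal_sup _); apply/seteqP; split=> _ [k kf <-];
  exists k => //; rewrite E.
Qed.

End integral_raw.

Section nu_decomposition.
Variables (R : realType) (D : nat) (m M : R).
Local Notation marked := (@marked R D m M).
Hypothesis m_gt0 : 0 < m.
Hypothesis m_lt_M : m < M.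
Variable h : Qstar_DmM D m M !=set0.
Local Notation qpoint := (qpoint m_gt0 h).
Local Notation leb := (@lebesgue_measure R).
Local Notation unif := (uniform_prob (@ltr01 R)).

Lemma measurable_qpoint1 (x : marked) :
  measurable_fun [set: R] (qpoint x : R -> QDmM_borel h).
Proof.
rewrite (_ : qpoint x = fun s => if s \in `]0, 1[%classic then qpoint x (id s) else QDmM_point h).
  by apply: (measurable_qpoint _ m_lt_M) => // s; rewrite /= in_itv.
apply/funext => s; case: ifPn => //; rewrite notin_setE/= in_itv/= => hs.
by rewrite /qpoint; case: pselect.
Qed.

Variable Q : quantum_graph R.
Hypothesis Qb : DmM_bounds D m M Q.

Lemma qpoint_Marked b (bP : bonds Q b) x (xP : 0 < x < blen b) :
  set_val (qpoint (Marked bP Qb) (x / blen b)) = \pi_(Qstar R) (Rooted bP xP).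
Proof.
have b0 : 0 < blen b by case/andP: xP; exact: lt_trans.
have hs : 0 < x / blen b < 1.
  by case/andP: xP => x0 xb; rewrite divr_gt0//= ltr_pdivrMr// mul1r.
rewrite (set_val_qpoint _ _ _ hs); congr (\pi_(Qstar R) _).
by rewrite /mpoint/=; apply: Rooted_eq; rewrite divfK// gt_eqF.
Qed.

(** The substitution [x = s * blen b], by [lebesgue_scale]; [qpoint_Marked] identifies the rooted
    graphs on the two sides. *)
Lemma integral_bond b (bP : bonds Q b) (A : set (QDmM_borel h)) : measurable A ->
  (\int[leb]_(x in `]0%R, blen b[)
     (\1_[set x | exists (bP : bonds Q b) (xP : (0 < x < blen b)%R),
            (set_val @` A) (\pi_(Qstar R) (Rooted bP xP))] x)%:E =
   (blen b)%:E * unif (qpoint (Marked bP Qb) @^-1` A))%E.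
Proof.
move=> mA; set S := (X in \1_X).
have b0 : 0 < blen b by apply: (len_gt0 (qgP Q)); exists b.
have mqA : measurable (qpoint (Marked bP Qb) @^-1` A).
  by rewrite -[X in measurable X]setTI; exact: measurable_qpoint1.
pose q01 := qpoint (Marked bP Qb) @^-1` A `&` `]0, 1[.
have mq01 : measurable q01 by exact: measurableI.
have SE : S = (fun x => x / blen b) @^-1` q01.
  apply/seteqP; split=> [x [bP' [xP [y Ay]]]|x []].
    rewrite (Prop_irrelevance bP' bP) -qpoint_Marked => /val_inj yE.
    split; first by rewrite /= -yE.
    by rewrite /= in_itv/=; case/andP: xP => x0 xb; rewrite divr_gt0//= ltr_pdivrMr// mul1r.
  rewrite /= in_itv/= ltr_pdivlMr// ltr_pdivrMr// mul0r mul1r => Ax xP.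
  exists bP, xP; exists (qpoint (Marked bP Qb) (x / blen b)) => //.
  exact: qpoint_Marked.
have mS : measurable S.
  rewrite SE -[X in measurable X]setTI.
  by apply: (@measurable_funM _ _ R) => //; exact: measurable_cst.
rewrite integral_indic// setIidl; last first.
  by move=> x [_ [xP _]]; rewrite /= in_itv.
by have := lebesgue_scale b0 mq01; rewrite unif_oitv// -SE.
Qed.

Definition mweight (x : marked) : R := blen (mbond x) / (2 * total_length (mgraph x)).

Lemma mweight_ge0 x : 0 <= mweight x.
Proof.
rewrite /mweight divr_ge0 ?mulr_ge0 ?total_length_ge0//.
by have /andP[/(le_trans (ltW m_gt0))] := blen_mbond_itv x.
Qed.

Definition qlaw (x : marked) : {measure set (QDmM_borel h) -> \bar R}.
Proof.
pose mu : {measure set (QDmM_borel h) -> \bar R} :=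
  pushforward unif (qpoint x : R -> QDmM_borel h).
exact: (mu (measurable_qpoint1 x)).
Defined.

Lemma integral_qlaw x f : measurable_fun setT f -> (forall z, 0 <= f z)%E ->
  (\int[qlaw x]_z f z = \int[unif]_s f (qpoint x s))%E.
Proof.
move=> mf f0; exact: (@ge0_integral_pushforward _ _ (measurableTypeR R) (QDmM_borel h) R (qpoint x)
  (measurable_qpoint1 x) unif setT f measurableT mf).
Qed.

Section finite_nu.
Hypotheses (Qfin : finite_graph Q) (Qedge : edges Q !=set0).
Variable x0 : marked.

Definition mark (b : vert Q * vert Q) : marked :=
  if pselect (bonds Q b) is left bP then Marked bP Qb else x0.

Lemma markE b (bP : bonds Q b) : mark b = Marked bP Qb.
Proof. by rewrite /mark; case: pselect => // bP'; rewrite (Prop_irrelevance bP' bP). Qed.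

Definition marks : seq marked := [seq mark b | b <- bond_seq Q].

Lemma sum_mweight : \sum_(x <- marks) mweight x = 1.
Proof.
rewrite big_map big_seq (eq_bigr (fun b => blen b / (2 * total_length Q))).
  by rewrite -big_seq -mulr_suml sum_blen// divff// mulf_neq0// gt_eqF ?total_length_gt0.
by move=> b; rewrite (mem_bond_seq Qfin) => /set_mem bP; rewrite markE.
Qed.

Lemma nu_DmME (A : set (QDmM_borel h)) : measurable A ->
  nu_DmM h Q A = (\sum_(x <- marks) (mweight x)%:E * qlaw x A)%E.
Proof.
move=> mA; rewrite /nu_DmM /nu fsbig_finite/=; last exact: finite_bonds.
rewrite -/(bond_seq Q).
rewrite big_map big_seq [RHS]big_seq ge0_sume_distrr; last first.
  move=> b; rewrite (mem_bond_seq Qfin) => /set_mem bP; rewrite integral_bond.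
    by rewrite mule_ge0// lee_fin ltW//; apply: (len_gt0 (qgP Q)); exists b.
  by [].
apply: eq_bigr => b; rewrite (mem_bond_seq Qfin) => /set_mem bP.
by rewrite integral_bond// markE/mweight/= muleA -EFinM mulrC.
Qed.

Let mi i : {measure set (QDmM_borel h) -> \bar R} :=
  mscale (NngNum (mweight_ge0 (nth x0 marks i))) (qlaw (nth x0 marks i)).

(** Replaces the set function [nu_DmM] by a genuine measure under the integral, so that the rules of
    integration become available. *)
Lemma integral_nu_msum (f : QDmM_borel h -> \bar R) :
  (\int[nu_DmM h Q]_z f z = \int[msum mi (size marks)]_z f z)%E.
Proof.
apply: eq_integral_set_fun => A mA.
rewrite nu_DmME// (big_nth x0) big_mkord; exact: eq_bigr.
Qed.

Lemma integral_nu_DmM (f : QDmM_borel h -> \bar R) :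
  measurable_fun setT f -> (forall z, 0 <= f z)%E ->
  (\int[nu_DmM h Q]_z f z =
   \sum_(x <- marks) (mweight x)%:E * \int[unif]_s f (qpoint x s))%E.
Proof.
move=> mf f0.
rewrite integral_nu_msum ge0_integral_measure_sum// (big_nth x0) big_mkord.
apply: eq_bigr => i _.
by rewrite ge0_integral_mscale// integral_qlaw.
Qed.

Lemma integral_nu_DmME (f : QDmM_borel h -> \bar R) :
  (\int[nu_DmM h Q]_z f z =
   \int[nu_DmM h Q]_z f^\+ z - \int[nu_DmM h Q]_z f^\- z)%E.
Proof. by rewrite !integral_nu_msum integralE. Qed.

End finite_nu.

End nu_decomposition.

(** * Averages over the root position and passage to the limit *)

Section root_average.
Variables (R : realType) (D : nat) (m M : R).
Local Notation marked := (@marked R D m M).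
Hypothesis m_gt0 : 0 < m.
Hypothesis m_lt_M : m < M.
Variable h : Qstar_DmM D m M !=set0.
Local Notation qpoint := (qpoint m_gt0 h).
Local Notation leb := (@lebesgue_measure R).
Local Notation unif := (uniform_prob (@ltr01 R)).

Variables (G : QDmM h -> R) (K : R).
Hypothesis G_cont : continuous G.
Hypothesis G_itv : forall z, 0 <= G z <= K.

(** Integrating out the position turns a test function on rooted graphs into a function of marked
    graphs, the kind that [limit_law] handles. *)
Definition root_average (x : marked) : R := fine (\int[unif]_s (G (qpoint x s))%:E).

Lemma measurable_root_fun x : measurable_fun [set: R] (fun s => G (qpoint x s)).
Proof.
have mG := measurable_continuous G_cont.
exact: (measurableT_comp mG (@measurable_qpoint1 R D m M m_gt0 m_lt_M h x)).
Qed.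

Lemma root_averageE x : (\int[unif]_s (G (qpoint x s))%:E = (root_average x)%:E)%E.
Proof.
rewrite /root_average fineK// ge0_fin_numE; last first.
  by apply: integral_ge0 => s _; rewrite lee_fin; case/andP: (G_itv (qpoint x s)).
apply: (@le_lt_trans _ _ (\int[unif]_s (cst K%:E s))%E).
  apply: ge0_le_integral => //.
  - by move=> s _; rewrite lee_fin; case/andP: (G_itv (qpoint x s)).
  - by apply/measurable_EFinP; exact: measurable_root_fun.
  - by move=> s _; rewrite lee_fin; case/andP: (G_itv (qpoint x s)).
rewrite integral_cst// [X in (_ * X)%E]probability_setT mule1 ltry//.
Qed.

Lemma root_average_itv x : 0 <= root_average x <= K.
Proof.
rewrite -!lee_fin -root_averageE; apply/andP; split.
  by apply: integral_ge0 => s _; rewrite lee_fin; case/andP: (G_itv (qpoint x s)).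
apply: (@le_trans _ _ (\int[unif]_s (cst K%:E s))%E).
  apply: ge0_le_integral => //.
  - by move=> s _; rewrite lee_fin; case/andP: (G_itv (qpoint x s)).
  - by apply/measurable_EFinP; exact: measurable_root_fun.
  - by move=> s _; rewrite lee_fin; case/andP: (G_itv (qpoint x s)).
by rewrite integral_cst// [X in (_ * X)%E]probability_setT mule1.
Qed.

(** For each [s] the integrand converges: by continuity of [G] if [0 < s < 1], and otherwise because
    [qpoint] is the base point. The constant [K] dominates. *)
Lemma root_average_continuous : coordwise_continuous (@mcoord R D m M) root_average.
Proof.
move=> x_ y xy.
pose f_ k s := (G (qpoint (x_ k) s))%:E.
pose f s := (G (qpoint y s))%:E.
have mf_ k : measurable_fun [set: R] (f_ k).
  by apply/measurable_EFinP; exact: measurable_root_fun.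
have mf : measurable_fun [set: R] f.
  by apply/measurable_EFinP; exact: measurable_root_fun.
have [|||_ _ H] := @dominated_convergence _ _ R unif setT measurableT f_ f (cst K%:E) mf_ mf.
  - apply: aeW => s _; apply: cvg_EFin; first exact: nearW.
    have [s01|s01] := pselect (0 < s < 1).
      exact: (@continuous_qpoint R D m M m_gt0 m_lt_M h R G x_ y
        (fun=> s) s G_cont xy _ s01 (cvg_cst _)).
    have out x : G (qpoint x s) = G (QDmM_point h) by rewrite /qpoint; case: pselect.
    rewrite out (_ : _ \o _ = cst (G (QDmM_point h))); first exact: cvg_cst.
    by apply/funext => k; rewrite /f_/= out.
  - by apply: finite_measure_integrable_cst.
  - apply: aeW => s n _; rewrite /f_ lee_fin ger0_norm//; by case/andP: (G_itv (qpoint (x_ n) s)).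
apply/fine_cvg; rewrite -/(root_average y) -root_averageE.
exact: H.
Qed.

End root_average.

Section limit_of_nu.
Variables (R : realType) (D : nat) (m M : R).
Local Notation marked := (@marked R D m M).
Hypothesis m_gt0 : 0 < m.
Hypothesis m_lt_M : m < M.
Variable h : Qstar_DmM D m M !=set0.
Local Notation qpoint := (qpoint m_gt0 h).
Local Notation leb := (@lebesgue_measure R).
Local Notation unif := (uniform_prob (@ltr01 R)).
Local Notation mR := (measurableTypeR R).

Section limit_probability.
Variable X : R -> marked.
Hypothesis mX : forall i,
  measurable_fun (`[0%R, 1%R[%classic : set R) (@mcoord R D m M i \o X).

Let E : set (mR * mR) := `[0, 1[ `*` `]0, 1[.

Definition limit_root (u : mR * mR) : QDmM_borel h :=
  if u \in E then qpoint (X u.1) u.2 else QDmM_point h.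

Lemma measurable_limit_root : measurable_fun [set: mR * mR] limit_root.
Proof.
apply: (measurable_qpoint _ m_lt_M (E := E) (X := X \o fst) (S := snd)).
- exact: measurableX.
- move=> i; have fE : fst @` E `<=` (`[0, 1[%classic : set mR).
    by move=> _ [[u v] [uE _] <-].
  have mfst : measurable_fun E (fst : mR * mR -> mR).
    by apply: measurable_funTS; exact: measurable_fst.
  have mI : measurable (`[0, 1[%classic : set mR) by [].
  exact: (@measurable_comp _ _ _ (mR * mR)%type mR R _ (mcoord i \o X) E fst mI fE (mX i) mfst).
- by apply: measurable_funTS; exact: measurable_snd.
- by move=> [u v] [_]; rewrite /= in_itv.
Qed.

HB.instance Definition _ := isMeasurableFun.Build _ _ _ _ limit_root measurable_limit_root.

Definition limit_prob : probability (QDmM_borel h) R :=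
  distribution (unif \x unif)%E limit_root.

(** By Tonelli, integrating over [s] first gives the root average at [X u], whose integral is the
    limit in [limit_law]. *)
Lemma integral_limit_prob (G : QDmM h -> R) (K : R) : continuous G ->
  (forall z, 0 <= G z <= K) ->
  (\int[limit_prob]_z (G z)%:E = \int[leb]_(u in `[0%R, 1%R[) (root_average m_gt0 G (X u))%:E)%E.
Proof.
move=> Gc GK; have G0 z : (0 <= (G z)%:E)%E by rewrite lee_fin; case/andP: (GK z).
have mG : measurable_fun [set: QDmM_borel h] (EFin \o G).
  by apply/measurable_EFinP; exact: measurable_continuous.
have mGZ := measurableT_comp mG measurable_limit_root.
rewrite ge0_integral_distribution// fubini_tonelli1//; last by move=> x; exact: G0.
rewrite integral_unif; last 2 first.
- by apply: measurable_fun_fubini_tonelli_F => // x; exact: G0.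
- by move=> x; apply: integral_ge0 => y _; exact: G0.
apply: eq_integral => u /set_mem u01.
rewrite -(root_averageE m_gt0 m_lt_M Gc GK); apply: eq_integral => s _ /=.
rewrite /limit_root; case: ifPn => //; rewrite notin_setE => sE.
rewrite /qpoint/=; case: pselect => // s01; exfalso; apply: sE.
by split => //=; rewrite in_itv.
Qed.

End limit_probability.

Variable Q : nat -> quantum_graph R.
Hypothesis Q_finite : forall N, finite_graph (Q N).
Hypothesis Q_edge : forall N, edges (Q N) !=set0.
Hypothesis Q_bounds : forall N, DmM_bounds D m M (Q N).

Lemma marked_exists : exists x : marked, True.
Proof. by have [_ [b bP _]] := Q_edge 0; exists (Marked bP (Q_bounds 0)). Qed.

(** For a nonnegative test function the integral against [nu_DmM] is the mean of its root average
    with weights [mweight], so [limit_law] applies. *)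
Lemma nu_subsequence : exists2 s : nat -> nat, {homo s : j k / (j < k)%N} &
  exists P : probability (QDmM_borel h) R, forall (G : QDmM h -> R) (K : R),
    continuous G -> (forall z, 0 <= G z <= K) ->
    (\int[P]_z (G z)%:E)%E \is a fin_num /\
    (fun k => \int[nu_DmM h (Q (s k))]_z (G z)%:E)%E @ \oo --> (\int[P]_z (G z)%:E)%E.
Proof.
have [x0 _] := marked_exists.
have [s s_incr [X [mX XP]]] := @limit_law R marked (@mcoord R D m M) (fun=> 1 + D%:R + M)
  (@mcoord_bound R D m M m_gt0 m_lt_M) (@limit_marked R D m M m_gt0 m_lt_M)
  (fun N => marks (Q_bounds N) x0) (fun=> @mweight R D m M) (fun=> mweight_ge0 m_gt0)
  (fun N => etrans (eq_bigr _ (fun _ _ => mulr1 _)) (sum_mweight _ (Q_finite N) (Q_edge N) x0)).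
exists s => //; exists (limit_prob mX) => G K Gc GK.
have G0 z : (0 <= (G z)%:E)%E by rewrite lee_fin; case/andP: (GK z).
have mG : measurable_fun [set: QDmM_borel h] (EFin \o G).
  by apply/measurable_EFinP; exact: measurable_continuous.
have [|_] := XP _ (@root_average_continuous R D m M m_gt0 m_lt_M h G K Gc GK).
  by exists K => x; have /andP[? ?] := root_average_itv m_gt0 m_lt_M Gc GK x; rewrite ger0_norm.
rewrite -[X in _ --> X](integral_limit_prob mX Gc GK) => XG; split.
  rewrite ge0_fin_numE ?integral_ge0//.
  apply: (@le_lt_trans _ _ (\int[limit_prob mX]_z (cst K%:E z))%E).
    by apply: ge0_le_integral => // z _; rewrite lee_fin; case/andP: (GK z).
  by rewrite integral_cst// [X in (_ * X)%E]probability_setT mule1 ltry.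
apply: cvg_trans XG; apply: near_eq_cvg; apply: nearW => k.
rewrite (integral_nu_DmM m_gt0 m_lt_M (Q_bounds (s k)) (Q_finite (s k)) x0 mG)//.
rewrite /mean -sumEFin; apply: eq_bigr => x _.
by rewrite EFinM -(root_averageE m_gt0 m_lt_M Gc GK).
Qed.

(** In [nu_subsequence] neither [s] nor [P] depends on [G], so they serve the positive and negative
    parts of [F] at once; the limits are finite and can be subtracted. *)
Lemma nu_subsequence_real : exists2 s : nat -> nat, {homo s : j k / (j < k)%N} &
  exists P : probability (QDmM_borel h) R, forall (F : QDmM h -> R) (K : R),
    continuous F -> (forall z, `|F z| <= K) ->
    (fun k => fine (\int[nu_DmM h (Q (s k))]_z (F z)%:E)) @ \oo -->
      fine (\int[P]_z (F z)%:E).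
Proof.
have [x0 _] := marked_exists; have [s s_incr [P HP]] := nu_subsequence.
exists s => //; exists P => F K Fc FK.
have pos (G : QDmM h -> R) : continuous G -> (forall z, `|G z| <= K) ->
    continuous (fun z => Num.max (G z) 0) /\ forall z, 0 <= Num.max (G z) 0 <= K.
  move=> Gc GK; split=> z.
    by apply: (@continuous_max R _ G (cst 0) z); [exact: Gc|exact: (@cst_continuous _ R^o)].
  rewrite le_max lexx orbT ge_max (le_trans _ (GK z)) ?ler_norm//=.
  exact: le_trans (normr_ge0 _) (GK z).
have [pc pK] := pos _ Fc FK.
have [|z|nc nK] := pos (fun z => - F z).
- by move=> z; exact: (@cvgN R R^o _ (nbhs z) _ F (F z) (@Fc z)).
- by rewrite normrN.
have [p_fin p_cvg] := HP _ K pc pK; have [n_fin n_cvg] := HP _ K nc nK.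
have posE : ((EFin \o F)^\+ = (fun z => (Num.max (F z) 0)%:E))%E.
  by apply/funext => z; rewrite funeposE/= EFin_max.
have negE : ((EFin \o F)^\- = (fun z => (Num.max (- F z)%R 0)%:E))%E.
  by apply/funext => z; rewrite funenegE/= EFin_max.
have -> : (\int[P]_z (F z)%:E =
    \int[P]_z (Num.max (F z) 0)%:E - \int[P]_z (Num.max (- F z) 0)%:E)%E.
  by rewrite integralE posE negE.
have pn_fin : (\int[P]_z (Num.max (F z) 0)%:E - \int[P]_z (Num.max (- F z) 0)%:E)%E \is a fin_num.
  by rewrite fin_numB; apply/andP.
apply: fine_cvg; rewrite fineK//.
rewrite (_ : (fun k => _) = (fun k => \int[nu_DmM h (Q (s k))]_z (Num.max (F z) 0)%:E -
    \int[nu_DmM h (Q (s k))]_z (Num.max (- F z) 0)%:E)%E).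
  by apply: cvgeB => //; exact: fin_num_adde_defr.
apply/funext => k.
by rewrite (integral_nu_DmME m_gt0 m_lt_M (Q_bounds (s k)) (Q_finite (s k)) x0) posE negE.
Qed.

Lemma nu_subsequence_complex : exists2 s : nat -> nat, {homo s : j k / (j < k)%N} &
  exists P : probability (QDmM_borel h) R,
  forall F : QDmM h -> R[i]^o, bounded_fun F -> continuous F ->
    (fun k => cintegral (nu_DmM h (Q (s k))) F : R[i]^o) @ \oo -->
      (cintegral P F : R[i]^o).
Proof.
have [s s_incr [P HP]] := nu_subsequence_real.
exists s => //; exists P => F [B [Breal FB]] Fc.
have [K FK] : exists K : R, forall z, cabs (F z) <= K.
  (* [bounded_fun] bounds the norm by every number above [B]. Norms of complex values are themselves
     complex, so the bound [K] is a real part. *)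
  have /FB {}FB : B < B + 1 by rewrite ltrDl.
  exists (complex.Re (B + 1)) => z; have /= := FB z I.
  by rewrite normC_cabs lecE /= => /andP[].
apply/cvg_complexP; split.
  apply: (HP (fun z => complex.Re (F z)) K) => [z|z].
    by have /cvg_complexP[] := Fc z.
  exact: le_trans (Re_le_cabs _) (FK z).
apply: (HP (fun z => complex.Im (F z)) K) => [z|z].
  by have /cvg_complexP[] := Fc z.
exact: le_trans (Im_le_cabs _) (FK z).
Qed.

End limit_of_nu.

Unset Implicit Arguments.

Theorem corollary3p7 (R : realType) (D : nat) (m M : R) (m_gt0 : 0 < m)
    (m_lt_M : m < M) (Q : nat -> quantum_graph R)
    (Q_finite : forall N, finite_graph (Q N))
    (Q_edge : forall N, edges (Q N) !=set0)
    (Q_bounds : forall N, DmM_bounds D m M (Q N)) :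
  let h := Qstar_DmM_neq0 (Q_bounds 0%N) (Q_edge 0%N) in
  exists s : nat -> nat, {homo s : j k / (j < k)%N} /\
  exists P : probability (QDmM_borel h) R,
  forall F : QDmM h -> R[i]^o, bounded_fun F -> continuous F ->
    (fun k => cintegral (nu_DmM h (Q (s k))) F : R[i]^o) @ \oo -->
      (cintegral P F : R[i]^o).
Proof.
move=> h; have [s s_incr HP] := nu_subsequence_complex m_gt0 m_lt_M h Q_finite Q_edge Q_bounds.
by exists s.
Qed.
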